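(* Let $N\ge 1$, let $D\subseteq\mathbb{C}$ be a domain, let $\mathcal{F}$ be a family of holomorphic maps of $D$ into $\mathbb{P}^N(\mathbb{C})$ (each $f=[f_0:\cdots:f_N]\in\mathcal{F}$ having $f_0\not\equiv 0$), and let $\delta$ be a real number with $0<\delta<1$. Suppose that for each $f\in\mathcal{F}$ there exist $2N+1$ moving hyperplanes $H_1^f,\dots,H_{2N+1}^f$ of $\mathbb{P}^N(\mathbb{C})$ on $D$ such that for every $f\in\mathcal{F}$ and every $z\in D$ the hyperplanes $H_1^f(z),\dots,H_{2N+1}^f(z)$ are in general position with $$\mathcal{D}\big(H_1^f(z),\dots,H_{2N+1}^f(z)\big)>\delta ,$$ and such that for every $f\in\mathcal{F}$ and every $z\in D$ the following conditions are satisfied: (i) If $\nabla f(z)\in H_j^f(z)$, then $f(z)\in H_j^f(z)$, for $j=1,\dots,2N+1$. (ii) If $f(z)\in\bigcup_{j=1}^{2N+1}H_j^f(z)$, then $$\frac{|\langle f(z),H_0\rangle|}{\|f(z)\|\cdot\|H_0\|}\ge\delta ,$$ where $H_0=\{x_0=0\}$ is a coordinate hyperplane. (iii) If $f(z)\in\bigcup_{j=1}^{2N+1}H_j^f(z)$, then $$\frac{|\langle\nabla f(z),H_k^f(z)\rangle|}{|f_0(z)|^2}\le\frac1\delta\qquad\text{for } k=1,\dots,2N+1 .$$ Then $\mathcal{F}$ is normal in $D$.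
   Context: Reduced representations. For a holomorphic map $f:D\to\mathbb{P}^N(\mathbb{C})$, a reduced representation is a tuple $\tilde f=(f_0,\dots,f_N)$ of holomorphic functions on $D$ without common zeros such that $f(z)=[f_0(z):\cdots:f_N(z)]$ for all $z\in D$. Every such $f$ has one on $D$, and two of them differ by a nowhere zero holomorphic factor. For each $f$ fix a reduced representation, written $f=[f_0:\cdots:f_N]$; put $\|f(z)\|=\|\tilde f(z)\|=\big(\sum_{i=0}^N|f_i(z)|^2\big)^{1/2}$. All conditions in the claim are independent of this choice. Hyperplanes. A hyperplane in $\mathbb{P}^N(\mathbb{C})$ is $H=\{[x_0:\cdots:x_N] : a_0x_0+\cdots+a_Nx_N=0\}$ with $\alpha=(a_0,\dots,a_N)\in\mathbb{C}^{N+1}\setminus\{0\}$. Representations are always normalized so that $\|H\|:=\max_{0\le i\le N}|a_i|=1$. For a vector $w=(w_0,\dots,w_N)\in\mathbb{C}^{N+1}$ put $\langle w,H\rangle=a_0w_0+\cdots+a_Nw_N$ (with $\alpha$ normalized; its modulus depends only on $H$ and $w$), and write $\langle f(z),H\rangle=\langle\tilde f(z),H\rangle$. Then $f(z)\in H$ means $\langle\tilde f(z),H\rangle=0$. In particular $\langle f(z),H_0\rangle=f_0(z)$ up to a unimodular constant, and $\|H_0\|=1$. A moving hyperplane $H$ on $D$ is given by holomorphic functions $a_0,\dots,a_N$ on $D$ that do not all vanish simultaneously at any point of $D$: for $z\in D$, $H(z)$ is the hyperplane $\{[x_0:\cdots:x_N] : a_0(z)x_0+\cdots+a_N(z)x_N=0\}$.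 At each $z$ the coefficient vector of $H(z)$ is normalized (divided by $\max_i|a_i(z)|$) before $\langle\cdot,H(z)\rangle$ or $\mathcal{D}$ is evaluated. The moving hyperplanes $H_j^f$ may depend on $f$. General position. For hyperplanes $H_1,\dots,H_q$, $q\ge N+1$, with normalized coefficient vectors $\alpha_1,\dots,\alpha_q$, define $$\mathcal{D}(H_1,\dots,H_q)=\prod_{1\le j_1<\cdots<j_{N+1}\le q}\big|\det(\alpha_{j_1}^t,\dots,\alpha_{j_{N+1}}^t)\big| .$$ The hyperplanes are in general position if $\mathcal{D}(H_1,\dots,H_q)>0$. Derived map. For $f=[f_0:\cdots:f_N]$ with $f_0\not\equiv0$, let $W(f_0,f_i)=f_0f_i'-f_0'f_i$. The derived holomorphic map $\nabla f:D\to\mathbb{P}^N(\mathbb{C})$ is $$\nabla f=[f_0^2/d: W(f_0,f_1)/d:\cdots:W(f_0,f_N)/d],$$ where $d$ is a holomorphic function on $D$ such that $f_0^2/d, W(f_0,f_1)/d,\dots,W(f_0,f_N)/d$ are holomorphic without common zeros. This does not depend on the choice of reduced representation of $f$ or of $d$. The statement $\nabla f(z)\in H$ refers to this map. In condition (iii), $\langle\nabla f(z),H\rangle$ is computed with the vector $(f_0^2,W(f_0,f_1),\dots,W(f_0,f_N))(z)$; under (ii), $f_0(z)\neq0$ at such points. Normality. A family $\mathcal{F}$ of holomorphic maps $D\to\mathbb{P}^N(\mathbb{C})$ is normal in $D$ if every sequence in $\mathcal{F}$ has a subsequence converging uniformly on compact subsets of $D$ (with respect to the Fubini–Study metric) to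 a holomorphic map $D\to\mathbb{P}^N(\mathbb{C})$. *)

(* Defs.v *)
From mathcomp Require Import all_boot all_order all_algebra complex.
From mathcomp Require Import all_classical all_reals all_analysis.
Import Order.TTheory GRing.Theory Num.Theory numFieldNormedType.Exports.

Set Implicit Arguments.
Unset Strict Implicit.
Unset Printing Implicit Defensive.

Local Open Scope classical_set_scope.
Local Open Scope ring_scope.

(* The usual modulus, with values in R rather than in R[i]. *)
Notation normc := ComplexField.Normc.normc.

(* R[i] carries its topology and its structure of normed module over itself
   only under the alias R[i]^o, hence the casts below. *)

Section Holomorphy.
Context {R : realType}.
Implicit Types (D : set R[i]) (f : R[i] -> R[i]).

Definition cderiv f : R[i] -> R[i] := derive1 (f : R[i]^o -> R[i]^o).

Definition holomorphic_on D f :=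
  forall z, D z -> derivable (f : R[i]^o -> R[i]^o) z 1.

Definition cdomain D :=
  [/\ D !=set0, open (D : set R[i]^o) & connected (D : set R[i]^o)].

End Holomorphy.

(* The points of P^N(C) are the lines through the origin of C^(N+1). *)
Record projspace (R : realType) (N : nat) := ProjSpace {
  line_of :> {vspace 'rV[R[i]]_N.+1};
  _ : \dim line_of == 1%N }.

Section Projective.
Context {R : realType} {N : nat}.
Local Notation C := R[i].
Local Notation vec := 'rV[C]_N.+1.
Local Notation PN := (projspace R N).
Implicit Types (D K : set C) (f g : C -> PN) (F : C -> vec).

Definition vnorm (w : vec) : R := Num.sqrt (\sum_i normc (w 0 i) ^+ 2).

Definition herm (v w : vec) : C := \sum_i v 0 i * (w 0 i)^*%C.

(* The Fubini-Study distance is the angle between two complex lines; it does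
   not depend on the nonzero vectors that vpick chooses on them. *)
Definition fubini_study (p q : PN) : R :=
  acos (normc (herm (vpick p) (vpick q)) / (vnorm (vpick p) * vnorm (vpick q))).

(* F = (f_0, .., f_N) is holomorphic without common zeros on D, and
   f = [f_0 : .. : f_N] there. *)
Definition reduced_rep D F f :=
  (forall i, holomorphic_on D (fun z => F z 0 i)) /\
  (forall z, D z -> F z != 0 /\ line_of (f z) = <[F z]>%VS).

(* Only the values of f on D matter. *)
Definition holomorphic_map D f :=
  forall z, D z -> exists U : set C, exists F,
    [/\ open (U : set C^o), U z, U `<=` D & reduced_rep U F f].

Definition wronskian (u v : C -> C) (z : C) : C :=
  u z * cderiv v z - cderiv u z * v z.

Definition derived_vec F (z : C) : vec :=
  \row_i (if i == 0 then F z 0 0 ^+ 2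
          else wronskian (fun w => F w 0 0) (fun w => F w 0 i) z).

(* g = [derived_vec F / d] is the derived map of [f_0 : .. : f_N]. The quotient
   G = derived_vec F / d is written as derived_vec F = d G: if f_0 is not
   identically 0 on the domain D, the zeros of d are isolated and this determines
   the holomorphic extension G of the quotient. *)
Definition derived_map D F g :=
  exists (d : C -> C) (G : C -> vec),
    [/\ holomorphic_on D d, reduced_rep D G g &
        forall z, D z -> derived_vec F z = d z *: G z].

(* Hyperplanes are given by nonzero coefficient vectors a. *)
Definition pairing (w a : vec) : C := \sum_i a 0 i * w 0 i.

Definition hyperplane (a : vec) : set PN :=
  [set p | forall w, w \in line_of p -> pairing w a = 0].

Definition hnorm (a : vec) : R := \big[Num.max/0]_i normc (a 0 i).

Definition hnormalize (a : vec) : vec := ((hnorm a)^-1)%:C%C *: a.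

Definition H0 : vec := delta_mx 0 0.

(* The product ranges over the increasing maps s from 'I_N.+1 to 'I_q. *)
Definition hyperplane_prod (q : nat) (a : 'I_q -> vec) : R :=
  \prod_(s : {ffun 'I_N.+1 -> 'I_q} |
          [forall i : 'I_N.+1, forall j : 'I_N.+1, (i < j)%N ==> (s i < s j)%N])
    normc (\det (\matrix_(i, k) hnormalize (a (s k)) 0 i)).

Definition general_position (q : nat) (a : 'I_q -> vec) :=
  0 < hyperplane_prod a.

Definition moving_hyperplane D (a : C -> vec) :=
  (forall i, holomorphic_on D (fun z => a z 0 i)) /\
  (forall z, D z -> a z != 0).

Definition cvg_locally_uniformly D (u : nat -> C -> PN) g :=
  forall K, compact (K : set C^o) -> K `<=` D ->
  forall e : R, 0 < e ->
    \forall n \near \oo, forall z, K z -> fubini_study (u n z) (g z) < e.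

Definition normal_family D (Fam : set (C -> PN)) :=
  forall u : nat -> C -> PN, (forall n, Fam (u n)) ->
  exists (phi : nat -> nat) (g : C -> PN),
    [/\ {homo phi : m n / (m < n)%N}, holomorphic_map D g &
        cvg_locally_uniformly D (u \o phi) g].

End Projective.

Arguments H0 {R N}.

(* Main.v *)
(* Suppose that the spherical derivatives of a sequence in the family are
   unbounded near a point of D. Rescaling at points that maximise the spherical
   derivative weighted by the distance to the boundary of a disc (Zalcman)
   gives curves of bounded spherical derivative on larger and larger discs,
   normalised to have spherical derivative 1 at 0, hence, by Marty's criterion,
   a nonconstant limit curve G : C -> P^N. The lower bound on D(H_1, .., H_q)
   makes the rescaled moving hyperplanes converge to fixed ones a_1, .., a_q in
   general position, q = 2N+1. Where G meets some a_j without staying in it,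
   Hurwitz's theorem carries (ii) and (iii) to the limit: there G_0 does not
   vanish and the derivative x' of x = G/G_0 is orthogonal to all the a_l. By
   Hurwitz's theorem and (i), a function <x', a_l> that does not vanish
   identically forces <x, a_l> = 0 at that point, which is possible for at most
   N of the 2N+1 indices; so x' = 0 and G is constant, a contradiction. Hence G
   is contained in a_j or omits it, for every j. But then G is constant: the
   nonvanishing <G, a_j> are of the form c exp(p_j), the bounded spherical
   derivative makes the p_j quadratic polynomials, and, at each point, at least
   N+1 of the |<G, a_j>| being comparable to |G| forces the p_j to be equal up
   to constants. So the spherical derivatives are locally bounded, and Marty's
   criterion gives the normality. *)
Require Import Defs.
From mathcomp Require Import all_boot all_order all_algebra complex.
From mathcomp Require Import all_classical all_reals all_analysis.
From mathcomp Require Import fingroup perm ring lra.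
Import Order.TTheory GRing.Theory Num.Theory numFieldNormedType.Exports.
Local Open Scope classical_set_scope.
Local Open Scope ring_scope.
Set Implicit Arguments.
Unset Strict Implicit.
Unset Printing Implicit Defensive.
Local Notation Re := complex.Re.
Local Notation Im := complex.Im.
Import ComplexField.Normc.

(** Nothing bounds the moving hyperplanes except general position, and normalising their
    coefficients destroys holomorphy. As 2N+1 is at least N+2, a quotient of minors gives a
    holomorphic function comparable to a power of the norm of the coefficients; this makes their
    ratios Lipschitz on discs of uniform size. The limit curve [G] is defined only up to a scalar at
    each point: its ratios are locally holomorphic, [G] itself need not be, so it is divided by a
    nonvanishing pairing before logarithms are taken. That the exponents are quadratic comes from a
    maximum principle: a bounded spherical derivative bounds the Laplacian of log |h|^2 from above,
    so for suitable [K] and every entire [q] the function |exp q|^2 exp (2K |z|^2) / |h|^2 has no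
    interior maximum; a suitable [q] isolates one Taylor coefficient of the exponent. The number
    2N+1 is what makes two sets of more than N indices meet, so that exponents can be compared at
    two points through one index. *)

Section Modulus.
Context {R : realType}.
Local Notation C := R[i].
Implicit Types (z w : C) (x y : R).

Lemma normcE z : (normc z)%:C%C = `|z|. Proof. by case: z. Qed.

Lemma normc_ge0 z : 0 <= normc z. Proof. by case: z => a b /=; exact: sqrtr_ge0. Qed.

Lemma normc_eq0 z : (normc z == 0) = (z == 0).
Proof. by apply/eqP/eqP => [/eq0_normc //|->]; exact: normc0. Qed.

Lemma normc_gt0 z : (0 < normc z) = (z != 0).
Proof. by rewrite lt_neqAle normc_ge0 andbT eq_sym normc_eq0. Qed.

Lemma ler_normcD z w : normc (z + w) <= normc z + normc w.
Proof. by rewrite -lecR rmorphD /= !normcE; exact: ler_normD. Qed.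

Lemma normcN z : normc (- z) = normc z.
Proof. by apply: complexI; rewrite !normcE normrN. Qed.

Lemma normcBC z w : normc (z - w) = normc (w - z).
Proof. by rewrite -normcN opprB. Qed.

Lemma ler_normcB z w : normc (z - w) <= normc z + normc w.
Proof. by rewrite -(normcN w) ler_normcD. Qed.

Lemma ler_normc_sub z w : normc z - normc w <= normc (z - w).
Proof. by rewrite lerBlDr -{1}(subrK w z) ler_normcD. Qed.

Lemma normc_triangle z u w : normc (z - w) <= normc (z - u) + normc (u - w).
Proof. by rewrite -{1}(subrK u z) -addrA ler_normcD. Qed.

Lemma normcX z n : normc (z ^+ n) = normc z ^+ n.
Proof. by elim: n => [|n IH]; rewrite ?expr0 ?normc1 // !exprS normcM IH. Qed.

Lemma normcR x : normc x%:C%C = `|x|.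
Proof. by rewrite /normc /= expr0n addr0 sqrtr_sqr. Qed.

Lemma normc_div z w : normc (z / w) = normc z / normc w.
Proof. by rewrite normcM normcV. Qed.

Lemma normci : normc ('i%C : C) = 1.
Proof. by rewrite /= expr0n add0r expr1n sqrtr1. Qed.

Lemma normcJ z : normc z^*%C = normc z.
Proof. by case: z => a b /=; rewrite sqrrN. Qed.

Lemma sqr_normcE z : (normc z) ^+ 2 = Re z ^+ 2 + Im z ^+ 2.
Proof. by case: z => a b /=; rewrite sqr_sqrtr // addr_ge0 ?sqr_ge0. Qed.

Lemma normc_Re z : `|Re z| <= normc z.
Proof.
rewrite -(@ler_pXn2r _ 2%N) ?nnegrE ?normc_ge0 // sqr_normcE real_normK ?num_real //.
by rewrite lerDl sqr_ge0.
Qed.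

Lemma normc_Im z : `|Im z| <= normc z.
Proof.
rewrite -(@ler_pXn2r _ 2%N) ?nnegrE ?normc_ge0 // sqr_normcE real_normK ?num_real //.
by rewrite lerDr sqr_ge0.
Qed.

Lemma normc_le_ReIm z : normc z <= `|Re z| + `|Im z|.
Proof.
rewrite -(@ler_pXn2r _ 2%N) ?nnegrE ?addr_ge0 ?normc_ge0 //.
rewrite sqr_normcE sqrrD !real_normK ?num_real //.
by rewrite addrAC lerDl mulrn_wge0 ?mulr_ge0.
Qed.

Lemma normc_ReB z w : `|Re z - Re w| <= normc (z - w).
Proof. by case: z w => a b [c d]; exact: (normc_Re ((a +i* b) - (c +i* d))%C). Qed.

Lemma normc_ImB z w : `|Im z - Im w| <= normc (z - w).
Proof. by case: z w => a b [c d]; exact: (normc_Im ((a +i* b) - (c +i* d))%C). Qed.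

Lemma normc_sum (I : Type) (r : seq I) (P : pred I) (F : I -> C) :
  normc (\sum_(i <- r | P i) F i) <= \sum_(i <- r | P i) normc (F i).
Proof.
elim/big_ind2: _ => [|u x v y ux vy|//]; first by rewrite normc0.
exact: (le_trans (ler_normcD _ _) (lerD ux vy)).
Qed.

Lemma normc_prod (I : Type) (r : seq I) (P : pred I) (F : I -> C) :
  normc (\prod_(i <- r | P i) F i) = \prod_(i <- r | P i) normc (F i).
Proof. by elim/big_ind2: _ => [|u x v y <- <-|//]; rewrite ?normc1 ?normcM. Qed.

Lemma gt0_complexE (e : C) : 0 < e -> e = (Re e)%:C%C /\ 0 < Re e.
Proof. by case: e => a b; rewrite ltcE /= => /andP[/eqP -> ->]. Qed.

End Modulus.

(** * Epsilon arguments and real induction *)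

Section Order.
Context {R : realType}.

Lemma dist_itv_le (x u v a : R) : x <= u <= x + a -> x <= v <= x + a -> `|u - v| <= a.
Proof. by move=> /andP[? ?] /andP[? ?]; rewrite ler_norml; apply/andP; split; lra. Qed.

Lemma le_of_all_eps (x y : R) : (forall e, 0 < e -> x <= y + e) -> x <= y.
Proof. by move=> H; apply/ler_addgt0Pr. Qed.

Lemma le0_of_all_eps (K x : R) : (forall e, 0 < e -> x <= e * K) -> x <= 0.
Proof.
move=> H; apply: le_of_all_eps => e e0; rewrite add0r.
have K0 : 0 < `|K| + 1 by rewrite ltr_wpDl.
apply: le_trans (H (e / (`|K| + 1)) _) _; first by rewrite divr_gt0.
rewrite -mulrA ger_pMr // mulrC ler_pdivrMr // mul1r.
by apply: le_trans (ler_norm K) _; rewrite lerDl.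
Qed.

(* The supremum of the [t] such that [P] holds on [a, t] is attained by the
   first hypothesis and equal to [b] by the second one. *)
Lemma real_induction (a b : R) (P : R -> Prop) : a <= b -> P a ->
  (forall t, a < t <= b -> (forall s, a <= s < t -> P s) -> P t) ->
  (forall t, a <= t < b -> (forall s, a <= s <= t -> P s) ->
     exists2 d, 0 < d & forall s, t < s < t + d -> P s) ->
  P b.
Proof.
move=> ab Pa Pcl Pop.
pose S := [set t | a <= t <= b /\ forall s, a <= s <= t -> P s].
have Sa : S a.
  split; first by rewrite lexx ab.
  by move=> s /le_anti <-.
have Sub : ubound S b by move=> t [/andP[]].
have hS : has_sup S by split; [exists a | exists b].
have as_ : a <= sup S by apply: ub_le_sup => //; exists b.
have sb : sup S <= b by apply: ge_sup => //; exists a.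
have Plt s : a <= s < sup S -> P s.
  move=> /andP[a_s ss].
  have e0 : 0 < sup S - s by rewrite subr_gt0.
  have [t [_ Pt]] := sup_adherent e0 hS.
  by rewrite opprB addrC subrK => st; apply: Pt; rewrite a_s ltW.
have Psup : P (sup S).
  move: as_; rewrite le_eqVlt => /predU1P[<-//|as_].
  by apply: Pcl => //; rewrite as_ sb.
have Ple s : a <= s <= sup S -> P s.
  by move=> /andP[a_s]; rewrite le_eqVlt => /predU1P[->//|ss]; apply: Plt; rewrite a_s.
move: sb; rewrite le_eqVlt => /predU1P[<-//|sb].
have [||d d0 Pd] := Pop (sup S); rewrite ?as_ //.
pose t := Num.min b (sup S + d / 2).
have st : sup S < t by rewrite lt_min sb ltrDl divr_gt0.
suff /(ub_le_sup (ex_intro _ b Sub)) : S t by rewrite leNgt st.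
split; first by rewrite (le_trans as_ (ltW st)) ge_min lexx.
move=> s /andP[a_s s_t]; have [ss|ss] := leP s (sup S); first by apply: Ple; rewrite a_s.
apply: Pd; rewrite ss /= (le_lt_trans s_t) // gt_min; apply/orP; right.
by rewrite ltrD2l ltr_pdivrMr // ltr_pMr // ltr1n.
Qed.

End Order.

#[global] Arguments ComplexField.Normc.normc : simpl never.

(** * Complex differentiability in epsilon-delta form *)

Section Differentiability.
Context {R : realType}.
Local Notation C := R[i].
Implicit Types (f g : C -> C) (z w l m h : C) (D : set C).

Definition disc (a : C) (r : R) : set C := [set z | normc (z - a) < r].

(** The derivative without a quotient, so that [h = 0] is no special case; the weak inequality
    survives passages to the limit. *)
Definition cdiff f z l := forall e : R, 0 < e -> exists2 d : R, 0 < d &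
  forall h, normc h < d -> normc (f (z + h) - f z - l * h) <= e * normc h.

Definition ccont f z := forall e : R, 0 < e -> exists2 d : R, 0 < d &
  forall h, normc h < d -> normc (f (z + h) - f z) <= e.

Lemma cnbhsP (P : set C) z : nbhs (z : C^o) P <-> exists2 d : R, 0 < d & disc z d `<=` P.
Proof.
split.
  move=> /(@nbhs_normP _ C^o)[e /= /gt0_complexE[-> e0] eP].
  exists (Re e) => // w; rewrite /disc /= => zw; apply: eP.
  by rewrite /ball_ /= distrC -normcE ltcR.
move=> [d d0 dP]; apply/(@nbhs_normP _ C^o); exists d%:C%C; first by rewrite /= ltcR.
by move=> w; rewrite /ball_ /= distrC -normcE ltcR => zw; exact: dP.
Qed.

(** The bridge to the [derivable] of the statement: the calculus rules are inherited from
    [is_derive], while estimates are made with [cdiff]. *)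
Lemma cdiff_is_derive f z l : cdiff f z l <-> is_derive (z : C^o) 1 (f : C^o -> C^o) l.
Proof.
have key : cdiff f z l <->
    (h^-1 *: ((f \o shift (z : C^o)) (h *: (1 : C^o)) - f z : C^o) @[h --> (0 : C^o)^'] --> (l : C^o)).
  split.
    move=> fl; apply/cvgrPdist_le => e /gt0_complexE[-> e0].
    have [d d0 dP] := fl _ e0.
    rewrite near_withinE; apply/cnbhsP; exists d => //= h; rewrite /disc /= subr0 => hd h0.
    rewrite -normcE lecR -(ler_pM2r (_ : 0 < normc h)) ?normc_gt0 // -normcM.
    suff -> : (l - h^-1 *: (f (h *: (1 : C^o) + z) - f z : C^o)) * h = - (f (z + h) - f z - l * h).
      by rewrite normcN dP.
    rewrite /GRing.scale /= mulr1 (addrC h z); field.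
    exact: h0.
  move=> /cvgrPdist_le H e e0.
  have /H : 0 < e%:C%C :> C by rewrite ltcR.
  rewrite near_withinE => /cnbhsP[d d0 dP]; exists d => // h hd.
  have [->|h0] := eqVneq h 0; first by rewrite addr0 subrr mulr0 subrr normc0 mulr0.
  have := dP h; rewrite /disc /= subr0 => /(_ hd h0).
  rewrite -normcE lecR -(ler_pM2r (_ : 0 < normc h)) ?normc_gt0 // -normcM.
  suff -> : (l - h^-1 *: (f (h *: (1 : C^o) + z) - f z : C^o)) * h = - (f (z + h) - f z - l * h).
    by rewrite normcN.
  rewrite /GRing.scale /= mulr1 (addrC h z); field.
  exact: h0.
split.
  move=> /key H; apply: DeriveDef; first by apply/cvg_ex; exists l.
  by apply/cvg_lim => //; exact: norm_hausdorff.
by move=> [dv dE]; apply/key; rewrite -dE; exact: dv.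
Qed.

Lemma cdiff_derivable f z l : cdiff f z l -> derivable (f : C^o -> C^o) z 1.
Proof. by move=> /cdiff_is_derive[]. Qed.

Lemma cdiff_cderiv f z l : cdiff f z l -> cderiv f z = l.
Proof. by move=> /cdiff_is_derive[_ <-]; rewrite /cderiv derive1E. Qed.

Lemma derivable_cdiff f z : derivable (f : C^o -> C^o) z 1 -> cdiff f z (cderiv f z).
Proof. by move=> df; apply/cdiff_is_derive; rewrite /cderiv derive1E; exact: derivableP. Qed.

Lemma cdiff_cst l z : cdiff (fun=> l) z 0.
Proof. by apply/cdiff_is_derive; exact: is_derive_cst. Qed.

Lemma cdiff_id z : cdiff id z 1.
Proof. by apply/cdiff_is_derive; exact: is_derive_id. Qed.

Lemma cdiffD f g z l m : cdiff f z l -> cdiff g z m -> cdiff (fun w => f w + g w) z (l + m).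
Proof. by move=> /cdiff_is_derive fl /cdiff_is_derive gm; apply/cdiff_is_derive; exact: is_deriveD. Qed.

Lemma cdiffN f z l : cdiff f z l -> cdiff (fun w => - f w) z (- l).
Proof. by move=> /cdiff_is_derive fl; apply/cdiff_is_derive; exact: is_deriveN. Qed.

Lemma cdiffB f g z l m : cdiff f z l -> cdiff g z m -> cdiff (fun w => f w - g w) z (l - m).
Proof. by move=> fl gm; apply: cdiffD => //; exact: cdiffN. Qed.

Lemma cdiffM f g z l m : cdiff f z l -> cdiff g z m ->
  cdiff (fun w => f w * g w) z (f z * m + g z * l).
Proof. by move=> /cdiff_is_derive fl /cdiff_is_derive gm; apply/cdiff_is_derive; exact: is_deriveM. Qed.

Lemma cdiff_ccont f z l : cdiff f z l -> ccont f z.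
Proof.
move=> fl e e0; have [d d0 dP] := fl 1 ltr01.
have L0 : 0 < 1 + normc l by rewrite ltr_pwDl // normc_ge0.
exists (Num.min d (e / (1 + normc l))); first by rewrite lt_min d0 divr_gt0.
move=> h; rewrite lt_min => /andP[hd he].
rewrite -(subrK (l * h) (f (z + h) - f z)) (le_trans (ler_normcD _ _)) //.
rewrite (le_trans (lerD (dP _ hd) (lexx _))) // normcM -mulrDl mulrC -ler_pdivlMr //.
exact: ltW.
Qed.

Lemma cdiff_lip f z l : cdiff f z l -> exists2 d : R, 0 < d &
  forall h, normc h < d -> normc (f (z + h) - f z) <= (1 + normc l) * normc h.
Proof.
move=> fl; have [d d0 dP] := fl 1 ltr01; exists d => // h hd.
rewrite -(subrK (l * h) (f (z + h) - f z)) (le_trans (ler_normcD _ _)) //.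
by rewrite (le_trans (lerD (dP _ hd) (lexx _))) // normcM -mulrDl.
Qed.

Lemma cdiff_comp f g z l m : cdiff g z m -> cdiff f (g z) l -> cdiff (f \o g) z (l * m).
Proof.
move=> gm fl e e0.
have M0 : 0 < 1 + normc m by rewrite ltr_pwDl // normc_ge0.
have L0 : 0 < 1 + normc l by rewrite ltr_pwDl // normc_ge0.
have e1 : 0 < e / 2 / (1 + normc m) by rewrite !divr_gt0.
have e2 : 0 < e / 2 / (1 + normc l) by rewrite !divr_gt0.
have [d1 d10 d1P] := fl _ e1; have [d2 d20 d2P] := gm _ e2.
have [d3 d30 d3P] := cdiff_lip gm.
exists (Num.min d2 (Num.min d3 (d1 / (1 + normc m)))); first by rewrite !lt_min d20 d30 divr_gt0.
move=> h; rewrite !lt_min => /and3P[h2 h3 h1].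
set k := g (z + h) - g z.
have kb : normc k <= (1 + normc m) * normc h by exact: d3P.
have kd : normc k < d1 by rewrite (le_lt_trans kb) // mulrC -ltr_pdivlMr.
have -> : (f \o g) (z + h) - (f \o g) z - l * m * h =
    (f (g z + k) - f (g z) - l * k) + l * (k - m * h).
  by rewrite /k /= (addrC (g z) (_ - _)) subrK; ring.
rewrite (le_trans (ler_normcD _ _)) //.
have := d1P _ kd; have := d2P _ h2; rewrite -/k => A B.
have {}B : normc (f (g z + k) - f (g z) - l * k) <= e / 2 * normc h.
  apply: (le_trans B); rewrite -mulrA ler_pM2l ?divr_gt0 //.
  by rewrite mulrC ler_pdivrMr // mulrC.
have {}A : normc (l * (k - m * h)) <= e / 2 * normc h.
  rewrite normcM (le_trans (ler_wpM2l (normc_ge0 _) A)) // mulrA ler_wpM2r ?normc_ge0 //.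
  rewrite mulrCA ger_pMr ?divr_gt0 // ler_pdivrMr // mul1r lerDr //.
by rewrite (le_trans (lerD B A)) // -mulrDl -splitr.
Qed.

Lemma cdiff_inv z : z != 0 -> cdiff (fun w => w^-1) z (- z ^- 2).
Proof.
move=> z0; have Z0 : 0 < normc z by rewrite normc_gt0.
move=> e e0; exists (Num.min (normc z / 2) (e * normc z ^+ 3 / 2)).
  by rewrite lt_min !divr_gt0 ?mulr_gt0 ?exprn_gt0.
move=> h; rewrite lt_min => /andP[h1 h2].
have zh : normc z / 2 <= normc (z + h).
  have := ler_normc_sub z (- h); rewrite opprK normcN => zh; apply: le_trans zh.
  by rewrite lerBrDr -lerBrDl (le_trans (ltW h1)) // -{2}(mul1r (normc z)); lra.
have zh0 : z + h != 0 by rewrite -normc_gt0 (lt_le_trans _ zh) // divr_gt0.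
have -> : (z + h)^-1 - z^-1 - - z ^- 2 * h = h ^+ 2 / (z ^+ 2 * (z + h)).
  by field; rewrite z0 zh0.
rewrite normc_div normcX normcM normcX ler_pdivrMr ?mulr_gt0 ?exprn_gt0 ?normc_gt0 //.
set x := normc z in Z0 h1 h2 zh *; set y := normc h in h1 h2 *.
have y0 : 0 <= y by exact: normc_ge0.
rewrite expr2 [e * y]mulrC -mulrA ler_wpM2l // (le_trans (ltW h2)) //.
by rewrite -mulrA ler_pM2l // exprSr -mulrA ler_pM2l ?exprn_gt0.
Qed.

Lemma cdiffV f z l : f z != 0 -> cdiff f z l -> cdiff (fun w => (f w)^-1) z (- (f z) ^- 2 * l).
Proof. by move=> f0 fl; apply: (cdiff_comp fl (cdiff_inv f0)). Qed.

Lemma cdiff_near f g z l : cdiff f z l ->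
  (exists2 d : R, 0 < d & forall w, disc z d w -> f w = g w) -> cdiff g z l.
Proof.
move=> fl [d d0 dP] e e0; have [d' d'0 d'P] := fl e e0.
exists (Num.min d d'); first by rewrite lt_min d0.
move=> h; rewrite lt_min => /andP[hd hd'].
have zz : disc z d z by rewrite /disc /= subrr normc0.
have zh : disc z d (z + h) by rewrite /disc /= addrAC subrr add0r.
by rewrite -!dP // d'P.
Qed.

Lemma cdiffX f z l n : cdiff f z l -> cdiff (fun w => f w ^+ n) z (n%:R * f z ^+ n.-1 * l).
Proof.
move=> fl; elim: n => [|n IH].
  rewrite !mul0r; apply: cdiff_near (cdiff_cst 1 z) _.
  by exists 1 => // w _; rewrite expr0.
have := cdiffM fl IH.
have -> : f z * (n%:R * f z ^+ n.-1 * l) + f z ^+ n * l = n.+1%:R * f z ^+ n.+1.-1 * l.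
  case: n {IH} => [|n] /=; first by rewrite expr0; ring.
  by rewrite exprS -[n.+2]addn1 natrD; ring.
by move=> H; apply: cdiff_near H _; exists 1 => // w _; rewrite exprS.
Qed.

Lemma cdiffZ a f z l : cdiff f z l -> cdiff (fun w => a * f w) z (a * l).
Proof.
move=> fl; have := cdiffM (cdiff_cst a z) fl.
by rewrite mulr0 addr0.
Qed.

End Differentiability.

(** * Integration along segments and Cauchy's theorem *)

Section CurvePrimitive.
Context {R : realType}.
Local Notation C := R[i].
Implicit Types (g G : R -> C) (t a b : R) (l : C).

Definition rcont g t := forall e : R, 0 < e -> exists2 d : R, 0 < d &
  forall h : R, `|h| < d -> normc (g (t + h) - g t) <= e.

Definition rdiff G t l := forall e : R, 0 < e -> exists2 d : R, 0 < d &
  forall h : R, `|h| < d -> normc (G (t + h) - G t - l * h%:C%C) <= e * `|h|.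

Lemma is_derive_eps (f : R -> R) (x l e : R) : is_derive x 1 f l -> 0 < e ->
  exists2 d : R, 0 < d & forall h, `|h| < d -> `|f (x + h) - f x - l * h| <= e * `|h|.
Proof.
move=> [dv <-] e0.
have /cvgrPdist_le/(_ _ e0) : h^-1 *: ((f \o shift x) (h *: 1) - f x) @[h --> 0^'] --> 'D_1 f x by exact: dv.
rewrite near_withinE => /nbhs_normP[d /= d0 dP]; exists d => // h hd.
have [->|h0] := eqVneq h 0; first by rewrite addr0 subrr mulr0 subrr normr0 mulr0.
have /= := dP h; rewrite sub0r normrN => /(_ hd h0).
rewrite -(ler_pM2r (_ : 0 < `|h|)) ?normr_gt0 // -normrM.
suff -> : ('D_1 f x - h^-1 *: (f (h *: 1 + x) - f x)) * h = - (f (x + h) - f x - 'D_1 f x * h).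
  by rewrite normrN.
rewrite /GRing.scale /= mulr1 (addrC h x); field.
exact: h0.
Qed.

(** The fundamental theorem of calculus concerns an integral from a fixed left endpoint, hence only
    points to its right. The primitives based at [-n], normalised to vanish at 0, have differences
    of derivative 0, so they agree where they overlap and glue to a primitive on the whole line. *)
Lemma real_primitive (g : R -> R) : continuous g ->
  exists G : R -> R, forall x : R, is_derive x 1 G (g x).
Proof.
move=> cg.
pose F (n : nat) (x : R) := (\int[lebesgue_measure]_(t in [set` `[(- n%:R : R), x]]) (g t))%R.
have dF n (x : R) : - n%:R < x -> is_derive x 1 (F n) (g x).
  move=> nx; have [||d1 d2] := @continuous_FTC1_closed R g (- n%:R) x (x + 1) _ _ nx (cg x).
  - by rewrite ltrDl.
  - apply: continuous_compact_integrable; first exact: segment_compact.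
    by apply: continuous_subspaceT => y; exact: cg.
  by apply: DeriveDef; [exact: d1|rewrite -derive1E; exact: d2].
have FE n m (x : R) : (n <= m)%N -> - n%:R < 0 :> R -> - n%:R < x -> F n x - F n 0 = F m x - F m 0.
  move=> nm n0 nx.
  pose H (y : R) := F n y - F m y.
  have nmR : - m%:R <= - n%:R :> R by rewrite lerN2 ler_nat.
  have dH (y : R) : - n%:R < y -> is_derive y 1 H 0.
    move=> ny; rewrite -(subrr (g y)); apply: is_deriveB; first exact: dF.
    by apply: dF; exact: le_lt_trans ny.
  suff : H x = H 0 by rewrite /H => E; lra.
  have cst (u v : R) : - n%:R < u -> u < v -> H u = H v.
    move=> nu uv.
    have dH' (y : R) : y \in `]u, v[ -> is_derive y 1 H 0.
      by rewrite in_itv /= => /andP[uy _]; apply: dH; exact: lt_trans uy.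
    have cH : {within `[u, v], continuous H}.
      apply: derivable_within_continuous => y; rewrite in_itv /= => /andP[uy _].
      by have [] := dH y (lt_le_trans nu uy).
    have [c _] := MVT uv dH' cH.
    by rewrite mul0r => /eqP; rewrite subr_eq0 => /eqP.
  have [x0|x0|->//] := ltgtP x 0; first exact: cst.
  by symmetry; apply: cst.
pose N (x : R) := (Num.truncn `|x|).+1.
have Ngt (x : R) : `|x| < (N x)%:R by exact: truncnS_gt.
exists (fun x => F (N x) x - F (N x) 0) => x.
(* The index [N y] may jump near [x]; on the ball of radius 1 about [x] every [F (N y)] is compared
   with the fixed [F (N x).+1]. *)
have xN : - (N x).+1%:R < x.
  by rewrite ltrNl (le_lt_trans (ler_norm _)) // normrN (lt_trans (Ngt x)) // ltr_nat.
have : is_derive x 1 (fun y => F (N x).+1 y - F (N x).+1 0) (g x).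
  by rewrite -[g x]subr0; apply: is_deriveB; exact: dF.
apply: near_eq_is_derive.
apply/nbhs_normP; exists 1 => //= y; rewrite /ball_ /= distrC => yx.
have yN : `|y| < (N x).+1%:R.
  have := Ngt x; have := ler_normD x (y - x); rewrite addrC subrK -natr1; lra.
rewrite -(FE (N y)) //.
- by rewrite ltnS truncn_le_nat.
- by rewrite ltrNl oppr0 ltr0Sn.
by rewrite ltrNl (le_lt_trans (ler_norm _)) // normrN Ngt.
Qed.

Lemma rdiffD F G t l m : rdiff F t l -> rdiff G t m -> rdiff (fun s => F s + G s) t (l + m).
Proof.
move=> Fl Gm e e0; have e2 : 0 < e / 2 by rewrite divr_gt0.
have [d1 d10 H1] := Fl _ e2; have [d2 d20 H2] := Gm _ e2.
exists (Num.min d1 d2) => [|h]; first by rewrite lt_min d10.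
rewrite lt_min => /andP[/H1 h1 /H2 h2].
have -> : F (t + h) + G (t + h) - (F t + G t) - (l + m) * h%:C%C =
    (F (t + h) - F t - l * h%:C%C) + (G (t + h) - G t - m * h%:C%C) by ring.
by rewrite (le_trans (ler_normcD _ _)) // (splitr e) mulrDl lerD.
Qed.

Lemma rcontD F G t : rcont F t -> rcont G t -> rcont (fun s => F s + G s) t.
Proof.
move=> Fl Gm e e0; have e2 : 0 < e / 2 by rewrite divr_gt0.
have [d1 d10 H1] := Fl _ e2; have [d2 d20 H2] := Gm _ e2.
exists (Num.min d1 d2) => [|h]; first by rewrite lt_min d10.
rewrite lt_min => /andP[/H1 h1 /H2 h2].
have -> : F (t + h) + G (t + h) - (F t + G t) = (F (t + h) - F t) + (G (t + h) - G t) by ring.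
by rewrite (le_trans (ler_normcD _ _)) // (splitr e) lerD.
Qed.

Lemma rcontZ (k : C) G t : rcont G t -> rcont (fun s => k * G s) t.
Proof.
move=> Gl e e0; have a0 : 0 < normc k + 1 by rewrite ltr_wpDl ?normc_ge0.
have [d d0 H] := Gl _ (divr_gt0 e0 a0); exists d => // h /H hb.
rewrite -mulrBr normcM (le_trans (ler_wpM2l (normc_ge0 _) hb)) //.
by rewrite mulrCA ger_pMr // ler_pdivrMr // mul1r lerDl.
Qed.

Lemma rdiffZ (k : C) G t l : rdiff G t l -> rdiff (fun s => k * G s) t (k * l).
Proof.
move=> Gl e e0; have a0 : 0 < normc k + 1 by rewrite ltr_wpDl ?normc_ge0.
have [d d0 H] := Gl _ (divr_gt0 e0 a0); exists d => // h /H hb.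
have -> : k * G (t + h) - k * G t - k * l * h%:C%C = k * (G (t + h) - G t - l * h%:C%C) by ring.
rewrite normcM (le_trans (ler_wpM2l (normc_ge0 _) hb)) // mulrA ler_wpM2r //.
by rewrite mulrCA ger_pMr // ler_pdivrMr // mul1r lerDl.
Qed.

Lemma rdiff_line (f : C -> C) (z v l : C) t : cdiff f (z + v * t%:C%C) l ->
  rdiff (fun s => f (z + v * s%:C%C)) t (l * v).
Proof.
move=> fl e e0; have v0 : 0 < normc v + 1 by rewrite ltr_wpDl ?normc_ge0.
have [d d0 H] := fl _ (divr_gt0 e0 v0).
exists (d / (normc v + 1)) => [|h]; first by rewrite divr_gt0.
rewrite ltr_pdivlMr // => hd.
have vh : normc (v * h%:C%C) <= `|h| * (normc v + 1).
  by rewrite normcM normcR mulrC ler_wpM2l // lerDl.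
have := H (v * h%:C%C) (le_lt_trans vh hd).
rewrite rmorphD /= mulrDr addrA -[l * v * _]mulrA => /le_trans; apply.
apply: le_trans (ler_wpM2l _ vh) _; first by rewrite ltW // divr_gt0.
by rewrite [`|h| * _]mulrC mulrA divfK ?gt_eqF.
Qed.

Lemma rcont_line (f : C -> C) (z v : C) t : ccont f (z + v * t%:C%C) ->
  rcont (fun s => f (z + v * s%:C%C)) t.
Proof.
move=> fl e e0; have v0 : 0 < normc v + 1 by rewrite ltr_wpDl ?normc_ge0.
have [d d0 H] := fl _ e0.
exists (d / (normc v + 1)) => [|h]; first by rewrite divr_gt0.
rewrite ltr_pdivlMr // => hd.
have vh : normc (v * h%:C%C) <= `|h| * (normc v + 1).
  by rewrite normcM normcR mulrC ler_wpM2l // lerDl.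
by have := H (v * h%:C%C) (le_lt_trans vh hd); rewrite rmorphD /= mulrDr addrA.
Qed.

(** A complex-valued curve has no intermediate point as in the real mean value theorem. Instead the
    bound with the slightly larger slope [M + e'] is propagated from [a] to [b] by real induction,
    and [e'] tends to 0. *)
Lemma mean_value_inequality G g a b (M : R) : a <= b ->
  (forall t, a <= t <= b -> rdiff G t (g t)) ->
  (forall t, a <= t <= b -> normc (g t) <= M) ->
  normc (G b - G a) <= M * (b - a).
Proof.
move=> ab dG gM; apply: le_of_all_eps => e e0.
have ba0 : 0 < b - a + 1 by rewrite ltr_wpDl // subr_ge0.
pose e' := e / (b - a + 1); have e'0 : 0 < e' by rewrite divr_gt0.
suff : normc (G b - G a) <= (M + e') * (b - a).
  move=> /le_trans; apply; rewrite mulrDl lerD2l /e' mulrAC -mulrA ger_pMr //.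
  by rewrite ler_pdivrMr // mul1r lerDl.
have step t : a <= t <= b -> exists2 d : R, 0 < d &
    forall h, `|h| < d -> normc (G (t + h) - G t) <= (M + e') * `|h|.
  move=> tab; have [d d0 H] := dG _ tab _ e'0; exists d => // h /H hb.
  rewrite -(subrK (g t * h%:C%C) (G (t + h) - G t)) (le_trans (ler_normcD _ _)) //.
  by rewrite addrC mulrDl lerD // normcM normcR ler_wpM2r // gM.
apply: (@real_induction _ a b (fun t => normc (G t - G a) <= (M + e') * (t - a))) => //.
- by rewrite !subrr normc0 mulr0.
- move=> t /andP[at_ tb] Ps; have [|d d0 H] := step t; first by rewrite ltW.
  pose h := Num.min (d / 2) (t - a).
  have h0 : 0 < h by rewrite lt_min subr_gt0 at_ divr_gt0.
  have hd : h < d by rewrite gt_min ltr_pdivrMr // ltr_pMr // ltr1n.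
  have ha : h <= t - a by rewrite ge_min lexx orbT.
  have := H (- h); rewrite normrN gtr0_norm // => /(_ hd) Ht.
  have := Ps (t - h); rewrite gtrBl h0 andbT lerBrDr -lerBrDl ha => /(_ isT) Ha.
  rewrite (le_trans (normc_triangle _ (G (t - h)) _)) // normcBC.
  by rewrite (le_trans (lerD Ht Ha)) // -mulrDr (_ : h + _ = t - a) //; ring.
move=> t /andP[at_ tb] Ps; have [|d d0 H] := step t; first by rewrite at_ ltW.
exists d => // s /andP[ts sd].
have h0 : 0 < s - t by rewrite subr_gt0.
have := H (s - t); rewrite gtr0_norm // ltrBlDl sd [t + _]addrC subrK => /(_ isT) Hs.
have Ha := Ps t; rewrite at_ lexx in Ha.
rewrite (le_trans (normc_triangle _ (G t) _)) // (le_trans (lerD Hs (Ha isT))) //.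
by rewrite -mulrDr (_ : s - t + _ = s - a) //; ring.
Qed.

Lemma curve_primitive g : (forall t, rcont g t) -> exists G, forall t, rdiff G t (g t).
Proof.
move=> cg.
have key (p : C -> R) : (forall z w, `|p z - p w| <= normc (z - w)) -> continuous (fun t : R => p (g t)).
  move=> pl t; apply/cvgrPdist_le => e e0; have [d d0 H] := cg t _ e0.
  apply/nbhs_normP; exists d => //= s; rewrite /ball_ /= distrC => ts.
  rewrite distrC (le_trans (pl _ _)) //.
  by have := H _ ts; rewrite [t + _]addrC subrK.
have [G1 dG1] := @real_primitive (fun t => Re (g t)) (key _ normc_ReB).
have [G2 dG2] := @real_primitive (fun t => Im (g t)) (key _ normc_ImB).
exists (fun t => (G1 t +i* G2 t)%C) => t e e0.
have e2 : 0 < e / 2 by rewrite divr_gt0.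
have [d1 d10 H1] := is_derive_eps (dG1 t) e2.
have [d2 d20 H2] := is_derive_eps (dG2 t) e2.
exists (Num.min d1 d2) => [|h]; first by rewrite lt_min d10.
rewrite lt_min => /andP[/H1 h1 /H2 h2].
rewrite (le_trans (normc_le_ReIm _)) // (splitr e) mulrDl.
case: (g t) h1 h2 => u v /= h1 h2.
by rewrite !mulr0 subr0 add0r lerD.
Qed.

(** The integral [cint] is the increment of a chosen primitive, so that splitting an interval and
    reversing its endpoints are mere algebra. A primitive exists when [g] is continuous on the whole
    line; otherwise the choice may fall back on 0. *)
Definition curve_prim g : R -> C := xget (fun=> 0) [set G | forall t, rdiff G t (g t)].

Definition cint g a b : C := curve_prim g b - curve_prim g a.

Lemma curve_primP g : (forall t, rcont g t) -> forall t, rdiff (curve_prim g) t (g t).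
Proof. by move=> /curve_primitive[G HG]; exact: (@xgetPex _ (fun=> 0) [set G | forall t, rdiff G t (g t)]) (ex_intro _ G HG). Qed.

Lemma cint_le g a b (M : R) : a <= b -> (forall t, rcont g t) ->
  (forall t, a <= t <= b -> normc (g t) <= M) -> normc (cint g a b) <= M * (b - a).
Proof. by move=> ab /curve_primP dG gM; apply: mean_value_inequality gM. Qed.

Lemma cint_eq G g a b : a <= b -> (forall t, rcont g t) ->
  (forall t, a <= t <= b -> rdiff G t (g t)) -> cint g a b = G b - G a.
Proof.
move=> ab /curve_primP dP dG; apply/eqP; rewrite -subr_eq0 -normc_eq0 eq_le normc_ge0 andbT.
have d0 t : a <= t <= b -> rdiff (fun s => curve_prim g s + -1 * G s) t (g t + -1 * g t).
  by move=> tab; apply: rdiffD => //; apply: rdiffZ; exact: dG.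
have := @mean_value_inequality _ _ _ _ 0 ab d0; rewrite mul0r.
have -> : curve_prim g b + -1 * G b - (curve_prim g a + -1 * G a) = cint g a b - (G b - G a).
  by rewrite /cint; ring.
by apply=> t _; rewrite mulN1r subrr normc0.
Qed.

Lemma cintD f g a b : a <= b -> (forall t, rcont f t) -> (forall t, rcont g t) ->
  cint (fun s => f s + g s) a b = cint f a b + cint g a b.
Proof.
move=> ab cf cg; rewrite (@cint_eq (fun t => curve_prim f t + curve_prim g t)) //.
- by rewrite /cint; ring.
- by move=> t; exact: rcontD.
by move=> t _; apply: rdiffD; exact: curve_primP.
Qed.

Lemma cintZ l g a b : a <= b -> (forall t, rcont g t) -> 
  cint (fun s => l * g s) a b = l * cint g a b.
Proof.
move=> ab cg; rewrite (@cint_eq (fun t => l * curve_prim g t)) //.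
- by rewrite /cint; ring.
- by move=> t; exact: rcontZ.
by move=> t _; apply: rdiffZ; exact: curve_primP.
Qed.

End CurvePrimitive.

(** * Integrals over rectangles and Goursat's theorem *)

Section RectangleIntegral.
Context {R : realType}.
Local Notation C := R[i].
Implicit Types (f g F : C -> C) (z l : C) (x y a b : R).

Lemma rdiff_hline f x y l : cdiff f (x +i* y)%C l -> rdiff (fun s => f (s +i* y)%C) x l.
Proof.
have E s : (s +i* y)%C = (0 +i* y)%C + 1 * s%:C%C by rewrite mul1r; simpc.
move=> fl; have -> : (fun s => f (s +i* y)%C) = (fun s => f ((0 +i* y)%C + 1 * s%:C%C)).
  by apply/funext => s; rewrite E.
by rewrite -(mulr1 l); apply: rdiff_line; rewrite -E.
Qed.

Lemma rdiff_vline f x y l : cdiff f (x +i* y)%C l -> rdiff (fun s => f (x +i* s)%C) y (l * 'i%C).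
Proof.
have E s : (x +i* s)%C = (x +i* 0)%C + 'i%C * s%:C%C by simpc.
move=> fl; have -> : (fun s => f (x +i* s)%C) = (fun s => f ((x +i* 0)%C + 'i%C * s%:C%C)).
  by apply/funext => s; rewrite E.
by apply: rdiff_line; rewrite -E.
Qed.

Lemma rcont_hline f x y : ccont f (x +i* y)%C -> rcont (fun s => f (s +i* y)%C) x.
Proof.
have E s : (s +i* y)%C = (0 +i* y)%C + 1 * s%:C%C by rewrite mul1r; simpc.
move=> fl; have -> : (fun s => f (s +i* y)%C) = (fun s => f ((0 +i* y)%C + 1 * s%:C%C)).
  by apply/funext => s; rewrite E.
by apply: rcont_line; rewrite -E.
Qed.

Lemma rcont_vline f x y : ccont f (x +i* y)%C -> rcont (fun s => f (x +i* s)%C) y.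
Proof.
have E s : (x +i* s)%C = (x +i* 0)%C + 'i%C * s%:C%C by simpc.
move=> fl; have -> : (fun s => f (x +i* s)%C) = (fun s => f ((x +i* 0)%C + 'i%C * s%:C%C)).
  by apply/funext => s; rewrite E.
by apply: rcont_line; rewrite -E.
Qed.

Definition hint f y a b : C := cint (fun t => f (t +i* y)%C) a b.
Definition vint f x a b : C := 'i%C * cint (fun t => f (x +i* t)%C) a b.

(** The boundary is run through counterclockwise, [vint] carrying the factor i of dz. The endpoints
    need not be ordered: exchanging two of them changes the sign. *)
Definition rect_int f x0 x1 y0 y1 : C :=
  hint f y0 x0 x1 + vint f x1 y0 y1 - hint f y1 x0 x1 - vint f x0 y0 y1.

Definition rect_bd x0 x1 y0 y1 z :=
  (x0 <= Re z <= x1 /\ (Im z = y0 \/ Im z = y1)) \/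
  (y0 <= Im z <= y1 /\ (Re z = x0 \/ Re z = x1)).

(** Continuity is asked on the four full lines that support the sides, because [cint] works with
    curves continuous on all of [R]. *)
Definition rect_cont f x0 x1 y0 y1 := forall z,
  Re z = x0 \/ Re z = x1 \/ Im z = y0 \/ Im z = y1 -> ccont f z.

Lemma rect_int_le f x0 x1 y0 y1 (M : R) : x0 <= x1 -> y0 <= y1 ->
  rect_cont f x0 x1 y0 y1 -> (forall z, rect_bd x0 x1 y0 y1 z -> normc (f z) <= M) ->
  normc (rect_int f x0 x1 y0 y1) <= 2 * M * (x1 - x0 + (y1 - y0)).
Proof.
move=> x01 y01 cf fM.
have H y : (y = y0 \/ y = y1) -> normc (hint f y x0 x1) <= M * (x1 - x0).
  move=> yE; apply: cint_le => // t; first by apply: rcont_hline; apply: cf; right; right.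
  by move=> tx; apply: fM; left.
have V x : (x = x0 \/ x = x1) -> normc (vint f x y0 y1) <= M * (y1 - y0).
  move=> xE; rewrite normcM normci mul1r; apply: cint_le => // t.
    by apply: rcont_vline; apply: cf => /=; tauto.
  by move=> ty; apply: fM; right.
rewrite /rect_int.
apply: le_trans (ler_normcB _ _) _; have := V x0 (or_introl erefl) => v0.
apply: le_trans (lerD (ler_normcB _ _) (lexx _)) _; have := H y1 (or_intror erefl) => h1.
apply: le_trans (lerD (lerD (ler_normcD _ _) (lexx _)) (lexx _)) _.
have := V x1 (or_intror erefl) => v1; have := H y0 (or_introl erefl) => h0.
lra.
Qed.

Lemma rect_intD f g x0 x1 y0 y1 : x0 <= x1 -> y0 <= y1 ->
  rect_cont f x0 x1 y0 y1 -> rect_cont g x0 x1 y0 y1 ->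
  rect_int (fun z => f z + g z) x0 x1 y0 y1 = rect_int f x0 x1 y0 y1 + rect_int g x0 x1 y0 y1.
Proof.
move=> x01 y01 cf cg.
have H y : (y = y0 \/ y = y1) -> hint (fun z => f z + g z) y x0 x1 = hint f y x0 x1 + hint g y x0 x1.
  move=> yE; apply: cintD => // t; apply: rcont_hline; [apply: cf|apply: cg] => /=; tauto.
have V x : (x = x0 \/ x = x1) -> vint (fun z => f z + g z) x y0 y1 = vint f x y0 y1 + vint g x y0 y1.
  move=> xE; rewrite /vint -mulrDr; congr (_ * _).
  apply: cintD => // t; apply: rcont_vline; [apply: cf|apply: cg] => /=; tauto.
rewrite /rect_int !H ?V; try tauto; ring.
Qed.

Lemma rect_intZ l f x0 x1 y0 y1 : x0 <= x1 -> y0 <= y1 -> rect_cont f x0 x1 y0 y1 ->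
  rect_int (fun z => l * f z) x0 x1 y0 y1 = l * rect_int f x0 x1 y0 y1.
Proof.
move=> x01 y01 cf.
have H y : (y = y0 \/ y = y1) -> hint (fun z => l * f z) y x0 x1 = l * hint f y x0 x1.
  move=> yE; apply: cintZ => // t; apply: rcont_hline; apply: cf => /=; tauto.
have V x : (x = x0 \/ x = x1) -> vint (fun z => l * f z) x y0 y1 = l * vint f x y0 y1.
  move=> xE; rewrite /vint mulrCA; congr (_ * _).
  apply: cintZ => // t; apply: rcont_vline; apply: cf => /=; tauto.
rewrite /rect_int !H ?V; try tauto; ring.
Qed.

Lemma rect_int_primitive F f x0 x1 y0 y1 : x0 <= x1 -> y0 <= y1 ->
  rect_cont f x0 x1 y0 y1 -> (forall z, rect_bd x0 x1 y0 y1 z -> cdiff F z (f z)) ->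
  rect_int f x0 x1 y0 y1 = 0.
Proof.
move=> x01 y01 cf dF.
have H y : (y = y0 \/ y = y1) -> hint f y x0 x1 = F (x1 +i* y)%C - F (x0 +i* y)%C.
  move=> yE; apply: (@cint_eq _ (fun t => F (t +i* y)%C)) => // t.
    by apply: rcont_hline; apply: cf => /=; tauto.
  by move=> tx; apply: rdiff_hline; apply: dF; left.
have V x : (x = x0 \/ x = x1) -> vint f x y0 y1 = F (x +i* y1)%C - F (x +i* y0)%C.
  move=> xE; have cx t : rcont (fun s => f (x +i* s)%C) t.
    by apply: rcont_vline; apply: cf => /=; tauto.
  rewrite /vint -cintZ //; apply: (@cint_eq _ (fun t => F (x +i* t)%C)) => // t.
    exact: rcontZ.
  by move=> tx; rewrite mulrC; apply: rdiff_vline; apply: dF; right.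
rewrite /rect_int !H ?V; try tauto; ring.
Qed.

Lemma rect_int_hsplit f x0 x x1 y0 y1 :
  rect_int f x0 x1 y0 y1 = rect_int f x0 x y0 y1 + rect_int f x x1 y0 y1.
Proof. by rewrite /rect_int /hint /vint /cint; ring. Qed.

Lemma rect_int_vsplit f x0 x1 y0 y y1 :
  rect_int f x0 x1 y0 y1 = rect_int f x0 x1 y0 y + rect_int f x0 x1 y y1.
Proof. by rewrite /rect_int /hint /vint /cint; ring. Qed.

(** Goursat's bisection: one of the four quarters of a rectangle carries at least a quarter of the
    integral. Dependent choice yields nested rectangles, and the suprema of their left and lower
    ends form a common point. *)
Lemma goursat_nested f (x y a b e : R) : 0 <= a -> 0 <= b ->
  e <= normc (rect_int f x (x + a) y (y + b)) ->
  exists z : C, [/\ x <= Re z <= x + a, y <= Im z <= y + b & forall n : nat,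
    exists x' y' : R, [/\ x' <= Re z <= x' + a / 2 ^+ n, y' <= Im z <= y' + b / 2 ^+ n &
      e <= 4 ^+ n * normc (rect_int f x' (x' + a / 2 ^+ n) y' (y' + b / 2 ^+ n))]].
Proof.
move=> a0 b0 e0.
pose J (p : nat * (R * R)) := 4 ^+ p.1 *
  normc (rect_int f p.2.1 (p.2.1 + a / 2 ^+ p.1) p.2.2 (p.2.2 + b / 2 ^+ p.1)).
(* A state consists of the depth, the lower left corner, and the proof that this rectangle still
   carries its share [e / 4^n]. *)
pose T := {p : nat * (R * R) | e <= J p}.
pose next (p q : T) := [/\ (sval q).1 = (sval p).1.+1,
  (sval p).2.1 <= (sval q).2.1 <= (sval p).2.1 + a / 2 ^+ (sval p).1.+1 &
  (sval p).2.2 <= (sval q).2.2 <= (sval p).2.2 + b / 2 ^+ (sval p).1.+1].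
have nextP (p : T) : {q : T | next p q}.
  apply: cid; case: p => -[n [u v]] Jp; rewrite /next /=.
  pose a' := a / 2 ^+ n.+1; pose b' := b / 2 ^+ n.+1.
  have a'0 : 0 <= a' by rewrite divr_ge0 // exprn_ge0.
  have b'0 : 0 <= b' by rewrite divr_ge0 // exprn_ge0.
  have aE : a / 2 ^+ n = a' + a' by rewrite /a' exprS; field; rewrite expf_neq0.
  have bE : b / 2 ^+ n = b' + b' by rewrite /b' exprS; field; rewrite expf_neq0.
  suff [[u' v'] [/= hu hv h]] : exists q : R * R,
      [/\ u <= q.1 <= u + a', v <= q.2 <= v + b' & e <= J (n.+1, q)].
    by exists (exist _ (n.+1, (u', v')) h).
  move: Jp; rewrite /J /= aE bE !addrA.
  rewrite (rect_int_hsplit f u (u + a')) (rect_int_vsplit f u _ v (v + b')).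
  rewrite (rect_int_vsplit f (u + a') _ v (v + b')) => Jp.
  apply/not_existsP => H.
  have h q : u <= q.1 <= u + a' -> v <= q.2 <= v + b' ->
     4 ^+ n * normc (rect_int f q.1 (q.1 + a') q.2 (q.2 + b')) < e / 4.
    move=> h1 h2; rewrite ltr_pdivlMr // mulrC mulrA -exprS ltNge; apply/negP => h3.
    by apply: (H q); split.
  have ua : u <= u + a' <= u + a' by rewrite lexx lerDl a'0.
  have vb : v <= v + b' <= v + b' by rewrite lexx lerDl b'0.
  have uu : u <= u <= u + a' by rewrite lexx lerDl a'0.
  have vv : v <= v <= v + b' by rewrite lexx lerDl b'0.
  have := h (u, v) uu vv; have := h (u + a', v) ua vv.
  have := h (u, v + b') uu vb; have := h (u + a', v + b') ua vb => /=.
  set j1 := rect_int _ _ _ _ _; set j2 := rect_int _ _ _ _ _.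
  set j3 := rect_int _ _ _ _ _; set j4 := rect_int _ _ _ _ _ => h4 h3 h2 h1.
  have p4 : 0 <= 4 ^+ n :> R by rewrite exprn_ge0.
  suff : e < e by rewrite ltxx.
  apply: le_lt_trans Jp _.
  have tri : normc (j4 + j2 + (j3 + j1)) <= normc j4 + normc j2 + (normc j3 + normc j1).
    apply: le_trans (ler_normcD _ _) _; exact: lerD (ler_normcD _ _) (ler_normcD _ _).
  apply: le_lt_trans (ler_wpM2l p4 tri) _.
  lra.
have [q [q0 qS]] := dependent_choice nextP (exist _ (0%N, (x, y)) (
  ltac:(by rewrite /J /= !expr0 mul1r !divr1) : e <= J (0%N, (x, y)))).
have qn n : (sval (q n)).1 = n.
  by elim: n => [|n IH]; [rewrite q0|have [-> _ _] := qS n; rewrite IH].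
pose X n := (sval (q n)).2.1; pose Y n := (sval (q n)).2.2.
(* The left ends increase, step [n] adding at most [c / 2^(n+1)]; so [U n + c / 2^n] bounds all of
   them, and their supremum lies in every interval. *)
have nest (U : nat -> R) (c : R) : 0 <= c -> (forall n, U n <= U n.+1 <= U n + c / 2 ^+ n.+1) ->
   forall n, U n <= sup (range U) <= U n + c / 2 ^+ n.
  move=> c0 HU.
  have up n k : U n <= U (n + k)%N.
    elim: k => [|k IH]; first by rewrite addn0.
    by rewrite addnS (le_trans IH) //; have /andP[] := HU (n + k)%N.
  have dn n k : U (n + k)%N <= U n + c / 2 ^+ n - c / 2 ^+ (n + k).
    elim: k => [|k IH]; first by rewrite addn0 addrK.
    rewrite addnS; have /andP[_ h] := HU (n + k)%N.
    have E : c / 2 ^+ (n + k) = c / 2 ^+ (n + k).+1 + c / 2 ^+ (n + k).+1.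
      by rewrite exprS; field; rewrite expf_neq0.
    lra.
  have ub n : ubound (range U) (U n + c / 2 ^+ n).
    move=> _ [m _ <-]; have [mn|/ltnW nm] := leqP m n.
      rewrite -(subnKC mn) (le_trans (up m (n - m)%N)) // subnKC // lerDl.
      by rewrite divr_ge0 // exprn_ge0.
    rewrite -(subnKC nm) (le_trans (dn n (m - n)%N)) // gerBl.
    by rewrite divr_ge0 // exprn_ge0.
  move=> n; apply/andP; split; first by apply: ub_le_sup; [exists (U n + c / 2 ^+ n)|exists n].
  by apply: ge_sup => //; exists (U n); exists n.
have nX := nest X a a0 (fun n => ltac:(have [_ + _] := qS n; rewrite qn; exact)).
have nY := nest Y b b0 (fun n => ltac:(have [_ _] := qS n; rewrite qn; exact)).
exists (sup (range X) +i* sup (range Y))%C; split => /=.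
- by have := nX 0%N; rewrite /X q0 /= expr0 divr1.
- by have := nY 0%N; rewrite /Y q0 /= expr0 divr1.
move=> n; exists (X n), (Y n); split => //.
by have := svalP (q n); rewrite /J qn.
Qed.

Lemma ccontD f g z : ccont f z -> ccont g z -> ccont (fun w => f w + g w) z.
Proof.
move=> Fl Gm e e0; have e2 : 0 < e / 2 by rewrite divr_gt0.
have [d1 d10 H1] := Fl _ e2; have [d2 d20 H2] := Gm _ e2.
exists (Num.min d1 d2) => [|h]; first by rewrite lt_min d10.
rewrite lt_min => /andP[/H1 h1 /H2 h2].
have -> : f (z + h) + g (z + h) - (f z + g z) = (f (z + h) - f z) + (g (z + h) - g z) by ring.
by rewrite (le_trans (ler_normcD _ _)) // (splitr e) lerD.
Qed.

Lemma ccontZ l f z : ccont f z -> ccont (fun w => l * f w) z.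
Proof.
move=> Gl e e0; have a0 : 0 < normc l + 1 by rewrite ltr_wpDl ?normc_ge0.
have [d d0 H] := Gl _ (divr_gt0 e0 a0); exists d => // h /H hb.
rewrite -mulrBr normcM (le_trans (ler_wpM2l (normc_ge0 _) hb)) //.
by rewrite mulrCA ger_pMr // ler_pdivrMr // mul1r lerDl.
Qed.

Lemma ccont_affine l m z : ccont (fun w => l + m * w) z.
Proof.
by apply: (@cdiff_ccont _ _ _ (0 + m * 1)); apply: cdiffD (cdiff_cst _ _) (cdiffZ _ (cdiff_id _)).
Qed.

(** On the rectangle of depth [n], [f] differs from its affine part at the common point by at most
    [e] times the sum of the sides, and the affine part has a quadratic primitive. The resulting
    bound is quadratic in the sides, which cancels the factor [4^n]. *)
Lemma goursat f x y a b : 0 <= a -> 0 <= b -> (forall z, ccont f z) ->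
  (forall z, x <= Re z <= x + a -> y <= Im z <= y + b -> exists l, cdiff f z l) ->
  rect_int f x (x + a) y (y + b) = 0.
Proof.
move=> a0 b0 cf df; apply/eqP; rewrite -normc_eq0 eq_le normc_ge0 andbT.
apply: (@le0_of_all_eps _ (2 * (a + b) ^+ 2) _ _) => e e0.
have [z [zx zy H]] := goursat_nested a0 b0 (lexx (normc (rect_int f x (x + a) y (y + b)))).
have [l dl] := df _ zx zy; have [d d0 dP] := dl _ e0.
have [n nd] : exists n : nat, (a + b) / 2 ^+ n < d.
  exists (Num.truncn ((a + b) / d)).+1.
  rewrite ltr_pdivrMr ?exprn_gt0 // mulrC -ltr_pdivrMr //.
  apply: lt_trans (truncnS_gt _) _.
  by rewrite -natrX ltr_nat ltn_expl.
have [x' [y' [zx' zy' h]]] := H n; apply: (le_trans h) => {h}.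
set a' := a / 2 ^+ n; set b' := b / 2 ^+ n in zx' zy' *.
have a'0 : 0 <= a' by rewrite divr_ge0 // exprn_ge0.
have b'0 : 0 <= b' by rewrite divr_ge0 // exprn_ge0.
pose A (w : C) : C := (f z - l * z) + l * w.
have cA w : ccont A w by exact: ccont_affine.
have A0 : rect_int A x' (x' + a') y' (y' + b') = 0.
  apply: (@rect_int_primitive (fun w => (f z - l * z) * w + l / 2 * (w * w))); rewrite ?lerDl //.
  move=> w _; rewrite /A.
  have := cdiffD (cdiffZ (f z - l * z) (cdiff_id w)) (cdiffZ (l / 2) (cdiffM (cdiff_id w) (cdiff_id w))).
  by congr cdiff; rewrite /=; field.
have cfA : rect_cont (fun w => f w + -1 * A w) x' (x' + a') y' (y' + b').
  move=> w _; apply: ccontD => //; exact: ccontZ.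
have -> : rect_int f x' (x' + a') y' (y' + b') =
    rect_int (fun w => f w + -1 * A w) x' (x' + a') y' (y' + b').
  have cA' : rect_cont (fun w => -1 * A w) x' (x' + a') y' (y' + b') by move=> w _; exact: ccontZ.
  rewrite rect_intD ?lerDl //.
  by rewrite rect_intZ ?lerDl // A0 mulr0 addr0.
have bd w : rect_bd x' (x' + a') y' (y' + b') w -> normc (f w + -1 * A w) <= e * (a' + b').
  move=> wb; have : x' <= Re w <= x' + a' /\ y' <= Im w <= y' + b'.
    by case: wb => -[h [->|->]]; rewrite !lexx !lerDl ?a'0 ?b'0.
  move=> [wx wy]; have zw : normc (w - z) <= a' + b'.
    apply: le_trans (normc_le_ReIm _) _; rewrite !raddfB; apply: lerD.
      apply: (@dist_itv_le _ x'); last exact: zx'.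
      by case: (w) wx.
    by apply: (@dist_itv_le _ y'); last exact: zy'; case: (w) wy.
  have ab : a' + b' = (a + b) / 2 ^+ n by rewrite mulrDl.
  have := dP (w - z); rewrite (le_lt_trans zw) ?ab // => /(_ isT).
  rewrite [z + _]addrC subrK -ab => h; apply: le_trans (ler_wpM2l (ltW e0) zw).
  by apply: le_trans h; rewrite le_eqVlt; apply/orP; left; apply/eqP; congr normc; rewrite /A; ring.
have := rect_int_le _ _ cfA bd; rewrite !lerDl => /(_ a'0 b'0).
rewrite !(addrAC _ a') !(addrAC _ b') !subrr !add0r => h.
have p4 : 0 < 4 ^+ n :> R by rewrite exprn_gt0.
apply: le_trans (ler_wpM2l (ltW p4) h) _.
rewrite /a' /b' (_ : 4 ^+ n = 2 ^+ n * 2 ^+ n :> R); last by rewrite -exprMn -natrM.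
rewrite le_eqVlt; apply/orP; left; apply/eqP; field.
by rewrite expf_neq0.
Qed.
End RectangleIntegral.

(** * Goursat's theorem on a square with an exceptional point *)

Section CauchySquare.
Context {R : realType}.
Local Notation C := R[i].
Implicit Types (f g F : C -> C) (z w l : C) (x y a b s e M : R) (n k : nat).

Lemma ccontM f g z : ccont f z -> ccont g z -> ccont (fun w => f w * g w) z.
Proof.
move=> cf cg e e0.
have f0 : 0 < normc (f z) + 1 by rewrite ltr_wpDl ?normc_ge0.
have g0 : 0 < normc (g z) + 1 by rewrite ltr_wpDl ?normc_ge0.
have [d1 d10 H1] := cf _ (divr_gt0 (divr_gt0 e0 (ltr0Sn _ 1)) g0).
have [d2 d20 H2] := cg _ (divr_gt0 (divr_gt0 e0 (ltr0Sn _ 1)) f0).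
have [d3 d30 H3] := cg _ ltr01.
exists (Num.min d1 (Num.min d2 d3)) => [|h]; first by rewrite !lt_min d10 d20.
rewrite !lt_min => /and3P[/H1 h1 /H2 h2 /H3 h3].
have -> : f (z + h) * g (z + h) - f z * g z =
   (f (z + h) - f z) * g (z + h) + f z * (g (z + h) - g z) by ring.
have gh : normc (g (z + h)) <= normc (g z) + 1.
  by rewrite -{1}(subrK (g z) (g (z + h))) addrC (le_trans (ler_normcD _ _)) // lerD2l.
rewrite (le_trans (ler_normcD _ _)) // !normcM (splitr e); apply: lerD.
  apply: le_trans (ler_pM (normc_ge0 _) (normc_ge0 _) h1 gh) _.
  by rewrite divfK // gt_eqF.
apply: le_trans (ler_wpM2l (normc_ge0 _) h2) _.
rewrite mulrCA ger_pMr ?divr_gt0 // ler_pdivrMr // mul1r lerDl //.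
Qed.

Lemma ccont_near f g z : ccont f z ->
  (exists2 d : R, 0 < d & forall w, disc z d w -> f w = g w) -> ccont g z.
Proof.
move=> fl [d d0 dP] e e0; have [d' d'0 d'P] := fl e e0.
exists (Num.min d d'); first by rewrite lt_min d0.
move=> h; rewrite lt_min => /andP[hd hd'].
have zz : disc z d z by rewrite /disc /= subrr normc0.
have zh : disc z d (z + h) by rewrite /disc /= addrAC subrr add0r.
by rewrite -!dP // d'P.
Qed.

Lemma ccont_comp f g z : ccont g z -> ccont f (g z) -> ccont (f \o g) z.
Proof.
move=> cg cf e e0; have [d d0 H] := cf _ e0.
have d2 : 0 < d / 2 by rewrite divr_gt0.
have [d' d'0 H'] := cg _ d2; exists d' => // h /H' hb.
have := H (g (z + h) - g z); rewrite [g z + _]addrC subrK; apply.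
by rewrite (le_lt_trans hb) // ltr_pdivrMr // ltr_pMr // ltr1n.
Qed.

Lemma ccont_cst l z : ccont (fun=> l) z.
Proof. exact: cdiff_ccont (cdiff_cst l z). Qed.

Lemma cdiff_subC w z : cdiff (fun u => u - w) z 1.
Proof. by rewrite -(subr0 1); exact: cdiffB (cdiff_id _) (cdiff_cst _ _). Qed.

Lemma cdiff_invB w z : z != w -> cdiff (fun u => (u - w)^-1) z (- (z - w) ^- 2).
Proof.
by move=> zw; rewrite -[X in cdiff _ _ X]mulr1; apply: (cdiffV _ (cdiff_subC w z)); rewrite subr_eq0.
Qed.

Lemma goursat_rect f x0 x1 y0 y1 : x0 <= x1 -> y0 <= y1 -> (forall z, ccont f z) ->
  (forall z, x0 <= Re z <= x1 -> y0 <= Im z <= y1 -> exists l, cdiff f z l) ->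
  rect_int f x0 x1 y0 y1 = 0.
Proof.
move=> x01 y01 cf df; rewrite -(subrKC x0 x1) -(subrKC y0 y1).
by apply: goursat; rewrite ?subr_ge0 // !subrKC.
Qed.

(** The rectangles to the left, to the right, below and above the central square each lie strictly
    on one side of the point [(a, b)], so their integrals vanish by hypothesis. *)
Lemma rect_int_shrink f (s a b h : R) : 0 < h -> - s <= a - h -> a + h <= s -> - s <= b - h -> b + h <= s ->
  (forall x0 x1 y0 y1, x0 <= x1 -> y0 <= y1 -> - s <= x0 -> x1 <= s -> - s <= y0 -> y1 <= s ->
    (x1 < a \/ a < x0 \/ y1 < b \/ b < y0) -> rect_int f x0 x1 y0 y1 = 0) ->
  rect_int f (- s) s (- s) s = rect_int f (a - h) (a + h) (b - h) (b + h).
Proof.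
move=> h0 a1 a2 b1 b2 off.
rewrite (rect_int_hsplit f _ (a - h)) (rect_int_hsplit f _ (a + h) s).
rewrite (rect_int_vsplit f (a - h) (a + h) _ (b - h)) (rect_int_vsplit f (a - h) (a + h) _ (b + h) s).
rewrite (off (- s) (a - h)) ?(off (a + h) s) ?(off (a - h) (a + h) (- s)) ?(off _ _ _ s).
  by rewrite !add0r !addr0.
all: lra.
Qed.

Lemma rect_bd_dist (a b h : R) (z : C) : 0 <= h -> rect_bd (a - h) (a + h) (b - h) (b + h) z ->
  `|Re z - a| <= h /\ `|Im z - b| <= h.
Proof. by move=> h0 zb; rewrite !ler_norml; case: zb => -[/andP[? ?] [?|?]]; split; apply/andP; split; lra. Qed.

(** This serves the difference quotient in Cauchy's formula, which is continuous at [w] but not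
    known to be differentiable there. The integral reduces to a square of half side [h] about [w],
    where it is at most [8 h (|f w| + 1)]. *)
Lemma goursat_except f s w : `|Re w| < s -> `|Im w| < s -> (forall z, ccont f z) ->
  (forall z, `|Re z| <= s -> `|Im z| <= s -> z != w -> exists l, cdiff f z l) ->
  rect_int f (- s) s (- s) s = 0.
Proof.
move=> ws1 ws2 cf df; apply/eqP; rewrite -normc_eq0 eq_le normc_ge0 andbT.
apply: (@le0_of_all_eps _ (8 * (normc (f w) + 1)) _ _) => e e0.
have [d d0 dP] := cf w _ ltr01.
pose h := Num.min (Num.min e (d / 4)) (Num.min (s - `|Re w|) (s - `|Im w|)).
have h0 : 0 < h by rewrite !lt_min e0 divr_gt0 // !subr_gt0 ws1 ws2.
have [he hd] : h <= e /\ h <= d / 4 by rewrite !ge_min !lexx !orbT.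
have [h1 h2] : h <= s - `|Re w| /\ h <= s - `|Im w| by rewrite !ge_min !lexx !orbT.
have : [/\ - s <= Re w - h, Re w + h <= s, - s <= Im w - h & Im w + h <= s].
  by have := ler_norm (Re w); have := ler_norm (- Re w); have := ler_norm (Im w);
    have := ler_norm (- Im w); rewrite !normrN => *; split; lra.
case=> a1 a2 a3 a4.
have D z : - s <= Re z <= s -> - s <= Im z <= s -> z != w -> exists l, cdiff f z l.
  by rewrite -!ler_norml; exact: df.
have offw x0 x1 y0 y1 : x0 <= x1 -> y0 <= y1 -> - s <= x0 -> x1 <= s -> - s <= y0 -> y1 <= s ->
    (x1 < Re w \/ Re w < x0 \/ y1 < Im w \/ Im w < y0) -> rect_int f x0 x1 y0 y1 = 0.
  move=> x01 y01 b1 b2 b3 b4 o; apply: goursat_rect => // z /andP[z1 z2] /andP[z3 z4].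
  apply: D; [by rewrite (le_trans b1 z1) (le_trans z2 b2)|by rewrite (le_trans b3 z3) (le_trans z4 b4)|].
  by apply/eqP => zw; move: z1 z2 z3 z4; rewrite zw; lra.
rewrite (rect_int_shrink h0 a1 a2 a3 a4 offw).
apply: (@le_trans _ _ (2 * (normc (f w) + 1) * (Re w + h - (Re w - h) + (Im w + h - (Im w - h))))).
  apply: rect_int_le => [||z _|z zb]; [lra|lra|exact: cf|].
  have [zR zI] := rect_bd_dist (ltW h0) zb.
  have zw : normc (z - w) < d.
    by have := normc_le_ReIm (z - w); rewrite !raddfB /=; lra.
  have := dP _ zw; rewrite [w + _]addrC subrK => fz.
  by have := ler_normcD (f z - f w) (f w); rewrite subrK; lra.
have := normc_ge0 (f w) => fw0.
rewrite (_ : 2 * (normc (f w) + 1) * _ = h * (8 * (normc (f w) + 1))); last by ring.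
by rewrite ler_wpM2r // mulr_ge0 // addr_ge0.
Qed.

Lemma rect_int_eq f g x0 x1 y0 y1 :
  (forall z, Re z = x0 \/ Re z = x1 \/ Im z = y0 \/ Im z = y1 -> f z = g z) ->
  rect_int f x0 x1 y0 y1 = rect_int g x0 x1 y0 y1.
Proof.
move=> fg.
have H y : (y = y0 \/ y = y1) -> hint f y x0 x1 = hint g y x0 x1.
  by move=> yE; congr (cint _ _ _); apply/funext => t; apply: fg => /=; tauto.
have V x : (x = x0 \/ x = x1) -> vint f x y0 y1 = vint g x y0 y1.
  by move=> xE; congr (_ * cint _ _ _); apply/funext => t; apply: fg => /=; tauto.
by rewrite /rect_int !H ?V //; tauto.
Qed.

End CauchySquare.

(** * Cauchy integrals over a square *)

Section CauchyFormula.
Context {R : realType}.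
Local Notation C := R[i].
Implicit Types (f g F : C -> C) (z w l : C) (x y a b s e M : R) (n k : nat).

(** Up to the constant 2 pi i and for [f] holomorphic, this is the value of [f] at [w] when [n = 0],
    the Taylor coefficient of order [n] when [w = 0], and in general the Taylor remainder of order
    [n] divided by [w^n]. *)
Definition cauchy_int f s n w : C :=
  rect_int (fun z => f z * (z^-1 ^+ n * (z - w)^-1)) (- s) s (- s) s.

Lemma normc_ge_line s z : 0 < s -> Re z = - s \/ Re z = s \/ Im z = - s \/ Im z = s -> s <= normc z.
Proof.
move=> s0 h; have := normc_Re z; have := normc_Im z.
by case: h => [->|[->|[->|->]]]; rewrite ?normrN (gtr0_norm s0) => *.
Qed.

Lemma cauchy_kernel_cont s n w : 0 < s -> normc w < s ->
  rect_cont (fun z => z^-1 ^+ n * (z - w)^-1) (- s) s (- s) s.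
Proof.
move=> s0 ws z /(normc_ge_line s0) zs.
have z0 : z != 0 by rewrite -normc_gt0 (lt_le_trans s0).
have zw : z != w by apply/eqP => E; move: zs; rewrite E leNgt ws.
apply: ccontM; last exact: cdiff_ccont (cdiff_invB zw).
apply: cdiff_ccont; apply: cdiffX; exact: cdiff_inv.
Qed.

(** One step of the geometric series: 1/(z - w) = 1/z + w/(z (z - w)). *)
Lemma cauchy_int_rec f s n w : 0 < s -> normc w < s -> (forall z, ccont f z) ->
  cauchy_int f s n w = cauchy_int f s n 0 + w * cauchy_int f s n.+1 w.
Proof.
move=> s0 ws cf.
have s00 : normc (0 : C) < s by rewrite normc0.
have ss : - s <= s by lra.
have c m v : normc v < s -> rect_cont (fun z => f z * (z^-1 ^+ m * (z - v)^-1)) (- s) s (- s) s.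
  by move=> vs z /(cauchy_kernel_cont m s0 vs); exact: ccontM.
have cw : rect_cont (fun z => w * (f z * (z^-1 ^+ n.+1 * (z - w)^-1))) (- s) s (- s) s.
  by move=> z zl; apply: ccontZ; apply: c zl.
rewrite /cauchy_int -rect_intZ -?rect_intD //; try exact: c.
apply: rect_int_eq => z /(normc_ge_line s0) zs.
have z0 : z != 0 by rewrite -normc_gt0 (lt_le_trans s0).
have zw : z - w != 0 by rewrite subr_eq0; apply/eqP => E; move: zs; rewrite E leNgt ws.
rewrite subr0 exprSr [w * (_ * _)]mulrCA -mulrDr; congr (_ * _).
rewrite -!mulrA [w * (_ * _)]mulrCA -mulrDr; congr (_ * _).
by field; rewrite z0 zw.
Qed.

(** On the boundary |z| is at least [s] and |z - w| at least [s / 2], so the integrand is at most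
    [2 M / s^(n+1)]; [rect_int_le] contributes the factor [8 s]. *)
Lemma cauchy_int_le f s n w M : 0 < s -> normc w <= s / 2 -> (forall z, ccont f z) ->
  (forall z, rect_bd (- s) s (- s) s z -> normc (f z) <= M) ->
  normc (cauchy_int f s n w) <= 16 * M / s ^+ n.
Proof.
move=> s0 ws cf fM; have ws' : normc w < s by lra.
have ss : - s <= s by lra.
have c : rect_cont (fun z => f z * (z^-1 ^+ n * (z - w)^-1)) (- s) s (- s) s.
  by move=> z /(cauchy_kernel_cont n s0 ws'); exact: ccontM.
have sn : 0 < s ^+ n by rewrite exprn_gt0.
have := @rect_int_le _ _ _ _ _ _ (M / s ^+ n * (2 / s)) ss ss c.
move=> /(_ _)/le_trans; apply; last first.
  by rewrite le_eqVlt; apply/orP; left; apply/eqP; field; rewrite !gt_eqF.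
move=> z zb; have zs : s <= normc z by apply: normc_ge_line => //; case: zb => -[_]; tauto.
have z0 : 0 < normc z by lra.
rewrite !normcM normcX !normcV mulrA; apply: ler_pM; rewrite ?mulr_ge0 ?exprn_ge0 ?invr_ge0 ?normc_ge0 //.
  apply: ler_pM; rewrite ?exprn_ge0 ?invr_ge0 ?normc_ge0 ?fM // -exprVn.
  by rewrite lerXn2r ?nnegrE ?invr_ge0 ?normc_ge0 ?(ltW s0) // lef_pV2 ?posrE.
rewrite -[2 / s]invf_div lef_pV2 ?posrE ?divr_gt0 //.
  by have := ler_normc_sub z w; lra.
by have := ler_normc_sub z w; lra.
Qed.

Lemma cauchy_int1 s n : 0 < s -> (0 < n)%N -> cauchy_int (fun=> 1) s n 0 = 0.
Proof.
move=> s0; case: n => // n _.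
have s00 : normc (0 : C) < s by rewrite normc0.
have ss : - s <= s by lra.
apply: (@rect_int_primitive _ (fun z => - n.+1%:R^-1 * z^-1 ^+ n.+1)) => //.
  by move=> z zl; apply: ccontZ; exact: cauchy_kernel_cont zl.
move=> z zb; have zs : s <= normc z by apply: normc_ge_line => //; case: zb => -[_]; tauto.
have z0 : z != 0 by rewrite -normc_gt0 (lt_le_trans s0).
have := cdiffZ (- n.+1%:R^-1) (cdiffX n.+1 (cdiff_inv z0)).
congr cdiff => /=; rewrite subr0 mul1r -[z ^- 2]exprVn.
have n0 : n.+1%:R != 0 :> C by rewrite pnatr_eq0.
move: (n.+1%:R) n0 => u u0; rewrite [_ ^+ n.+1]exprS; move: (z^-1) (z^-1 ^+ n) => v p.
by field.
Qed.

(** The contour is not moved: by [cauchy_int_rec] and [cauchy_int1] the difference is [w^(k+1)]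
    times the integral with index [k+1], for every [k], and this is of the order of [2^-k]. *)
Lemma cauchy_const s w : 0 < s -> normc w <= s / 2 ->
  cauchy_int (fun=> 1) s 0 w = cauchy_int (fun=> 1) s 0 0.
Proof.
move=> s0 ws; have ws' : normc w < s by lra.
have c1 z : ccont (fun=> 1 : C) z by exact: ccont_cst.
have it k : cauchy_int (fun=> 1) s 1 w = w ^+ k * cauchy_int (fun=> 1) s k.+1 w.
  elim: k => [|k ->]; first by rewrite mul1r.
  by rewrite [in LHS]cauchy_int_rec // cauchy_int1 // add0r mulrA -exprSr.
suff E : cauchy_int (fun=> 1) s 1 w = 0.
  by rewrite cauchy_int_rec // E mulr0 addr0.
apply/eqP; rewrite -normc_eq0 eq_le normc_ge0 andbT.
apply: (@le0_of_all_eps _ (16 / s) _ _) => e e0.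
have [k ke] : exists k : nat, 1 / 2 ^+ k < e.
  exists (Num.truncn e^-1).+1; rewrite ltr_pdivrMr ?exprn_gt0 // mulrC -ltr_pdivrMr //.
  by rewrite mul1r (lt_trans (truncnS_gt _)) // -natrX ltr_nat ltn_expl.
rewrite (it k) normcM normcX.
have M1 z : rect_bd (- s) s (- s) s z -> normc (1 : C) <= 1 by rewrite normc1.
have := cauchy_int_le k.+1 s0 ws c1 M1; rewrite mulr1 => h.
have wk : normc w ^+ k <= (s / 2) ^+ k by rewrite lerXn2r ?nnegrE ?normc_ge0 ?divr_ge0 ?(ltW s0).
apply: le_trans (ler_pM _ (normc_ge0 _) wk h) _; first by rewrite exprn_ge0 ?normc_ge0.
have -> : (s / 2) ^+ k * (16 / s ^+ k.+1) = 1 / 2 ^+ k * (16 / s).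
  by rewrite expr_div_n exprS; field; rewrite !expf_neq0 ?gt_eqF.
by rewrite ler_wpM2r ?(ltW ke) // divr_ge0 // ltW.
Qed.

(** The value is 2 pi i, but only a lower bound for its modulus is wanted, which avoids computing an
    arctangent. Opposite sides combine to 4 i s times the integral of 1/(t^2 + s^2) over [-s, s].
    There the integrand stays within 1/(4 s^2) of 3/(4 s^2), so the integral is at least 1/s in
    modulus. *)
Lemma cauchy_const_ge s : 0 < s -> 4 <= normc (cauchy_int (fun=> 1) s 0 0).
Proof.
move=> s0; have ss : - s <= s by lra.
pose g (t : R) : C := ((t ^+ 2 + s ^+ 2)^-1)%:C%C.
have den t : 0 < t ^+ 2 + s ^+ 2 by rewrite ltr_wpDl ?sqr_ge0 // exprn_gt0.
have denC t : (t%:C%C ^+ 2 + s%:C%C ^+ 2) != 0 :> C.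
  by rewrite -!rmorphXn -rmorphD /= fmorph_eq0 gt_eqF.
pose f z := (1 : C) * (z^-1 ^+ 0 * (z - 0)^-1).
have fE z : f z = z^-1 by rewrite /f expr0 !mul1r subr0.
have cf : rect_cont f (- s) s (- s) s.
  move=> z zl; apply: ccontZ; apply: cauchy_kernel_cont zl => //; by rewrite normc0.
have zE x y : (x +i* y)%C = x%:C%C + 'i%C * y%:C%C :> C by simpc.
have i2 : 'i%C * 'i%C = -1 :> C by rewrite -expr2 sqr_i.
have gE t : g t = (t%:C%C ^+ 2 + s%:C%C ^+ 2)^-1 by rewrite /g fmorphV rmorphD !rmorphXn.
have cH y : (y = - s \/ y = s) -> forall t, rcont (fun t => f (t +i* y)%C) t.
  by move=> ys t; apply: rcont_hline; apply: cf => /=; tauto.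
have cV x : (x = - s \/ x = s) -> forall t, rcont (fun t => f (x +i* t)%C) t.
  by move=> ys t; apply: rcont_vline; apply: cf => /=; tauto.
have s0C : s%:C%C != 0 :> C by rewrite fmorph_eq0 gt_eqF.
have hE t : f (t +i* (- s))%C + -1 * f (t +i* s)%C = 2 * 'i%C * s%:C%C * g t.
  rewrite !fE gE (zE t (- s)) (zE t s) rmorphN mulrN.
  have -> : t%:C%C ^+ 2 + s%:C%C ^+ 2 = (t%:C%C - 'i%C * s%:C%C) * (t%:C%C + 'i%C * s%:C%C) :> C.
    by rewrite [RHS](_ : _ = t%:C%C ^+ 2 - ('i%C * 'i%C) * s%:C%C ^+ 2); [rewrite i2; ring|ring].
  have n1 : (t%:C%C - 'i%C * s%:C%C) * (t%:C%C + 'i%C * s%:C%C) != 0 :> C.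
    rewrite [X in X != 0](_ : _ = t%:C%C ^+ 2 - ('i%C * 'i%C) * s%:C%C ^+ 2); last by ring.
    by rewrite i2 mulN1r opprK.
  by move: n1; rewrite mulf_eq0 negb_or => /andP[n1 n2]; field; rewrite n1 n2.
have vE t : f (s +i* t)%C + -1 * f ((- s) +i* t)%C = 2 * s%:C%C * g t.
  rewrite !fE gE (zE (- s) t) (zE s t) rmorphN.
  have -> : t%:C%C ^+ 2 + s%:C%C ^+ 2 = (s%:C%C + 'i%C * t%:C%C) * (s%:C%C - 'i%C * t%:C%C) :> C.
    by rewrite [RHS](_ : _ = s%:C%C ^+ 2 - ('i%C * 'i%C) * t%:C%C ^+ 2); [rewrite i2; ring|ring].
  have n1 : (s%:C%C + 'i%C * t%:C%C) * (s%:C%C - 'i%C * t%:C%C) != 0 :> C.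
    rewrite [X in X != 0](_ : _ = s%:C%C ^+ 2 - ('i%C * 'i%C) * t%:C%C ^+ 2); last by ring.
    by rewrite i2 mulN1r opprK addrC.
  have -> : - s%:C%C + 'i%C * t%:C%C = - (s%:C%C - 'i%C * t%:C%C) :> C by ring.
  by move: n1; rewrite mulf_eq0 negb_or => /andP[n1 n2]; field; rewrite ?oppr_eq0 n1 ?n2.
have cg t : rcont g t.
  have := @rcontZ _ ((2 * s%:C%C)^-1) _ t (rcontD (cV s (or_intror erefl) t) (rcontZ (-1) (cV (- s) (or_introl erefl) t))).
  congr rcont; apply/funext => u; rewrite vE mulKf //.
  by rewrite mulf_neq0 // pnatr_eq0.
have E : cauchy_int (fun=> 1) s 0 0 = 4 * 'i%C * s%:C%C * cint g (- s) s.
  have e1 : hint f (- s) (- s) s + -1 * hint f s (- s) s = 2 * 'i%C * s%:C%C * cint g (- s) s.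
    rewrite -!cintZ //; last by apply: cH; right.
    rewrite -cintD //; [|by apply: cH; left|by move=> t; apply: rcontZ; apply: cH; right].
    by congr (cint _ _ _); apply/funext => t; rewrite hE.
  have e2 : vint f s (- s) s + -1 * vint f (- s) (- s) s = 'i%C * (2 * s%:C%C * cint g (- s) s).
    rewrite /vint mulrCA -mulrDr; congr (_ * _).
    rewrite -!cintZ //; last by apply: cV; left.
    rewrite -cintD //; [|by apply: cV; right|by move=> t; apply: rcontZ; apply: cV; left].
    by congr (cint _ _ _); apply/funext => t; rewrite vE.
  rewrite /cauchy_int -/f /rect_int.
  have -> : hint f (- s) (- s) s + vint f s (- s) s - hint f s (- s) s - vint f (- s) (- s) s =
    (hint f (- s) (- s) s + -1 * hint f s (- s) s) + (vint f s (- s) s + -1 * vint f (- s) (- s) s) by ring.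
  rewrite e1 e2; ring.
pose c : C := (3 / (4 * s ^+ 2))%:C%C.
have s2 : 0 < s ^+ 2 by rewrite exprn_gt0.
have cc t : rcont (fun=> - c) t.
  by move=> e e0; exists 1 => // h _; rewrite subrr normc0 ltW.
have Ic : cint (fun=> - c) (- s) s = - c * (2 * s)%:C%C.
  rewrite (@cint_eq _ (fun t => - c * t%:C%C)) //.
    by rewrite -mulrBr -rmorphB /=; congr (_ * _%:C%C); ring.
  move=> t _; have -> : (fun t0 : R => - c * t0%:C%C) = (fun t0 => (fun z => - c * z) (0 + 1 * t0%:C%C)).
    by apply/funext => u; rewrite add0r mul1r.
  rewrite -[X in rdiff _ _ X](mulr1 (- c)); apply: rdiff_line.
  by rewrite -[X in cdiff _ _ X](mulr1 (- c)); apply: cdiffZ; exact: cdiff_id.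
have B : normc (cint g (- s) s - c * (2 * s)%:C%C) <= 1 / (4 * s ^+ 2) * (2 * s).
  rewrite -mulNr -Ic -cintD //.
  apply: le_trans (@cint_le _ _ _ _ (1 / (4 * s ^+ 2)) ss _ _) _.
  - by move=> t; apply: rcontD.
  - move=> t /andP[t1 t2]; 
    have -> : g t + - c = ((t ^+ 2 + s ^+ 2)^-1 - 3 / (4 * s ^+ 2))%:C%C by rewrite rmorphB.
    rewrite normcR.
    have t2s : t ^+ 2 <= s ^+ 2 by rewrite -ler_sqrt ?sqr_ge0 // !sqrtr_sqr (gtr0_norm s0) ler_norml t1.
    have i1 : (2 * s ^+ 2)^-1 <= (t ^+ 2 + s ^+ 2)^-1.
      by rewrite lef_pV2 ?posrE ?den ?mulr_gt0 //; lra.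
    have i3 : (t ^+ 2 + s ^+ 2)^-1 <= (s ^+ 2)^-1.
      by rewrite lef_pV2 ?posrE ?den // lerDr sqr_ge0.
    have E1 : (2 * s ^+ 2)^-1 = 2 * (1 / (4 * s ^+ 2)) by field; rewrite gt_eqF.
    have E2 : (s ^+ 2)^-1 = 4 * (1 / (4 * s ^+ 2)) by field; rewrite gt_eqF.
    have E3 : 3 / (4 * s ^+ 2) = 3 * (1 / (4 * s ^+ 2)) by field; rewrite gt_eqF.
    rewrite ler_norml; apply/andP; split; lra.
  by rewrite opprK; apply: ler_wpM2l; [rewrite divr_ge0 // mulr_ge0 ?ltW|lra].
have G : s^-1 <= normc (cint g (- s) s).
  have := ler_normc_sub (c * (2 * s)%:C%C) (c * (2 * s)%:C%C - cint g (- s) s).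
  rewrite subKr; rewrite normcBC in B.
  have -> : normc (c * (2 * s)%:C%C) = 3 / (2 * s).
    rewrite normcM !normcR -normrM ger0_norm; first by field; rewrite gt_eqF.
    by rewrite mulr_ge0 ?divr_ge0 ?mulr_ge0 ?ltW.
  have E4 : 1 / (4 * s ^+ 2) * (2 * s) = 1 / (2 * s) by field; rewrite gt_eqF.
  have E5 : 3 / (2 * s) = 3 * (1 / (2 * s)) by field; rewrite gt_eqF.
  have E6 : s^-1 = 2 * (1 / (2 * s)) by field; rewrite gt_eqF.
  lra.
rewrite E !normcM normci normcR gtr0_norm // mulr1.
have -> : normc (4 : C) = 4.
  by rewrite -[4 in LHS](rmorph_nat (real_complex R)) normcR ger0_norm.
rewrite -mulrA ler_pMr // -(mulfV (lt0r_neq0 s0)) ler_pM2l //.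
Qed.

End CauchyFormula.

(** * Taylor expansion with remainder and the maximum principle *)

Section PowerSeries.
Context {R : realType}.
Local Notation C := R[i].
Implicit Types (f g F : C -> C) (z w l : C) (x y a b s e M : R) (n k : nat).

Definition square_bd s z := rect_bd (- s) s (- s) s z.

Definition clamp s x : R := Num.max (- s) (Num.min s x).

Lemma clamp_le s x : 0 <= s -> `|clamp s x| <= s.
Proof.
move=> s0; rewrite ler_norml /clamp le_max lexx /= ge_max ge_min lexx /=.
by rewrite andbT; lra.
Qed.

Lemma clamp_id s x : `|x| <= s -> clamp s x = x.
Proof.
by rewrite ler_norml /clamp => /andP[x1 x2]; rewrite (min_idPr x2) (max_idPr x1).
Qed.

Lemma clamp_lip s x y : `|clamp s x - clamp s y| <= `|x - y|.
Proof.
have h1 := ler_norm (x - y); have h2 := ler_norm (y - x); rewrite (distrC y x) in h2.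
rewrite /clamp; case: (leP s x) => sx; case: (leP s y) => sy.
- by rewrite subrr normr0.
- by case: (leP (- s) s) => ?; case: (leP (- s) y) => ?; rewrite ler_norml; apply/andP; split; lra.
- by case: (leP (- s) s) => ?; case: (leP (- s) x) => ?; rewrite ler_norml; apply/andP; split; lra.
by case: (leP (- s) x) => ?; case: (leP (- s) y) => ?; rewrite ler_norml; apply/andP; split; lra.
Qed.

(** The retraction of the plane onto a closed square. Composition with it turns a function
    continuous on the square into one continuous on the plane, as [goursat] and [rect_cont] ask. *)
Definition csquare s z : C := (clamp s (Re z) +i* clamp s (Im z))%C.

Lemma ccont_csquare s z : ccont (csquare s) z.
Proof.
move=> e e0; exists (e / 2) => [|h hd]; first by rewrite divr_gt0.
apply: le_trans (normc_le_ReIm _) _ => /=.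
have hR : `|Re (z + h) - Re z| <= normc h.
  by have := normc_ReB (z + h) z; rewrite addrAC subrr add0r.
have hI : `|Im (z + h) - Im z| <= normc h.
  by have := normc_ImB (z + h) z; rewrite addrAC subrr add0r.
have := clamp_lip s (Re (z + h)) (Re z); have := clamp_lip s (Im (z + h)) (Im z).
lra.
Qed.

Lemma csquare_lt s z : 0 < s -> normc (csquare s z) < 5 / 3 * s.
Proof.
move=> s0; rewrite -(@ltr_pXn2r _ 2%N) ?nnegrE ?normc_ge0 ?mulr_ge0 ?(ltW s0) //.
rewrite sqr_normcE /=.
have h x : (clamp s x) ^+ 2 <= s ^+ 2.
  by rewrite -(real_normK (num_real _)) lerXn2r ?nnegrE ?(ltW s0) // clamp_le // ltW.
have s2 : 0 < s ^+ 2 by rewrite exprn_gt0.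
have := h (Re z); have := h (Im z); rewrite exprMn.
have -> : (5 / 3) ^+ 2 = 25 / 9 :> R by field.
lra.
Qed.

Lemma csquare_id s z : `|Re z| <= s -> `|Im z| <= s -> csquare s z = z.
Proof. by move=> *; rewrite /csquare !clamp_id //; case: (z). Qed.

Lemma disc0 (a : C) (r : R) : 0 < r -> disc a r a.
Proof. by rewrite /disc /= subrr normc0. Qed.

Lemma holomorphic_ccont (D : set C) f z : holomorphic_on D f -> D z -> ccont f z.
Proof. by move=> hf /hf/derivable_cdiff/cdiff_ccont. Qed.

(** The coefficients do not depend on [M], so one expansion serves all bounds and all orders. The
    constant is the 16 of [cauchy_int_le] divided by the lower bound 4 of [cauchy_const_ge]. *)
Lemma cauchy_power_series f s : 0 < s -> holomorphic_on (disc 0 (2 * s)) f ->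
  exists c : nat -> C, forall M, (forall z, square_bd s z -> normc (f z) <= M) ->
  forall n w, normc w <= s / 2 ->
    normc (f w - \sum_(k < n) c k * w ^+ k) <= 4 * M * (normc w / s) ^+ n.
Proof.
(* The square of half side [s'] exceeds the square of integration, so that [F] equals [f] near the
   latter, and still lies in the disc of radius [2 s], because the square root of 2 is less than 5/3
   and 5/3 times 6/5 is 2. *)
move=> s0 hf; pose s' := 6 / 5 * s; have s'0 : 0 < s' by rewrite /s'; lra.
pose F z := f (csquare s' z).
have inD z : disc 0 (2 * s) (csquare s' z).
  by rewrite /disc /= subr0; have := csquare_lt z s'0; rewrite /s'; lra.
have cF z : ccont F z.
  by apply: ccont_comp; [exact: ccont_csquare|exact: holomorphic_ccont (inD z)].
have FE z : `|Re z| <= s' -> `|Im z| <= s' -> F z = f z.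
  by move=> *; rewrite /F csquare_id.
have dF z : `|Re z| <= s -> `|Im z| <= s -> exists l, cdiff F z l.
  move=> zR zI; exists (cderiv f z).
  have zs : csquare s' z = z by apply: csquare_id; rewrite /s'; lra.
  have := derivable_cdiff (hf _ (inD z)); rewrite zs => /cdiff_near; apply.
  exists (s / 5) => [|w]; first by lra.
  rewrite /disc /= => wz.
  by rewrite FE //; [have := normc_ReB w z; have := ler_normD (Re w - Re z) (Re z)|
    have := normc_ImB w z; have := ler_normD (Im w - Im z) (Im z)]; rewrite subrK /s'; lra.
pose kap : C := cauchy_int (fun=> 1) s 0 0.
have kap4 : 4 <= normc kap by exact: cauchy_const_ge.
have kap0 : kap != 0 by rewrite -normc_gt0; lra.
exists (fun k => cauchy_int F s k 0 / kap) => M fM n w ws.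
have ws' : normc w < s by lra.
have FM z : square_bd s z -> normc (F z) <= M.
  by move=> zb; rewrite FE ?fM // ler_norml; apply/andP; rewrite /s';
    case: zb => -[/andP[? ?] [?|?]]; split; lra.
have rep : f w * kap = cauchy_int F s 0 w.
  have wR : `|Re w| < s by have := normc_Re w; lra.
  have wI : `|Im w| < s by have := normc_Im w; lra.
  have Fw : F w = f w by apply: FE; rewrite /s'; lra.
  have [l dl] := dF w (ltW wR) (ltW wI).
  (* The difference quotient of [F] at [w], completed by the derivative; its integral vanishes by
     [goursat_except], and expanding it gives Cauchy's formula. *)
  pose g z := if z == w then l else (F z + - F w) * (z - w)^-1.
  have gE z : z != w -> exists2 d : R, 0 < d & forall u, disc z d u -> (F u + - F w) * (u - w)^-1 = g u.
    move=> zw; exists (normc (z - w)); first by rewrite normc_gt0 subr_eq0.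
    move=> u; rewrite /disc /= /g normcBC; case: eqP => // ->; by rewrite ltxx.
  have cg z : ccont g z.
    have [->|zw] := eqVneq z w; last first.
      apply: ccont_near (gE _ zw); apply: ccontM; last exact: cdiff_ccont (cdiff_invB zw).
      by apply: ccontD => //; exact: ccont_cst.
    move=> e e0; have [d d0 dP] := dl _ e0; exists d => // h hd; rewrite /g eqxx.
    have [h0|h0] := eqVneq (w + h) w; first by rewrite subrr normc0 ltW.
    have hn0 : h != 0 by apply: contraNneq h0 => ->; rewrite addr0.
    rewrite [w + h - w]addrAC subrr add0r.
    rewrite -(ler_pM2r (_ : 0 < normc h)) ?normc_gt0 // -normcM mulrBl mulfVK //.
    exact: dP.
  have := @goursat_except _ g s w wR wI cg.
  have dg z : `|Re z| <= s -> `|Im z| <= s -> z != w -> exists l, cdiff g z l.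
    move=> zR zI zw; have [m dm] := dF z zR zI.
    exists ((F z + - F w) * - (z - w) ^- 2 + (z - w)^-1 * (m + 0)).
    by apply: cdiff_near (gE _ zw); apply: cdiffM (cdiffD dm (cdiff_cst _ _)) (cdiff_invB zw).
  move=> /(_ dg).
  have ss : - s <= s by lra.
  pose k z := z^-1 ^+ 0 * (z - w)^-1.
  have ck : rect_cont k (- s) s (- s) s by exact: cauchy_kernel_cont.
  rewrite (@rect_int_eq _ g (fun z => F z * k z + (- f w) * (1 * k z))); last first.
    move=> z /(normc_ge_line s0) zs; rewrite /g ifN; first by rewrite Fw /k expr0; ring.
    by apply/eqP => E; move: zs; rewrite E leNgt ws'.
  rewrite rect_intD // => [||z zl]; last 2 first.
  - by move=> z zl; apply: ccontM => //; exact: ck.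
  - by apply: ccontZ; apply: ccontZ; exact: ck.
  rewrite rect_intZ // => [|z zl]; last by apply: ccontZ; exact: ck.
  rewrite -/(cauchy_int F s 0 w) -/(cauchy_int (fun=> 1) s 0 w) cauchy_const // -/kap.
  by move=> /eqP; rewrite mulNr subr_eq0 => /eqP.
have expn : cauchy_int F s 0 w = \sum_(k < n) cauchy_int F s k 0 * w ^+ k + w ^+ n * cauchy_int F s n w.
  elim: n => [|n ->]; first by rewrite big_ord0 add0r mul1r.
  by rewrite big_ord_recr /= [in LHS](cauchy_int_rec n) // exprS; ring.
have -> : f w - \sum_(k < n) cauchy_int F s k 0 / kap * w ^+ k = w ^+ n * cauchy_int F s n w / kap.
  apply: (mulIf kap0); rewrite mulrBl divfK // rep expn mulr_suml addrAC.
  rewrite [X in X + _](_ : _ = 0) ?add0r //; apply/eqP; rewrite subr_eq0; apply/eqP.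
  by apply: eq_bigr => k _; rewrite mulrAC divfK.
rewrite normc_div normcM normcX ler_pdivrMr ?(lt_le_trans _ kap4) //.
have h := cauchy_int_le n s0 ws cF FM.
have M0 : 0 <= M by apply: le_trans (FM (s +i* 0)%C _); rewrite ?normc_ge0 //; right; split => /=; [apply/andP; split; lra|right].
have A0 : 0 <= 4 * M * (normc w / s) ^+ n by rewrite !mulr_ge0 // exprn_ge0 // divr_ge0 ?normc_ge0 // ltW.
apply: le_trans _ (ler_wpM2l A0 kap4).
apply: le_trans (ler_wpM2l (exprn_ge0 _ (normc_ge0 _)) h) _.
rewrite le_eqVlt; apply/orP; left; apply/eqP; rewrite expr_div_n; field.
by rewrite expf_neq0 // gt_eqF.
Qed.

Lemma holomorphic_shift (a : C) f (r : R) : holomorphic_on (disc a r) f ->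
  holomorphic_on (disc 0 r) (fun z => f (a + z)).
Proof.
move=> hf z; rewrite /disc /= subr0 => zr.
have := hf (a + z); rewrite /disc /= addrAC subrr add0r => /(_ zr)/derivable_cdiff d.
apply: (@cdiff_derivable _ _ _ (cderiv f (a + z) * (0 + 1))).
by apply: (cdiff_comp (cdiffD (cdiff_cst a z) (cdiff_id z))).
Qed.

Lemma power_series (a : C) f (r : R) : 0 < r -> holomorphic_on (disc a r) f ->
  exists c : nat -> C, forall M, (forall z, disc a r z -> normc (f z) <= M) ->
  forall n w, normc w <= r / 4 ->
    normc (f (a + w) - \sum_(k < n) c k * w ^+ k) <= 4 * M * (2 * normc w / r) ^+ n.
Proof.
move=> r0 /holomorphic_shift hf; have s0 : 0 < r / 2 by rewrite divr_gt0.
rewrite -(_ : 2 * (r / 2) = r) in hf; last by field.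
have [c cP] := cauchy_power_series s0 hf; exists c => M fM n w wr.
have -> : 2 * normc w / r = normc w / (r / 2) by field; rewrite gt_eqF.
apply: cP => [z zb|]; last by lra.
apply: fM; rewrite /disc /= addrAC subrr add0r.
have zR : Re z ^+ 2 <= (r / 2) ^+ 2.
  rewrite -(real_normK (num_real (Re z))) lerXn2r ?nnegrE ?(ltW s0) // ler_norml.
  by apply/andP; case: zb => -[/andP[? ?] [?|?]]; split; lra.
have zI : Im z ^+ 2 <= (r / 2) ^+ 2.
  rewrite -(real_normK (num_real (Im z))) lerXn2r ?nnegrE ?(ltW s0) // ler_norml.
  by apply/andP; case: zb => -[/andP[? ?] [?|?]]; split; lra.
rewrite -(@ltr_pXn2r _ 2%N) ?nnegrE ?normc_ge0 ?(ltW r0) // sqr_normcE.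
apply: le_lt_trans (lerD zR zI) _; rewrite expr_div_n.
have : 0 < r ^+ 2 by rewrite exprn_gt0.
by rewrite (_ : 2 ^+ 2 = 4 :> R); [lra|ring].
Qed.

(* The estimate with the constant 4 given by Cauchy's formula is applied to all
   powers of [f], which brings the constant down to 1. *)
Lemma max_modulus (a : C) f s M : 0 < s -> holomorphic_on (disc a (2 * s)) f ->
  (forall z, square_bd s (z - a) -> normc (f z) <= M) -> normc (f a) <= M.
Proof.
move=> s0 hf fM.
have M0 : 0 <= M.
  apply: le_trans (fM (a + (s +i* 0)%C) _); rewrite ?normc_ge0 // addrAC subrr add0r.
  by right; split => /=; [apply/andP; split; lra|right].
have pw n : normc (f a) ^+ n <= 4 * M ^+ n.
  have hfn : holomorphic_on (disc a (2 * s)) (fun z => f z ^+ n).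
    by move=> z /hf/derivable_cdiff/(cdiffX n)/cdiff_derivable.
  have [c cP] := cauchy_power_series s0 (holomorphic_shift hfn).
  have := cP (M ^+ n) _ 0%N 0; rewrite big_ord0 subr0 normc0 expr0 mulr1 addr0 normcX; apply; last first.
    by rewrite divr_ge0 // ltW.
  move=> z zb; rewrite normcX lerXn2r ?nnegrE ?normc_ge0 //; apply: fM.
  by rewrite addrAC subrr add0r.
rewrite leNgt; apply/negP => Mf.
have f0 : 0 < normc (f a) by lra.
have [M00|M1] := eqVneq M 0.
  by have := pw 1%N; rewrite M00 !expr1 mulr0 => ?; lra.
have {}M0 : 0 < M by rewrite lt_neqAle eq_sym M1.
pose q := normc (f a) / M - 1.
have q0 : 0 < q by rewrite subr_gt0 ltr_pdivlMr // mul1r.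
(* Bernoulli's inequality: once [n q > 3], the [n]-th power of the ratio exceeds the constant 4
   allowed by [pw]. *)
have qn n : 1 + n%:R * q <= (1 + q) ^+ n.
  elim: n => [|n IH]; first by rewrite mul0r addr0 expr0.
  rewrite exprS; apply: le_trans (ler_wpM2l _ IH); last by lra.
  have : 0 <= n%:R * q * q by rewrite !mulr_ge0 // ltW.
  by rewrite -natr1; lra.
pose n := (Num.truncn (3 / q)).+1.
have nq : 3 < n%:R * q by rewrite -ltr_pdivrMr // truncnS_gt.
have := pw n; rewrite -ler_pdivrMr ?exprn_gt0 // -expr_div_n.
have E : 1 + q = normc (f a) / M by rewrite /q addrC subrK.
by have := qn n; rewrite E; lra.
Qed.

End PowerSeries.

(* Limits along a fixed nonprincipal ultrafilter replace the extraction of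
   subsequences: every bounded sequence converges along it. *)
Definition omega : set_system nat :=
  projT1 (cid (ultraFilterLemma (eventually_filter : ProperFilter \oo))).

#[global] Instance omega_ultra : UltraFilter omega.
Proof. by rewrite /omega; case: cid => ? []. Qed.

#[global] Instance omega_proper : ProperFilter omega.
Proof. exact: ultra_proper. Qed.

Lemma omega_eventually (P : set nat) : (\forall n \near \oo, P n) -> omega P.
Proof. by rewrite /omega; case: cid => /= U [_]; apply. Qed.

Lemma omega_geq m : omega [set n | (m <= n)%N].
Proof. by apply: omega_eventually; exists m. Qed.

Lemma omega_neq0 (P : set nat) : omega P -> exists n, P n.
Proof. exact: filter_ex. Qed.

Lemma omegaC (P : set nat) : ~ omega P -> omega (~` P).
Proof. by have [] := @in_ultra_setVsetC _ omega P _. Qed.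

Lemma omega_finite (T : finType) (k : nat -> T) : exists t, omega [set n | k n = t].
Proof.
suff key (s : seq T) : omega [set n | k n \in s] -> exists t, omega [set n | k n = t].
  by apply: (key (enum T)); apply: filterS filterT => n _ /=; rewrite mem_enum.
elim: s => [|t s IH] H; first by have [n] := omega_neq0 H.
have [|/omegaC Ht] := pselect (omega [set n | k n = t]); first by exists t.
apply: IH; apply: filterS (filterI H Ht) => n /= [].
by rewrite in_cons => /predU1P[].
Qed.

(** * Limits along an ultrafilter and local theory *)

Section OmegaLimit.
Context {R : realType}.
Local Notation C := R[i].
Implicit Types (f g F : C -> C) (z w l : C) (x y a b s e M : R) (n k : nat).

Lemma omega_small (c : R) : 0 < c -> omega [set n | n.+1%:R^-1 < c].
Proof.
move=> c0; apply: filterS (omega_geq (Num.truncn c^-1)) => n /= h.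
rewrite invf_plt ?posrE // (lt_le_trans (truncnS_gt _)) // ler_nat //.
Qed.

Definition slim (u : nat -> C) l := forall e : R, 0 < e -> omega [set n | normc (u n - l) < e].

Definition ucvg (A : set C) (f : nat -> C -> C) g := forall e : R, 0 < e ->
  omega [set n | forall z, A z -> normc (f n z - g z) < e].

(** The limit is the supremum of the numbers that bound [u] from below on a set of [omega]. Just
    above the supremum this fails, and the ultrafilter then contains the complementary set. *)
Lemma real_omega_limit (u : nat -> R) M : omega [set n | `|u n| <= M] ->
  exists x : R, forall e, 0 < e -> omega [set n | `|u n - x| < e].
Proof.
move=> uM; pose S := [set x | omega [set n | x <= u n]].
have SM : S (- M) by apply: filterS uM => n /=; rewrite ler_norml => /andP[].
have ubS : ubound S M.
  move=> x /= Sx; have [n [/= h]] := omega_neq0 (filterI Sx uM).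
  by rewrite ler_norml => /andP[_]; exact: le_trans.
have hS : has_sup S by split; [exists (- M)|exists M].
exists (sup S) => e e0.
have [x Sx xs] := sup_adherent e0 hS.
have : ~ S (sup S + e).
  by move=> /(ub_le_sup (ex_intro _ M ubS)); rewrite gerDl leNgt e0.
move=> /omegaC H; apply: filterS (filterI Sx H) => n /= [h1] /negP.
by rewrite -ltNge ltr_norml => h2; apply/andP; split; lra.
Qed.

Lemma omega_limit (u : nat -> C) M : omega [set n | normc (u n) <= M] -> exists l, slim u l.
Proof.
move=> uM.
have [|x xP] := @real_omega_limit (fun n => Re (u n)) M.
  by apply: filterS uM => n /=; apply: le_trans; exact: normc_Re.
have [|y yP] := @real_omega_limit (fun n => Im (u n)) M.
  by apply: filterS uM => n /=; apply: le_trans; exact: normc_Im.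
exists (x +i* y)%C => e e0; have e2 : 0 < e / 2 by rewrite divr_gt0.
apply: filterS (filterI (xP _ e2) (yP _ e2)) => n /= [h1 h2].
by have := normc_le_ReIm (u n - (x +i* y)%C); rewrite !raddfB /=; lra.
Qed.

Lemma slim_le (u : nat -> C) l M : slim u l -> omega [set n | normc (u n) <= M] -> normc l <= M.
Proof.
move=> ul uM; apply: le_of_all_eps => e e0.
have [n [/= h1 h2]] := omega_neq0 (filterI (ul e e0) uM).
by have := ler_normc_sub l (l - u n); rewrite subKr (normcBC l); lra.
Qed.

Lemma slim_unique (u : nat -> C) l m : slim u l -> slim u m -> l = m.
Proof.
move=> ul um; apply/eqP; rewrite -subr_eq0 -normc_eq0 eq_le normc_ge0 andbT.
apply: le_of_all_eps => e e0; have e2 : 0 < e / 2 by rewrite divr_gt0.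
have [n [/= h1 h2]] := omega_neq0 (filterI (ul _ e2) (um _ e2)).
by have := normc_triangle l (u n) m; rewrite (normcBC l (u n)); lra.
Qed.

Lemma slim_cst l : slim (fun=> l) l.
Proof. by move=> e e0; apply: filterS filterT => n _ /=; rewrite subrr normc0. Qed.

Lemma slim_near (u v : nat -> C) l : slim u l -> omega [set n | u n = v n] -> slim v l.
Proof. by move=> ul uv e e0; apply: filterS (filterI (ul e e0) uv) => n /= [h <-]. Qed.

Lemma slimD (u v : nat -> C) l m : slim u l -> slim v m -> slim (fun n => u n + v n) (l + m).
Proof.
move=> ul vm e e0; have e2 : 0 < e / 2 by rewrite divr_gt0.
apply: filterS (filterI (ul _ e2) (vm _ e2)) => n /= [h1 h2].
rewrite (_ : u n + v n - (l + m) = (u n - l) + (v n - m)); last by ring.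
by have := ler_normcD (u n - l) (v n - m); lra.
Qed.

Lemma slimM (u v : nat -> C) l m : slim u l -> slim v m -> slim (fun n => u n * v n) (l * m).
Proof.
move=> ul vm e e0.
have l0 : 0 < normc l + 1 by rewrite ltr_wpDl ?normc_ge0.
have m0 : 0 < normc m + 1 by rewrite ltr_wpDl ?normc_ge0.
have e1 : 0 < e / 2 / (normc m + 1) by rewrite !divr_gt0.
have e2 : 0 < e / 2 / (normc l + 1) by rewrite !divr_gt0.
apply: filterS (filterI (filterI (ul _ e1) (ul _ ltr01)) (vm _ e2)) => n /= [[h1 h2] h3].
rewrite (_ : u n * v n - l * m = (u n - l) * m + u n * (v n - m)); last by ring.
have un : normc (u n) <= normc l + 1.
  by have := ler_normc_sub (u n) l; lra.
have a1 : normc ((u n - l) * m) < e / 2.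
  rewrite normcM; rewrite ltr_pdivlMr // in h1; apply: le_lt_trans h1.
  by rewrite ler_wpM2l ?normc_ge0 // lerDl.
have a2 : normc (u n * (v n - m)) <= e / 2.
  rewrite normcM; rewrite ltr_pdivlMr // in h3; apply: le_trans (ltW h3).
  by rewrite mulrC ler_wpM2l ?normc_ge0.
by have := ler_normcD ((u n - l) * m) (u n * (v n - m)); lra.
Qed.

Lemma slimN (u : nat -> C) l : slim u l -> slim (fun n => - u n) (- l).
Proof. by move=> ul e e0; apply: filterS (ul e e0) => n /=; rewrite -opprD normcN. Qed.

Lemma slimB (u v : nat -> C) l m : slim u l -> slim v m -> slim (fun n => u n - v n) (l - m).
Proof. by move=> ul vm; apply: slimD => //; exact: slimN. Qed.

Lemma slim_sum (I : Type) (r : seq I) (P : pred I) (u : I -> nat -> C) (l : I -> C) :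
  (forall i, P i -> slim (u i) (l i)) ->
  slim (fun n => \sum_(i <- r | P i) u i n) (\sum_(i <- r | P i) l i).
Proof.
move=> H; elim: r => [|i r IH].
  rewrite big_nil; apply: slim_near (slim_cst 0) _.
  by apply: filterS filterT => n _ /=; rewrite big_nil.
rewrite big_cons; case: ifPn => Pi.
  apply: slim_near (slimD (H _ Pi) IH) _.
  by apply: filterS filterT => n _ /=; rewrite big_cons Pi.
apply: slim_near IH _.
by apply: filterS filterT => n _ /=; rewrite big_cons (negbTE Pi).
Qed.

Lemma slim_prod (I : Type) (r : seq I) (P : pred I) (u : I -> nat -> C) (l : I -> C) :
  (forall i, P i -> slim (u i) (l i)) ->
  slim (fun n => \prod_(i <- r | P i) u i n) (\prod_(i <- r | P i) l i).
Proof.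
move=> H; elim: r => [|i r IH].
  rewrite big_nil; apply: slim_near (slim_cst 1) _.
  by apply: filterS filterT => n _ /=; rewrite big_nil.
rewrite big_cons; case: ifPn => Pi.
  apply: slim_near (slimM (H _ Pi) IH) _.
  by apply: filterS filterT => n _ /=; rewrite big_cons Pi.
apply: slim_near IH _.
by apply: filterS filterT => n _ /=; rewrite big_cons (negbTE Pi).
Qed.

Lemma ucvg_slim A (f : nat -> C -> C) g z : ucvg A f g -> A z -> slim (fun n => f n z) (g z).
Proof. by move=> fg Az e e0; apply: filterS (fg e e0) => n /=; exact. Qed.

Lemma ucvg_sub (A B : set C) (f : nat -> C -> C) g : B `<=` A -> ucvg A f g -> ucvg B f g.
Proof. by move=> BA fg e e0; apply: filterS (fg e e0) => n /= h z /BA /h. Qed.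

Lemma ucvgD A (f1 f2 : nat -> C -> C) g1 g2 : ucvg A f1 g1 -> ucvg A f2 g2 ->
  ucvg A (fun n z => f1 n z + f2 n z) (fun z => g1 z + g2 z).
Proof.
move=> h1 h2 e e0; have e2 : 0 < e / 2 by rewrite divr_gt0.
apply: filterS (filterI (h1 _ e2) (h2 _ e2)) => n /= [k1 k2] z Az.
rewrite (_ : f1 n z + f2 n z - (g1 z + g2 z) = (f1 n z - g1 z) + (f2 n z - g2 z)); last by ring.
by have := ler_normcD (f1 n z - g1 z) (f2 n z - g2 z); have := k1 z Az; have := k2 z Az; lra.
Qed.

Lemma ucvg_sum A (I : finType) (f : I -> nat -> C -> C) (g : I -> C -> C) :
  (forall i, ucvg A (f i) (g i)) -> ucvg A (fun n z => \sum_i f i n z) (fun z => \sum_i g i z).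
Proof.
move=> H; have : forall r : seq I, ucvg A (fun n z => \sum_(i <- r) f i n z) (fun z => \sum_(i <- r) g i z).
  elim=> [|i r IH].
    by move=> e e0; apply: filterS filterT => n _ /= z _; rewrite !big_nil subrr normc0.
  move=> e e0; apply: filterS (ucvgD (H i) IH e0) => n /= h z Az.
  by rewrite !big_cons; exact: h.
exact.
Qed.

Lemma ucvgM A (f1 f2 : nat -> C -> C) g1 g2 M : (forall z, A z -> normc (g1 z) <= M) -> (forall z, A z -> normc (g2 z) <= M) ->
  ucvg A f1 g1 -> ucvg A f2 g2 -> ucvg A (fun n z => f1 n z * f2 n z) (fun z => g1 z * g2 z).
Proof.
move=> B1 B2 h1 h2 e e0.
have M0 : 0 < `|M| + 1 by rewrite ltr_wpDl.
have e2 : 0 < e / 2 / (`|M| + 1) by rewrite !divr_gt0.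
apply: filterS (filterI (h1 _ ltr01) (filterI (h1 _ e2) (h2 _ e2))) => n /= [k0 [k1 k2]] z Az.
rewrite (_ : f1 n z * f2 n z - g1 z * g2 z = (f1 n z - g1 z) * g2 z + f1 n z * (f2 n z - g2 z)); last by ring.
have ML := ler_norm M.
have a1 : normc ((f1 n z - g1 z) * g2 z) < e / 2.
  rewrite normcM; have := k1 z Az; rewrite ltr_pdivlMr // => h; apply: le_lt_trans h.
  by rewrite ler_wpM2l ?normc_ge0 //; have := B2 z Az; lra.
have a2 : normc (f1 n z * (f2 n z - g2 z)) <= e / 2.
  rewrite normcM; have := k2 z Az; rewrite ltr_pdivlMr // => /ltW h; apply: le_trans h.
  rewrite mulrC ler_wpM2l ?normc_ge0 //.
  by have := ler_normc_sub (f1 n z) (g1 z); have := B1 z Az; have := k0 z Az; lra.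
by have := ler_normcD ((f1 n z - g1 z) * g2 z) (f1 n z * (f2 n z - g2 z)); lra.
Qed.

Lemma ucvgV A (f : nat -> C -> C) g (c : R) : 0 < c -> (forall z, A z -> c <= normc (g z)) ->
  ucvg A f g -> ucvg A (fun n z => (f n z)^-1) (fun z => (g z)^-1).
Proof.
move=> c0 gc fg e e0.
have c2 : 0 < c / 2 by rewrite divr_gt0.
have ec : 0 < e * (c * (c / 2)) by rewrite !mulr_gt0.
apply: filterS (filterI (fg _ c2) (fg _ ec)) => n /= [k1 k2] z Az.
have fn : c / 2 <= normc (f n z).
  by have := ler_normc_sub (g z) (g z - f n z); rewrite subKr (normcBC (g z)); have := gc z Az; have := k1 z Az; lra.
have f0 : f n z != 0 by rewrite -normc_gt0; lra.
have g0 : g z != 0 by rewrite -normc_gt0; have := gc z Az; lra.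
rewrite (_ : (f n z)^-1 - (g z)^-1 = - (f n z - g z) / (g z * f n z)); last by field; rewrite f0 g0.
rewrite normc_div normcN normcM ltr_pdivrMr ?mulr_gt0 ?normc_gt0 //.
apply: lt_le_trans (k2 z Az) _; rewrite ler_pM2l //.
by apply: ler_pM => //; [exact: ltW|exact: ltW|exact: gc].
Qed.

End OmegaLimit.

(** * Cauchy estimates and the theorems of Weierstrass, Hurwitz and Montel *)

Section LocalTheory.
Context {R : realType}.
Local Notation C := R[i].
Implicit Types (f g : C -> C) (z w l a : C) (r e M : R) (n k : nat).

Lemma disc_shift a w r : disc a r (a + w) = (normc w < r) :> Prop.
Proof. by rewrite /disc /= addrAC subrr add0r. Qed.

Lemma disc_sub a b r s : normc (b - a) + s <= r -> disc b s `<=` disc a r.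
Proof. by move=> h z; rewrite /disc /= => zb; have := normc_triangle z b a; lra. Qed.

Lemma disc_le a r s : s <= r -> disc a s `<=` disc a r.
Proof. by move=> sr; apply: disc_sub; rewrite subrr normc0 add0r. Qed.

Lemma holomorphic_sub (A B : set C) f : A `<=` B -> holomorphic_on B f -> holomorphic_on A f.
Proof. by move=> AB hf z /AB; exact: hf. Qed.

Lemma ccont_bounded f a : ccont f a -> exists2 d : R, 0 < d &
  forall z, disc a d z -> normc (f z) <= normc (f a) + 1.
Proof.
move=> cf; have [d d0 H] := cf _ ltr01; exists d => // z zd.
have := H _ zd; rewrite [a + _]addrC subrK => h.
by have := ler_normc_sub (f z) (f a); lra.
Qed.

(** The power series is cut at orders 1 and 2. The bound on the derivative comes from |w| = r/4,
    where the two remainders are at most 2M and M. *)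
Lemma taylor1 a f r M : 0 < r -> holomorphic_on (disc a r) f ->
  (forall z, disc a r z -> normc (f z) <= M) ->
  [/\ normc (cderiv f a) <= 12 * M / r,
   forall w, normc w <= r / 4 -> normc (f (a + w) - f a) <= 8 * M / r * normc w &
   forall w, normc w <= r / 4 ->
     normc (f (a + w) - f a - cderiv f a * w) <= 16 * M / r ^+ 2 * normc w ^+ 2].
Proof.
move=> r0 hf fM; have [c cP] := power_series r0 hf; have {}cP := cP M fM.
have M0 : 0 <= M by apply: le_trans (fM a (disc0 a r0)); exact: normc_ge0.
have c0 : c 0%N = f a.
  have := cP 1%N 0; rewrite normc0 mulr0 mul0r expr1 mulr0 addr0 big_ord1 expr0 mulr1 => h.
  apply/esym/eqP; rewrite -subr_eq0 -normc_eq0 eq_le normc_ge0 andbT h //.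
  by rewrite divr_ge0 // ltW.
have h1 w : normc w <= r / 4 -> normc (f (a + w) - f a) <= 8 * M / r * normc w.
  move=> /(cP 1%N); rewrite big_ord1 expr0 mulr1 c0 expr1 => /le_trans; apply.
  by rewrite le_eqVlt; apply/orP; left; apply/eqP; field; rewrite gt_eqF.
have h2 w : normc w <= r / 4 -> normc (f (a + w) - f a - c 1%N * w) <= 16 * M / r ^+ 2 * normc w ^+ 2.
  move=> /(cP 2%N); rewrite big_ord_recl big_ord1 expr0 mulr1 c0 /= expr1 opprD addrA => /le_trans; apply.
  by rewrite le_eqVlt; apply/orP; left; apply/eqP; field; rewrite gt_eqF.
have c1 : cderiv f a = c 1%N.
  apply: cdiff_cderiv => e e0.
  have q0 : 0 <= 16 * M / r ^+ 2 by rewrite divr_ge0 ?sqr_ge0 // mulr_ge0.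
  have q1 : 0 < 16 * M / r ^+ 2 + 1 by rewrite ltr_wpDl.
  exists (Num.min (r / 4) (e / (16 * M / r ^+ 2 + 1))); first by rewrite lt_min !divr_gt0.
  move=> h; rewrite lt_min => /andP[/ltW hr]; rewrite ltr_pdivlMr // => /ltW he.
  apply: le_trans (h2 h hr) _; rewrite expr2 mulrA ler_wpM2r ?normc_ge0 //.
  apply: le_trans he; rewrite mulrC ler_wpM2l ?normc_ge0 // lerDl //.
rewrite c1; split => //.
pose w : C := (r / 4)%:C%C.
have wn : normc w = r / 4 by rewrite normcR gtr0_norm // divr_gt0.
have := h1 w; have := h2 w; rewrite wn lexx => /(_ isT) k2 /(_ isT) k1.
have : normc (c 1%N * w) <= 12 * M / r * (r / 4).
  have := ler_normcB (f (a + w) - f a) (f (a + w) - f a - c 1%N * w); rewrite subKr.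
  have e1 : 8 * M / r * (r / 4) = 2 * M by field; rewrite gt_eqF.
  have e2 : 16 * M / r ^+ 2 * (r / 4) ^+ 2 = M by field; rewrite gt_eqF.
  have e3 : 12 * M / r * (r / 4) = 3 * M by field; rewrite gt_eqF.
  lra.
by rewrite normcM wn ler_pM2r // divr_gt0.
Qed.

(** The derivatives of [f n] at a point are bounded, hence have a limit along [omega], and the
    second order estimate of [taylor1], uniform in [n], passes to the limit: the limit of the
    derivatives is the derivative of [g]. Their uniform convergence is the Cauchy estimate applied
    to [f n - g]. *)
Lemma weierstrass a r (f : nat -> C -> C) g : 0 < r ->
  omega [set n | holomorphic_on (disc a r) (f n)] -> ucvg (disc a r) f g ->
  holomorphic_on (disc a r) g /\
  ucvg (disc a (r / 2)) (fun n => cderiv (f n)) (cderiv g).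
Proof.
move=> r0 hf fg.
have hg : holomorphic_on (disc a r) g.
  move=> z zr; pose s := r - normc (z - a).
  have s0 : 0 < s by rewrite subr_gt0.
  have zs : disc z s `<=` disc a r by apply: disc_sub; rewrite /s; lra.
  have [n0 [/= hn0 fn0]] := omega_neq0 (filterI hf (fg _ ltr01)).
  have [d d0 fb] := ccont_bounded (holomorphic_ccont hn0 zr).
  pose t := Num.min d s; have t0 : 0 < t by rewrite lt_min d0.
  have td : disc z t `<=` disc z d by apply: disc_le; rewrite ge_min lexx.
  have ts : disc z t `<=` disc a r by apply: subset_trans zs; apply: disc_le; rewrite ge_min lexx orbT.
  pose M := normc (f n0 z) + 3.
  have fM : omega [set n | forall u, disc z t u -> normc (f n u) <= M].
    apply: filterS (fg _ ltr01) => n /= fn u ut.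
    have := fb u (td u ut); have := fn u (ts u ut); have := fn0 u (ts u ut).
    rewrite (normcBC (f n0 u)) /M => k1 k2 k3.
    by have := ler_normc_sub (f n u) (g u); have := ler_normc_sub (g u) (f n0 u); lra.
  have hft : omega [set n | holomorphic_on (disc z t) (f n)].
    by apply: filterS hf => n /=; exact: holomorphic_sub.
  have [l lP] : exists l, slim (fun n => cderiv (f n) z) l.
    apply: (@omega_limit _ _ (12 * M / t)); apply: filterS (filterI hft fM) => n /= [k1 k2].
    by have [] := taylor1 t0 k1 k2.
  apply: (@cdiff_derivable _ _ _ l) => e e0.
  have M0 : 0 <= M by rewrite /M addr_ge0 ?normc_ge0.
  have q0 : 0 <= 16 * M / t ^+ 2 by rewrite divr_ge0 ?sqr_ge0 // mulr_ge0.
  have q1 : 0 < 16 * M / t ^+ 2 + 1 by rewrite ltr_wpDl.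
  exists (Num.min (t / 4) (e / (16 * M / t ^+ 2 + 1))); first by rewrite lt_min !divr_gt0.
  move=> h; rewrite lt_min => /andP[/ltW hr]; rewrite ltr_pdivlMr // => /ltW he.
  have fz : slim (fun n => f n z) (g z) by exact: ucvg_slim fg zr.
  have fzh : slim (fun n => f n (z + h)) (g (z + h)).
    by apply: ucvg_slim fg _; apply: ts; rewrite disc_shift; lra.
  have H := slimB (slimB fzh fz) (slimM lP (slim_cst h)).
  apply: (@le_trans _ _ (16 * M / t ^+ 2 * normc h ^+ 2)).
    apply: (slim_le H); apply: filterS (filterI hft fM) => n /= [k1 k2].
    by have [_ _] := taylor1 t0 k1 k2; exact.
  rewrite expr2 mulrA ler_wpM2r ?normc_ge0 //.
  apply: le_trans he; rewrite mulrC ler_wpM2l ?normc_ge0 // lerDl //.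
split => // e e0.
have e1 : 0 < e / 2 * (r / 2) / 12 by rewrite !(divr_gt0, mulr_gt0).
apply: filterS (filterI hf (fg _ e1)) => n /= [hn fn] z zr.
have zs : disc z (r / 2) `<=` disc a r by apply: disc_sub; move: zr; rewrite /disc /=; lra.
have za : disc a r z by apply: zs; apply: disc0; lra.
have dfg u : disc a r u -> cdiff (fun v => f n v - g v) u (cderiv (f n) u - cderiv g u).
  by move=> ur; apply: cdiffB; apply: derivable_cdiff; [exact: hn|exact: hg].
have hfg : holomorphic_on (disc z (r / 2)) (fun u => f n u - g u).
  by move=> u /zs ur; exact: cdiff_derivable (dfg u ur).
have r20 : 0 < r / 2 by lra.
have [+ _ _] := taylor1 r20 hfg (fun u us => ltW (fn u (zs u us))).
rewrite (cdiff_cderiv (dfg z za)) => /le_lt_trans; apply.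
rewrite (_ : 12 * _ / _ = e / 2); last by field; rewrite gt_eqF.
by lra.
Qed.

(** By [taylor1], the derivative is locally the uniform limit of the difference quotients with step
    [1 / (n+1)]. These are holomorphic, so [weierstrass] applies. *)
Lemma holomorphic_cderiv (D : set C) f : open (D : set C^o) -> holomorphic_on D f ->
  holomorphic_on D (cderiv f).
Proof.
move=> oD hf a Da.
have [r r0 rD] : exists2 r : R, 0 < r & disc a r `<=` D by apply/cnbhsP; exact: open_nbhs_nbhs.
have hfr := holomorphic_sub rD hf.
have [d d0 fb] := ccont_bounded (holomorphic_ccont hf Da).
pose s := Num.min d r / 2; have s0 : 0 < s by rewrite divr_gt0 // lt_min d0.
have [sd sr] : 2 * s <= d /\ 2 * s <= r.
  by rewrite /s mulrCA divff ?mulr1 ?ge_min ?lexx ?orbT.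
pose M := normc (f a) + 1; pose t n : R := n.+1%:R^-1.
have M0 : 0 < M by rewrite ltr_wpDl ?normc_ge0.
have t0 n : 0 < t n by rewrite invr_gt0.
have ts : omega [set n | t n < s / 4] by apply: omega_small; lra.
pose q n u := ((t n)%:C%C)^-1 * (f (u + (t n)%:C%C) - f u).
have key u n : disc a s u -> t n < s / 4 ->
    normc (q n u - cderiv f u) <= 16 * M / s ^+ 2 * t n.
  move=> us tn; have us' : disc u s `<=` disc a d by apply: disc_sub; move: us; rewrite /disc /=; lra.
  have hu : holomorphic_on (disc u s) f.
    by apply: holomorphic_sub hfr; apply: disc_sub; move: us; rewrite /disc /=; lra.
  have fM v : disc u s v -> normc (f v) <= M by move=> /us'/fb.
  have [_ _ /(_ (t n)%:C%C)] := taylor1 s0 hu fM.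
  rewrite normcR gtr0_norm // => /(_ (ltW tn)) h.
  have tC : (t n)%:C%C != 0 :> C by rewrite fmorph_eq0 gt_eqF.
  rewrite (_ : q n u - cderiv f u = ((t n)%:C%C)^-1 * (f (u + (t n)%:C%C) - f u - cderiv f u * (t n)%:C%C)).
    rewrite normcM normcV normcR gtr0_norm // mulrC ler_pdivrMr //.
    by apply: le_trans h _; rewrite [t n ^+ 2]expr2 mulrA.
  by rewrite /q; field.
have Q : ucvg (disc a s) q (cderiv f).
  move=> e e0; pose c := 16 * M / s ^+ 2.
  have c0 : 0 < c by rewrite divr_gt0 ?exprn_gt0 // mulr_gt0.
  have ec : 0 < e / c by rewrite divr_gt0.
  apply: filterS (filterI ts (omega_small ec)) => n /= [tn te] u us.
  by apply: le_lt_trans (key u n us tn) _; rewrite mulrC -ltr_pdivlMr.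
have hq : omega [set n | holomorphic_on (disc a s) (q n)].
  apply: filterS ts => n /= tn u us.
  have fu : cdiff f u (cderiv f u).
    by apply: derivable_cdiff; apply: hfr; move: us; rewrite /disc /=; lra.
  have fut : cdiff f (u + (t n)%:C%C) (cderiv f (u + (t n)%:C%C)).
    apply: derivable_cdiff; apply: hfr; rewrite /disc /= addrAC.
    apply: le_lt_trans (ler_normcD _ _) _; rewrite normcR gtr0_norm //.
    by move: us; rewrite /disc /=; lra.
  apply: cdiff_derivable; apply: cdiffZ; apply: cdiffB fu.
  exact: (cdiff_comp (cdiffD (cdiff_id u) (cdiff_cst _ u)) fut).
by have [+ _] := weierstrass s0 hq Q; apply; exact: disc0.
Qed.

(** If all Taylor coefficients vanish, the remainder estimate forces [f] to vanish near [a].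
    Otherwise [m] is the first index with a nonzero coefficient, and near [a] the remainder is at
    most half of the leading term. *)
Lemma isolated_zero a r f : 0 < r -> holomorphic_on (disc a r) f ->
  (exists2 d : R, 0 < d & forall z, disc a d z -> f z = 0) \/
  (exists m c d, [/\ 0 < c :> R, 0 < d :> R &
     forall w, normc w < d -> c * normc w ^+ m <= normc (f (a + w))]).
Proof.
move=> r0 hf.
have [d d0 fb] := ccont_bounded (holomorphic_ccont hf (disc0 a r0)).
pose s := Num.min d r; have s0 : 0 < s by rewrite lt_min d0.
have hs : holomorphic_on (disc a s) f.
  by apply: holomorphic_sub hf; apply: disc_le; rewrite ge_min lexx orbT.
pose M := normc (f a) + 1; have M0 : 0 < M by rewrite ltr_wpDl ?normc_ge0.
have fM z : disc a s z -> normc (f z) <= M.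
  by move=> zs; apply: fb; apply: disc_le zs; rewrite ge_min lexx.
have [c /(_ M fM) cP] := power_series s0 hs.
have [c0|/existsNP] := pselect (forall k, c k = 0).
  left; exists (s / 4) => [|z zs]; first by lra.
  have {zs}zs : normc (z - a) <= s / 4 by exact: ltW.
  apply/eqP; rewrite -normc_eq0 eq_le normc_ge0 andbT.
  apply: (@le0_of_all_eps _ (4 * M)) => e e0.
  have [k ke] : exists k : nat, 1 / 2 ^+ k < e.
    exists (Num.truncn e^-1).+1; rewrite ltr_pdivrMr ?exprn_gt0 // mulrC -ltr_pdivrMr //.
    by rewrite mul1r (lt_trans (truncnS_gt _)) // -natrX ltr_nat ltn_expl.
  have := cP k (z - a) zs; rewrite [a + _]addrC subrK big1 => [|i _]; last by rewrite c0 mul0r.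
  rewrite subr0 => /le_trans; apply; rewrite mulrC ler_wpM2r ?mulr_ge0 ?(ltW M0) //.
  apply: le_trans (ltW ke); rewrite (_ : 1 / 2 ^+ k = (1 / 2) ^+ k); last by rewrite expr_div_n expr1n.
  rewrite lerXn2r ?nnegrE ?divr_ge0 ?mulr_ge0 ?normc_ge0 ?(ltW s0) //.
  by rewrite ler_pdivrMr //; lra.
move=> ex; right.
have ex' : exists k, c k != 0 by case: ex => k /eqP; exists k.
case: (ex_minnP ex') => m cm mmin {ex ex'}.
have cm0 : 0 < normc (c m) by rewrite normc_gt0.
pose K := 4 * M * (2 / s) ^+ m.+1.
have K0 : 0 < K by rewrite !mulr_gt0 // exprn_gt0 // divr_gt0.
exists m, (normc (c m) / 2), (Num.min (s / 4) (normc (c m) / 2 / K)).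
split; [by rewrite divr_gt0|by rewrite lt_min !divr_gt0|].
move=> w; rewrite lt_min => /andP[/ltW ws]; rewrite ltr_pdivlMr // => /ltW wK.
have := cP m.+1 w ws; rewrite big_ord_recr /= big1 => [|i _]; last first.
  have [->|/mmin] := eqVneq (c i) 0; first by rewrite mul0r.
  by rewrite leqNgt ltn_ord.
rewrite add0r => h.
have {}h : normc (f (a + w) - c m * w ^+ m) <= normc (c m) / 2 * normc w ^+ m.
  apply: le_trans h _; have -> : 4 * M * (2 * normc w / s) ^+ m.+1 = normc w * K * normc w ^+ m.
    by rewrite /K [2 * normc w / s]mulrAC exprMn !exprS; ring.
  by rewrite ler_wpM2r // exprn_ge0 ?normc_ge0.
have := ler_normc_sub (c m * w ^+ m) (c m * w ^+ m - f (a + w)).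
rewrite subKr (normcBC (c m * w ^+ m)) normcM normcX; lra.
Qed.

Lemma square_bd_norm s z : 0 < s -> square_bd s z -> s <= normc z /\ normc z <= 2 * s.
Proof.
move=> s0 zb; split; first by apply: normc_ge_line => //; case: zb => -[_]; tauto.
apply: le_trans (normc_le_ReIm _) _.
have [h1 h2] : `|Re z| <= s /\ `|Im z| <= s.
  by rewrite !ler_norml; case: zb => -[/andP[? ?] [->|->]]; split; apply/andP; split; lra.
lra.
Qed.

(** If [f n] had no zero near [a], the maximum principle for [1 / f n] on a small square would bound
    its value at [a] by its values on the boundary. The latter stay bounded since [g] is bounded
    below there by [isolated_zero], whereas [f n a] tends to 0. *)
Lemma hurwitz a r (f : nat -> C -> C) g d : 0 < r -> 0 < d ->
  omega [set n | holomorphic_on (disc a r) (f n)] -> ucvg (disc a r) f g -> g a = 0 ->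
  ~ (exists2 d : R, 0 < d & forall z, disc a d z -> g z = 0) ->
  omega [set n | exists2 z, disc a d z & f n z = 0].
Proof.
move=> r0 d0 hf fg ga gn0.
have [hg _] := weierstrass r0 hf fg.
have [//|[m [c [t [c0 t0 gc]]]]] := isolated_zero r0 hg.
pose s := Num.min d (Num.min r t) / 4.
have s4 : 4 * s = Num.min d (Num.min r t) by rewrite /s mulrCA divff // mulr1.
have m0 : 0 < Num.min d (Num.min r t) by rewrite !lt_min d0 r0.
have s0 : 0 < s by rewrite divr_gt0.
have [sd sr st] : [/\ 4 * s <= d, 4 * s <= r & 4 * s <= t].
  by rewrite s4 !ge_min !lexx !orbT.
pose q := c * s ^+ m; have q0 : 0 < q by rewrite mulr_gt0 // exprn_gt0.
have q2 : 0 < q / 2 by rewrite divr_gt0.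
apply: filterS (filterI hf (fg _ q2)) => n /= [hn fn].
apply: contrapT => nz.
have f0 z : disc a (2 * s) z -> f n z != 0.
  by move=> zs; apply/eqP => fz; apply: nz; exists z => //; apply: disc_le zs; lra.
have hi : holomorphic_on (disc a (2 * s)) (fun z => (f n z)^-1).
  move=> z zs; have dz : cdiff (f n) z (cderiv (f n) z).
    by apply: derivable_cdiff; apply: hn; apply: disc_le zs; lra.
  exact: cdiff_derivable (cdiffV (f0 z zs) dz).
have bd z : square_bd s (z - a) -> normc ((f n z)^-1) <= 2 / q.
  move=> /(square_bd_norm s0)[zs z2].
  have gz : q <= normc (g z).
    have := gc (z - a); rewrite [a + _]addrC subrK => gz; apply: le_trans (gz _); last by lra.
    by rewrite ler_pM2l // lerXn2r ?nnegrE ?normc_ge0 // ltW.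
  have zr : disc a r z by rewrite /disc /=; lra.
  have fz : q / 2 <= normc (f n z).
    by have := ler_normc_sub (g z) (g z - f n z); rewrite subKr (normcBC (g z)); have := fn z zr; lra.
  by rewrite normcV -[2 / q]invf_div lef_pV2 ?posrE //; lra.
have := max_modulus s0 hi bd.
have fa : normc (f n a) < q / 2 by have := fn a (disc0 a r0); rewrite ga subr0.
have fa0 : 0 < normc (f n a) by rewrite normc_gt0 f0 //; apply: disc0; lra.
by rewrite normcV -[2 / q]invf_div lef_pV2 ?posrE // leNgt fa.
Qed.

(** Pointwise limits exist along [omega] without any extraction. If convergence were not uniform,
    points where it fails would have a limit [z], and the Lipschitz bound of [taylor1] near [z],
    valid for all [f n] and for [g], gives a contradiction. On the radius [r / 4] the disc of radius
    [r / 2] about [z] remains available. *)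
Lemma montel a r (f : nat -> C -> C) M : 0 < r ->
  omega [set n | holomorphic_on (disc a r) (f n) /\ forall z, disc a r z -> normc (f n z) <= M] ->
  exists g, ucvg (disc a (r / 4)) f g.
Proof.
move=> r0 hfM.
have M0 : 0 <= M.
  have [n [_ h]] := omega_neq0 hfM; apply: le_trans (h a (disc0 a r0)); exact: normc_ge0.
have lim z : exists l, disc a r z -> slim (fun n => f n z) l.
  have [zr|zr] := pselect (disc a r z); last by exists 0.
  have [|l lP] := @omega_limit _ (fun n => f n z) M; last by exists l.
  by apply: filterS hfM => n /= [_]; apply.
pose g z := projT1 (cid (lim z)).
have gP z : disc a r z -> slim (fun n => f n z) (g z) by rewrite /g; case: cid.
exists g => e e0; apply: contrapT => /omegaC H.
have bad n : exists z, (exists2 z, disc a (r / 4) z & e <= normc (f n z - g z)) ->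
    disc a (r / 4) z /\ e <= normc (f n z - g z).
  by have [[z z1 z2]|nz] := pselect (exists2 z, disc a (r / 4) z & e <= normc (f n z - g z)); [exists z|exists 0].
pose u n := projT1 (cid (bad n)).
have uP : omega [set n | disc a (r / 4) (u n) /\ e <= normc (f n (u n) - g (u n))].
  apply: filterS H => n /= /existsNP[z /not_implyP[z1 /negP]]; rewrite -leNgt => z2.
  by rewrite /u; case: cid => v /= vP; apply: vP; exists z.
have [z uz] : exists z, slim u z.
  apply: (@omega_limit _ _ (normc a + r / 4)); apply: filterS uP => n /= [+ _]; rewrite /disc /=.
  by have := ler_normc_sub (u n) a; lra.
have za : normc (z - a) <= r / 4.
  by apply: (slim_le (slimB uz (slim_cst a))); apply: filterS uP => n /= [/ltW].
have hr : 0 < r / 2 by lra.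
pose L := 8 * M / (r / 2).
have L0 : 0 <= L by rewrite divr_ge0 ?mulr_ge0 // ltW.
have zsub : disc z (r / 2) `<=` disc a r by apply: disc_sub; lra.
have lip n w : holomorphic_on (disc a r) (f n) /\ (forall z, disc a r z -> normc (f n z) <= M) ->
    normc (w - z) <= r / 8 -> normc (f n w - f n z) <= L * normc (w - z).
  move=> [h1 h2] wz; have := taylor1 hr (holomorphic_sub zsub h1) (fun v vz => h2 v (zsub v vz)).
  by case=> _ /(_ (w - z)); rewrite [z + _]addrC subrK => h _; apply: h; lra.
have glip w : normc (w - z) <= r / 8 -> normc (g w - g z) <= L * normc (w - z).
  move=> wz; have wr : disc a r w by apply: zsub; rewrite /disc /=; lra.
  have zr : disc a r z by apply: zsub; exact: disc0.
  apply: (slim_le (slimB (gP w wr) (gP z zr))); apply: filterS hfM => n /= h; exact: lip.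
have zr : disc a r z by apply: zsub; exact: disc0.
have e4 : 0 < e / 4 by lra.
have r8 : 0 < r / 8 by lra.
have eL : 0 < e / 4 / (L + 1) by rewrite !divr_gt0 // ltr_wpDl.
have [n /= [[[un1 un2] hn] [h1 [h2 h3]]]] := omega_neq0 (filterI (filterI uP hfM)
  (filterI (gP z zr _ e4) (filterI (uz _ r8) (uz _ eL)))).
rewrite ltr_pdivlMr ?ltr_wpDl // in h3.
have k1 := lip n (u n) hn (ltW h2); have k2 := glip (u n) (ltW h2).
have k3 := normc_triangle (f n (u n)) (f n z) (g (u n)).
have k4 := normc_triangle (f n z) (g z) (g (u n)).
rewrite (normcBC (g z)) in k4; have k5 := normc_ge0 (u n - z).
have k6 : L * normc (u n - z) <= e / 4 by apply: le_trans (ltW h3); rewrite mulrC ler_wpM2l // lerDl.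
simpl in h1, un2; lra.
Qed.

Lemma constant_of_cderiv0 a r f : (forall z, disc a r z -> cdiff f z 0) ->
  forall z, disc a r z -> f z = f a.
Proof.
move=> df z za; apply/eqP; rewrite -subr_eq0 -normc_eq0 eq_le normc_ge0 andbT.
have := @mean_value_inequality R (fun t => f (a + (z - a) * t%:C%C)) (fun=> 0) 0 1 0 ler01.
rewrite mul0r mulr1 mulr0 addr0 [a + _]addrC subrK; apply=> [t /andP[t0 t1]|t _]; last by rewrite normc0.
rewrite -(mul0r (z - a)); apply: rdiff_line; apply: df.
rewrite disc_shift normcM normcR ger0_norm //; apply: le_lt_trans za.
by rewrite -[leRHS]mulr1 ler_wpM2l ?normc_ge0.
Qed.

(** The plane is connected: the property is carried along the segment from [a] to [z] by
    [real_induction]. *)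
Lemma plane_induction (E : C -> Prop) a : E a ->
  (forall z, E z -> exists2 d : R, 0 < d & forall w, disc z d w -> E w) ->
  (forall z, (forall d : R, 0 < d -> exists2 w, disc z d w & E w) -> E z) ->
  forall z, E z.
Proof.
move=> Ea Eo Ec z; pose p (t : R) := a + (z - a) * t%:C%C.
have pc t e : 0 < e -> exists2 d : R, 0 < d & forall s, `|s - t| < d -> disc (p t) e (p s).
  move=> e0; have z0 : 0 < normc (z - a) + 1 by rewrite ltr_wpDl ?normc_ge0.
  exists (e / (normc (z - a) + 1)) => [|s]; first by rewrite divr_gt0.
  rewrite ltr_pdivlMr // => h; rewrite /disc /p /=.
  rewrite (_ : _ - _ = (z - a) * (s - t)%:C%C); last by rewrite rmorphB /=; ring.
  by rewrite normcM normcR mulrC; apply: le_lt_trans h; rewrite ler_wpM2l // lerDl.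
have -> : z = p 1 by rewrite /p mulr1 addrC subrK.
apply: (@real_induction _ 0 1 (fun t => E (p t))) => //.
- by rewrite /p mulr0 addr0.
- move=> t /andP[t0 t1] H; apply: Ec => e e0; have [d d0 dP] := pc t e e0.
  pose s := Num.max 0 (t - d / 2).
  have st : s < t by rewrite gt_max t0 gtrBl divr_gt0.
  have s0 : 0 <= s by rewrite le_max lexx.
  exists (p s); last by apply: H; rewrite s0.
  have sd : t - d / 2 <= s by rewrite le_max lexx orbT.
  by apply: dP; rewrite ltr_norml; apply/andP; split; lra.
move=> t /andP[t0 t1] H; have [e e0 eP] := Eo (p t) (H t (ltac:(by rewrite t0 lexx))).
have [d d0 dP] := pc t e e0; exists d => // s /andP[s1 s2]; apply: eP; apply: dP.
by rewrite ltr_norml; apply/andP; split; lra.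
Qed.

End LocalTheory.

(** * The complex exponential, primitives and logarithms of entire functions *)

Section Exponential.
Context {R : realType}.
Local Notation C := R[i].
Implicit Types (f g h p q : C -> C) (z w l : C) (x y e : R).

Definition cexp z : C := (expR (Re z))%:C%C * (cos (Im z) +i* sin (Im z))%C.

Lemma cexp0 : cexp 0 = 1.
Proof. by rewrite /cexp /= expR0 cos0 sin0 mul1r. Qed.

Lemma cexpD z w : cexp (z + w) = cexp z * cexp w.
Proof.
rewrite /cexp !raddfD /= expRD rmorphM /= cosD sinD mulrACA; congr (_ * _).
by simpc; congr (_ +i* _)%C; ring.
Qed.

Lemma normc_cexp z : normc (cexp z) = expR (Re z).
Proof.
rewrite normcM normcR ger0_norm ?expR_ge0 // -[RHS]mulr1; congr (_ * _).
by rewrite /normc cos2Dsin2 sqrtr1.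
Qed.

Lemma cexp_neq0 z : cexp z != 0.
Proof. by rewrite -normc_gt0 normc_cexp expR_gt0. Qed.

Lemma cdiff_cexp z : cdiff cexp z (cexp z).
Proof.
have at0 : cdiff cexp 0 1.
  move=> e e0; have e8 : 0 < e / 8 by lra.
  have [d1 d10 H1] := is_derive_eps (is_derive_expR (0 : R)) e8.
  have [d2 d20 H2] := is_derive_eps (is_derive_cos (0 : R)) e8.
  have [d3 d30 H3] := is_derive_eps (is_derive_sin (0 : R)) e8.
  have [d4 d40 H4] := is_derive_eps (is_derive_expR (0 : R)) ltr01.
  exists (Num.min (Num.min d1 d2) (Num.min (Num.min d3 d4) (Num.min (e / 8) (1 / 2)))).
    by rewrite !lt_min d10 d20 d30 d40; lra.
  move=> h; rewrite !lt_min => /andP[/andP[h1 h2] /andP[/andP[h3 h4] /andP[h5 h6]]].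
  have hR := normc_Re h; have hI := normc_Im h.
  have {H1} := H1 _ (le_lt_trans hR h1); have {H2} := H2 _ (le_lt_trans hI h2).
  have {H3} := H3 _ (le_lt_trans hI h3); have {H4} := H4 _ (le_lt_trans hR h4).
  rewrite !add0r expR0 cos0 sin0 oppr0 mul0r !subr0 !mul1r addr0 => k4 k3 k2 k1.
  rewrite cexp0; apply: le_trans (normc_le_ReIm _) _.
  have := normc_ge0 h; case: h h1 h2 h3 h4 h5 h6 hR hI k1 k2 k3 k4 => x y.
  rewrite /cexp; set N := normc _ => /= h1 h2 h3 h4 h5 h6 hR hI k1 k2 k3 k4 N0.
  rewrite ?(mul0r, subr0, addr0, oppr0, add0r).
  set E := expR x in k1 k4 *.
  have E1 : `|E - 1| <= 2 * N.
    by have := ler_normD (E - 1 - x) x; rewrite subrK; lra.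
  have E2 : `|E| <= 2 by have := ler_normD (E - 1) 1; rewrite subrK normr1; lra.
  have A1 : `|E * cos y - 1 - x| <= 3 / 8 * e * N.
    rewrite (_ : E * cos y - 1 - x = E * (cos y - 1) + (E - 1 - x)); last by ring.
    apply: le_trans (ler_normD _ _) _; rewrite normrM.
    have := ler_pM (normr_ge0 _) (normr_ge0 _) E2 k2.
    have := ler_wpM2l (ltW e8) hI; have := ler_wpM2l (ltW e8) hR; lra.
  have A2 : `|E * sin y - y| <= 4 / 8 * e * N.
    rewrite (_ : E * sin y - y = E * (sin y - y) + (E - 1) * y); last by ring.
    apply: le_trans (ler_normD _ _) _; rewrite !normrM.
    have := ler_pM (normr_ge0 _) (normr_ge0 _) E2 k3.
    have := ler_pM (normr_ge0 _) (normr_ge0 _) E1 hI.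
have := ler_wpM2l (ltW e8) hI; have := ler_wpM2l N0 (ltW h5); lra.
  have : 0 <= e * N by rewrite mulr_ge0 // ltW.
  lra.
have : cdiff (fun w => cexp z * (cexp \o (fun u => u - z)) w) z (cexp z * (1 * 1)).
  apply: cdiffZ; apply: (cdiff_comp (cdiff_subC z z)).
  by rewrite subrr.
rewrite !mulr1 => /cdiff_near; apply; exists 1 => // w _ /=.
by rewrite -cexpD addrC subrK.
Qed.

Lemma cint_swap (g : R -> C) (a b : R) : cint g b a = - cint g a b.
Proof. by rewrite /cint opprB. Qed.

Lemma cint_dist (g : R -> C) l (a b : R) e : (forall t, rcont g t) ->
  (forall t, `|t - a| <= `|b - a| -> normc (g t - l) <= e) ->
  normc (cint g a b - l * (b - a)%:C%C) <= e * `|b - a|.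
Proof.
move=> cg gl.
have key (u v : R) : u <= v -> (forall t, u <= t <= v -> normc (g t - l) <= e) ->
    normc (cint g u v - l * (v - u)%:C%C) <= e * (v - u).
  move=> uv h.
  have cc t : rcont (fun=> - l) t by move=> d d0; exists 1 => // k _; rewrite subrr normc0 ltW.
  have <- : cint (fun=> - l) u v = - (l * (v - u)%:C%C).
    rewrite (@cint_eq _ (fun t => - l * t%:C%C)) //; first by rewrite rmorphB /=; ring.
    move=> t _; have -> : (fun t0 : R => - l * t0%:C%C) = (fun t0 => (fun z => - l * z) (0 + 1 * t0%:C%C)).
      by apply/funext => s; rewrite add0r mul1r.
    rewrite -[X in rdiff _ _ X](mulr1 (- l)); apply: rdiff_line.
    by rewrite -[X in cdiff _ _ X](mulr1 (- l)); apply: cdiffZ; exact: cdiff_id.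
  by rewrite -cintD //; apply: cint_le => // t; exact: rcontD.
have [ab|ab] := leP a b.
  rewrite ger0_norm ?subr_ge0 //; apply: key => // t /andP[t1 t2]; apply: gl.
  by rewrite !ger0_norm ?subr_ge0 ?lerB.
rewrite ltr0_norm ?subr_lt0 // opprB.
rewrite (_ : _ - _ = - (cint g b a - l * (a - b)%:C%C)); last first.
  by rewrite cint_swap !rmorphB /=; ring.
rewrite normcN; apply: key => [|t /andP[t1 t2]]; first exact: ltW.
apply: gl; rewrite (distrC t) (distrC b) !ger0_norm ?subr_ge0 ?(ltW ab) //; lra.
Qed.

(** The primitive integrates horizontally from 0, then vertically. Its increment at [z] differs by a
    closed rectangle from two short integrals near [z], and the closed rectangle contributes 0
    whatever the order of its endpoints. *)
Lemma entire_primitive q : holomorphic_on setT q -> exists p, forall z, cdiff p z (q z).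
Proof.
move=> hq; have dq z : cdiff q z (cderiv q z) by apply: derivable_cdiff; exact: hq.
have cq z : ccont q z by exact: cdiff_ccont (dq z).
have r0 x0 x1 y0 y1 : rect_int q x0 x1 y0 y1 = 0.
  have r1 u0 u1 v0 v1 : u0 <= u1 -> v0 <= v1 -> rect_int q u0 u1 v0 v1 = 0.
    by move=> *; apply: goursat_rect => // z _ _; exists (cderiv q z).
  have sx u0 u1 v0 v1 : rect_int q u0 u1 v0 v1 = - rect_int q u1 u0 v0 v1.
    by rewrite /rect_int /hint /vint /cint; ring.
  have sy u0 u1 v0 v1 : rect_int q u0 u1 v0 v1 = - rect_int q u0 u1 v1 v0.
    by rewrite /rect_int /hint /vint /cint; ring.
  have [x01|/ltW x01] := leP x0 x1; have [y01|/ltW y01] := leP y0 y1.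
  - exact: r1.
  - by rewrite sy r1 ?oppr0.
  - by rewrite sx r1 ?oppr0.
  - by rewrite sx sy r1 ?oppr0.
exists (fun z => hint q 0 0 (Re z) + vint q (Re z) 0 (Im z)) => z e e0.
have e2 : 0 < e / 2 by lra.
have [d d0 dP] := cq z _ e2; exists d => // h hd.
have := r0 (Re z) (Re (z + h)) 0 (Im z).
have E : Re (z + h) = Re z + Re h /\ Im (z + h) = Im z + Im h by rewrite !raddfD.
case: E => -> ->; set x := Re z; set y := Im z; set u := Re h; set v := Im h.
move=> r.
have zE : z = (x +i* y)%C by rewrite /x /y; case: (z).
have hE : h = u%:C%C + 'i%C * v%:C%C by rewrite /u /v; case: (h) => ? ?; simpc.
have -> : hint q 0 0 (x + u) + vint q (x + u) 0 (y + v) - (hint q 0 0 x + vint q x 0 y) - q z * h =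
    (hint q y x (x + u) - q z * (x + u - x)%:C%C)
    + 'i%C * (cint (fun t => q ((x + u) +i* t)%C) y (y + v) - q z * (y + v - y)%:C%C) + rect_int q x (x + u) 0 y.
  rewrite (_ : x + u - x = u); last by ring.
  rewrite (_ : y + v - y = v); last by ring.
  rewrite {1}hE /rect_int /hint /vint /cint; ring.
rewrite r addr0.
have B1 : normc (hint q y x (x + u) - q z * (x + u - x)%:C%C) <= e / 2 * `|x + u - x|.
  apply: cint_dist => [t|t]; first by apply: rcont_hline; exact: cq.
  rewrite (_ : x + u - x = u); last by ring.
  move=> tu; have := dP ((t - x)%:C%C); rewrite normcR => /(_ (le_lt_trans (le_trans tu (normc_Re h)) hd)).
  by congr (normc (q _ - _) <= _); rewrite zE; simpc; congr (_ +i* _)%C; ring.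
have B2 : normc (cint (fun t => q ((x + u) +i* t)%C) y (y + v) - q z * (y + v - y)%:C%C) <= e / 2 * `|y + v - y|.
  apply: cint_dist => [t|t]; first by apply: rcont_vline; exact: cq.
  rewrite (_ : y + v - y = v); last by ring.
  move=> tv; have : normc (u +i* (t - y))%C <= normc h.
    rewrite -(@ler_pXn2r _ 2%N) ?nnegrE ?normc_ge0 // !sqr_normcE /= lerD2l.
    by rewrite -(real_normK (num_real (t - y))) -(real_normK (num_real (Im h))) lerXn2r ?nnegrE.
  move=> /le_lt_trans/(_ hd)/dP.
  by congr (normc (q _ - _) <= _); rewrite zE; simpc; congr (_ +i* _)%C; ring.
apply: le_trans (ler_normcD _ _) _; rewrite normcM normci mul1r.
have uh := normc_Re h; have vh := normc_Im h.
rewrite (_ : x + u - x = u) in B1 *; last by ring.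
rewrite (_ : y + v - y = v) in B2 *; last by ring.
have := ler_wpM2l (ltW e2) uh; have := ler_wpM2l (ltW e2) vh.
rewrite -/u -/v; lra.
Qed.

Lemma holomorphicT f : (forall z, exists l, cdiff f z l) -> holomorphic_on setT f.
Proof. by move=> H z _; have [l] := H z; exact: cdiff_derivable. Qed.

(** With [p] a primitive of h'/h, the quotient of [h] by [cexp (p - p 0)] has derivative 0. *)
Lemma entire_log h : holomorphic_on setT h -> (forall z, h z != 0) ->
  exists p c, [/\ holomorphic_on setT p, p 0 = 0, c != 0 & forall z, h z = c * cexp (p z)].
Proof.
move=> hh h0; have dh z : cdiff h z (cderiv h z) by apply: derivable_cdiff; exact: hh.
have hdh : holomorphic_on setT (cderiv h) by apply: holomorphic_cderiv => //; exact: openT.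
have ddh z : cdiff (cderiv h) z (cderiv (cderiv h) z) by apply: derivable_cdiff; exact: hdh.
have [p pP] : exists p, forall z, cdiff p z (cderiv h z * (h z)^-1).
  apply: entire_primitive; apply: holomorphicT => z.
  by eexists; apply: cdiffM; [exact: ddh|apply: cdiffV; [exact: h0|exact: dh]].
have dE z : cdiff (fun w => h w * (cexp (p w - p 0))^-1) z 0.
  have d1 : cdiff (fun w => p w - p 0) z (cderiv h z * (h z)^-1 - 0) by apply: cdiffB => //; exact: cdiff_cst.
  have d2 : cdiff (fun w => cexp (p w - p 0)) z (cexp (p z - p 0) * (cderiv h z * (h z)^-1 - 0)).
    exact: cdiff_comp d1 (cdiff_cexp _).
  have := cdiffM (dh z) (@cdiffV _ (fun w => cexp (p w - p 0)) z _ (cexp_neq0 _) d2).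
  have hz := h0 z; have ez := cexp_neq0 (p z - p 0).
  by congr cdiff; rewrite /= subr0; field; rewrite hz ez.
exists (fun z => p z - p 0), (h 0); split.
- by apply: holomorphicT => z; eexists; apply: cdiffB (pP z) (cdiff_cst _ _).
- by rewrite subrr.
- exact: h0.
move=> z.
have := @constant_of_cderiv0 _ 0 (normc z + 1) _ (fun w _ => dE w) z.
rewrite /disc /= subr0 => /(_ (ltac:(by rewrite ltrDl))).
rewrite subrr cexp0 invr1 mulr1 => <-.
by rewrite divfK // cexp_neq0.
Qed.

End Exponential.

Local Opaque cderiv.

(** * Marty's criterion *)

Section Marty.
Context {R : realType} {N : nat}.
Local Notation C := R[i].
Local Notation vec := 'rV[C]_N.+1.
Implicit Types (f g : C -> C) (F : C -> vec) (z w a : C) (r e M : R) (i k : 'I_N.+1).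

Definition coord F k : C -> C := fun z => F z 0 k.

(* A spherical derivative of [F_0 : .. : F_N], up to a factor depending on N. *)
Definition sph F z : R := (\sum_k \sum_l normc (wronskian (coord F k) (coord F l) z)) /
  (\sum_k normc (F z 0 k) ^+ 2).

Lemma finite_radius (I : finType) (Q : I -> R -> Prop) :
  (forall (i : I) (d d' : R), d' <= d -> Q i d -> Q i d') -> (forall i : I, exists2 d : R, 0 < d & Q i d) ->
  exists2 d : R, 0 < d & forall i : I, Q i d.
Proof.
move=> Qle Qex; suff H (s : seq I) : exists2 d : R, 0 < d & forall i : I, i \in s -> Q i d.
  by have [d d0 dP] := H (enum I); exists d => // i; apply: dP; rewrite mem_enum.
elim: s => [|i s [d d0 dP]]; first by exists 1.
have [d' d'0 d'P] := Qex i; exists (Num.min d d') => [|j]; first by rewrite lt_min d0.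
rewrite in_cons => /predU1P[->|/dP]; last by apply: Qle; rewrite ge_min lexx.
by apply: Qle d'P; rewrite ge_min lexx orbT.
Qed.

Lemma row_neq0_max (v : vec) : v != 0 ->
  exists2 i, v 0 i != 0 & forall k, normc (v 0 k) <= normc (v 0 i).
Proof.
move=> v0; pose i := [arg max_(i > ord0) normc (v 0 i)]%O.
have imax k : normc (v 0 k) <= normc (v 0 i) by rewrite /i; case: arg_maxP => // j _; apply.
exists i => //; apply: contraNneq v0 => vi0; apply/eqP/rowP => k; rewrite mxE.
by apply: eq0_normc; apply/eqP; rewrite eq_le normc_ge0 andbT -(@normc0 R) -vi0.
Qed.

Lemma ler_sum_one (I : finType) (u : I -> R) (i : I) : (forall j, 0 <= u j) -> u i <= \sum_j u j.
Proof. by move=> u0; rewrite (bigD1 i) //= lerDl sumr_ge0. Qed.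

Lemma sum_sqr_ge F z i : normc (F z 0 i) ^+ 2 <= \sum_k normc (F z 0 k) ^+ 2.
Proof. by apply: (ler_sum_one (u := fun k => normc (F z 0 k) ^+ 2)) => k; rewrite exprn_ge0 // normc_ge0. Qed.

Lemma sum_sqr_gt0 F z : F z != 0 -> 0 < \sum_k normc (F z 0 k) ^+ 2.
Proof.
move=> /row_neq0_max[i i0 _]; apply: lt_le_trans (sum_sqr_ge F z i).
by rewrite exprn_gt0 // normc_gt0.
Qed.

Lemma sph_ge0 F z : 0 <= sph F z.
Proof.
rewrite divr_ge0 ?sumr_ge0 // => [k _|k _]; last by rewrite exprn_ge0 // normc_ge0.
by rewrite sumr_ge0 // => l _; exact: normc_ge0.
Qed.

Lemma wronskian_le_sph F z i k : F z != 0 ->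
  normc (wronskian (coord F i) (coord F k) z) <= sph F z * \sum_k normc (F z 0 k) ^+ 2.
Proof.
move=> F0; rewrite divfK ?gt_eqF ?sum_sqr_gt0 //.
apply: le_trans (ler_sum_one i _) => [|k']; last by apply: sumr_ge0 => l _; exact: normc_ge0.
by apply: (ler_sum_one k) => l; exact: normc_ge0.
Qed.

Lemma cdiff_ratio f g z : g z != 0 -> cdiff f z (cderiv f z) -> cdiff g z (cderiv g z) ->
  cdiff (fun w => f w / g w) z (wronskian g f z / g z ^+ 2).
Proof.
move=> g0 df dg; have := cdiffM df (cdiffV g0 dg).
congr cdiff; rewrite /wronskian.
by move: (f z) (g z) (cderiv f z) (cderiv g z) g0 => u v du dv v0; field.
Qed.

(** A coordinate that is largest at [a] stays comparable to the largest at a distance controlled by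
    [M] alone. While |F_k| is at most 2 |F_i|, the derivative W(F_i, F_k)/F_i^2 of the ratio is at
    most [4 (N+1) M], and real induction along the segment keeps the ratio below [1 + c t], hence
    below 2. *)
Lemma dominating_coord F a r M i : 0 < M -> (forall k, holomorphic_on (disc a r) (coord F k)) ->
  (forall z, disc a r z -> F z != 0 /\ sph F z <= M) ->
  (forall k, normc (F a 0 k) <= normc (F a 0 i)) ->
  forall z, disc a r z -> normc (z - a) < (5 * N.+1%:R * M)^-1 ->
  forall k, normc (F z 0 k) <= 2 * normc (F z 0 i).
Proof.
(* Four of the five multiples of [(N+1) M] bound the derivative of the ratio, the fifth is the slack
   consumed by the real induction. *)
move=> M0 hF FM ai z zr; pose K := 5 * N.+1%:R * M; rewrite -/K => zK.
have K0 : 0 < K by rewrite !mulr_gt0 // ltr0Sn.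
pose h := z - a; pose p (t : R) : C := a + h * t%:C%C.
pose c := K * normc h; have c0 : 0 <= c by rewrite mulr_ge0 ?normc_ge0 // ltW.
have c1 : c <= 1 by rewrite /c mulrC -ler_pdivlMr // div1r ltW.
have pr t : 0 <= t <= 1 -> disc a r (p t).
  move=> /andP[t0 t1]; rewrite disc_shift normcM normcR ger0_norm //; apply: le_lt_trans zr.
  by rewrite -[leRHS]mulr1 ler_wpM2l ?normc_ge0.
have pc t e : 0 < e -> exists2 d : R, 0 < d & forall s, `|s - t| < d -> normc (p s - p t) < e.
  move=> e0; have z0 : 0 < normc h + 1 by rewrite ltr_wpDl ?normc_ge0.
  exists (e / (normc h + 1)) => [|s]; first by rewrite divr_gt0.
  rewrite ltr_pdivlMr // => H; rewrite (_ : _ - _ = h * (s - t)%:C%C); last by rewrite /p rmorphB /=; ring.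
  by rewrite normcM normcR mulrC; apply: le_lt_trans H; rewrite ler_wpM2l // lerDl.
pose P t := forall k, normc (F (p t) 0 k) <= (1 + c * t) * normc (F (p t) 0 i).
suff P1 : P 1.
  have p1 : p 1 = z by rewrite /p mulr1 /h addrC subrK.
  move=> k; have := P1 k; rewrite p1 mulr1 => /le_trans; apply.
  by rewrite ler_wpM2r ?normc_ge0 //; lra.
apply: (@real_induction _ 0 1 P) => //.
- by move=> k; rewrite /p mulr0 addr0 mulr0 addr0 mul1r.
- move=> t /andP[t0 t1] Ps k; apply: le_of_all_eps => e e0.
  have e3 : 0 < e / 3 by lra.
  have tr : disc a r (p t) by apply: pr; rewrite ltW.
  have [d1 d10 H1] := holomorphic_ccont (hF k) tr e3.
  have [d2 d20 H2] := holomorphic_ccont (hF i) tr e3.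
  have [d d0 dP] := pc t (Num.min d1 d2) (ltac:(by rewrite lt_min d10)).
  pose s := Num.max 0 (t - d / 2).
  have st : s < t by rewrite gt_max t0 gtrBl divr_gt0.
  have s0 : 0 <= s by rewrite le_max lexx.
  have sd : t - d / 2 <= s by rewrite le_max lexx orbT.
  have := dP s (ltac:(by rewrite ltr_norml; apply/andP; split; lra)).
  rewrite lt_min => /andP[/H1 + /H2]; rewrite /coord [p t + _]addrC subrK => k1 k2.
  have k3 := Ps s (ltac:(by rewrite s0)) k.
  have k4 := ler_normc_sub (F (p t) 0 k) (F (p s) 0 k); rewrite normcBC in k4.
  have k5 := ler_normc_sub (F (p s) 0 i) (F (p t) 0 i).
  have k6 : (1 + c * s) * normc (F (p s) 0 i) <= (1 + c * t) * (normc (F (p t) 0 i) + e / 3).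
    have cs0 : 0 <= c * s by rewrite mulr_ge0.
    have cst : c * s <= c * t by rewrite ler_wpM2l // ltW.
    by apply: ler_pM; rewrite ?normc_ge0 //; lra.
  have k7 : c * t * (e / 3) <= 1 * (e / 3).
    rewrite ler_wpM2r ?(ltW e3) //; apply: le_trans c1.
    by rewrite -[leRHS]mulr1 ler_wpM2l.
  lra.
move=> t /andP[t0 t1] Ps.
have tr : disc a r (p t) by apply: pr; rewrite t0 ltW.
have Pt : P t by apply: Ps; rewrite t0 lexx.
have [F0 FM'] := FM _ tr.
have Fi0 : F (p t) 0 i != 0.
  have [k k0 _] := row_neq0_max F0; apply: contraNneq k0 => i0.
  by have := Pt k; rewrite i0 normc0 mulr0 -normc_eq0 eq_le normc_ge0 => ->.
have ct : c * t <= 1 by apply: le_trans c1; rewrite -[leRHS]mulr1 ler_wpM2l // ltW.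
have Si : 0 < normc (F (p t) 0 i) by rewrite normc_gt0.
have dF k : cdiff (coord F k) (p t) (cderiv (coord F k) (p t)) by apply: derivable_cdiff; exact: hF.
have dphi k := cdiff_ratio (f := coord F k) (g := coord F i) Fi0 (dF k) (dF i).
have Wb k : normc (wronskian (coord F i) (coord F k) (p t) / F (p t) 0 i ^+ 2) <= 4 * N.+1%:R * M.
  rewrite normc_div normcX ler_pdivrMr ?exprn_gt0 //.
  apply: le_trans (wronskian_le_sph i k F0) _.
  have S4 : \sum_k normc (F (p t) 0 k) ^+ 2 <= 4 * N.+1%:R * normc (F (p t) 0 i) ^+ 2.
    apply: (@le_trans _ _ (\sum_(k < N.+1) 4 * normc (F (p t) 0 i) ^+ 2)).
      apply: ler_sum => l _; rewrite (_ : 4 * _ = (2 * normc (F (p t) 0 i)) ^+ 2); last by ring.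
      rewrite lerXn2r ?nnegrE ?mulr_ge0 ?normc_ge0 //; apply: le_trans (Pt l) _.
      by rewrite ler_wpM2r ?normc_ge0 //; lra.
    by rewrite sumr_const card_ord -mulr_natl; rewrite le_eqVlt; apply/orP; left; apply/eqP; ring.
  apply: le_trans (ler_pM (sph_ge0 _ _) (ltW (sum_sqr_gt0 F0)) FM' S4) _.
  by rewrite le_eqVlt; apply/orP; left; apply/eqP; ring.
have NM : 0 < N.+1%:R * M by rewrite mulr_gt0 // ltr0Sn.
have [d d0 dP] : exists2 d : R, 0 < d & forall k, forall w, normc w < d ->
    normc (F (p t + w) 0 k / F (p t + w) 0 i - F (p t) 0 k / F (p t) 0 i) <= K * normc w.
  apply: finite_radius => [k d d' dd H w wd|k]; first by apply: H; lra.
  have [d d0 H] := dphi k _ NM; exists d => // w /H.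
  pose D := wronskian (coord F i) (coord F k) (p t) / F (p t) 0 i ^+ 2.
  pose q := F (p t + w) 0 k / F (p t + w) 0 i - F (p t) 0 k / F (p t) 0 i.
  rewrite -[X in normc X <= _ -> _]/(q - D * w) -/q => h1.
  have := ler_normcD (q - D * w) (D * w); rewrite subrK => h2; apply: le_trans h2 _.
  have := ler_wpM2r (normc_ge0 w) (Wb k); rewrite -normcM => h3.
  apply: le_trans (lerD h1 h3) _; rewrite -mulrDl ler_wpM2r ?normc_ge0 //.
  by rewrite /K; lra.
have Si2 : 0 < normc (F (p t) 0 i) / 2 by rewrite divr_gt0.
have [d2 d20 d2P] := holomorphic_ccont (hF i) tr Si2.
have dd2 : 0 < Num.min d d2 by rewrite lt_min d0.
have [d3 d30 d3P] := pc t _ dd2.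
exists (Num.min d3 (1 - t)) => [|s]; first by rewrite lt_min d30 subr_gt0.
rewrite -ltrBlDl => /andP[ts]; rewrite lt_min => /andP[s3 s1] k.
have st0 : 0 < s - t by rewrite subr_gt0.
have := d3P s; rewrite gtr0_norm // => /(_ s3); rewrite lt_min => /andP[pd /d2P].
rewrite /coord [p t + _]addrC subrK => Fs.
have Fsi : 0 < normc (F (p s) 0 i).
  by have := ler_normc_sub (F (p t) 0 i) (F (p s) 0 i); rewrite (normcBC (F (p t) 0 i)); lra.
have := dP k _ pd; rewrite [p t + _]addrC subrK.
rewrite (_ : p s - p t = h * (s - t)%:C%C); last by rewrite /p rmorphB /=; ring.
rewrite normcM normcR gtr0_norm // mulrA -/c => H.
have Q : normc (F (p t) 0 k / F (p t) 0 i) <= 1 + c * t.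
  by rewrite normc_div ler_pdivrMr.
have := ler_normc_sub (F (p s) 0 k / F (p s) 0 i) (F (p t) 0 k / F (p t) 0 i).
rewrite normc_div => H2.
have : normc (F (p s) 0 k) / normc (F (p s) 0 i) <= 1 + c * s by lra.
by rewrite ler_pdivrMr.
Qed.

(** Near each point one coordinate [i] dominates for a set of indices [n] in [omega], so the ratios
    F_k/F_i are holomorphic and bounded by 2, and Montel's theorem applies. Only ratios of
    coordinates of [G] have a meaning: the vector itself may jump from point to point. *)
Lemma marty (U : set C) (F : nat -> C -> vec) : open (U : set C^o) ->
  (forall a, U a -> exists r M, [/\ 0 < r, 0 < M & omega [set n |
     (forall k, holomorphic_on (disc a r) (coord (F n) k)) /\
     (forall z, disc a r z -> F n z != 0 /\ sph (F n) z <= M)]]) ->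
  exists G : C -> vec, forall a, U a -> exists r i, [/\ 0 < r, disc a r `<=` U,
     forall z, disc a r z -> G z 0 i != 0,
     omega [set n | (forall k, holomorphic_on (disc a r) (coord (F n) k)) /\
        forall z, disc a r z -> F n z 0 i != 0 /\ forall k, normc (F n z 0 k) <= 2 * normc (F n z 0 i)] &
     forall k, holomorphic_on (disc a r) (fun z => G z 0 k / G z 0 i) /\
        ucvg (disc a r) (fun n z => F n z 0 k / F n z 0 i) (fun z => G z 0 k / G z 0 i)].
Proof.
move=> oU hF.
pose good a (r : R) (i : 'I_N.+1) (psi : C -> vec) := [/\ 0 < r, disc a r `<=` U,
     omega [set n | (forall k, holomorphic_on (disc a r) (coord (F n) k)) /\
        forall z, disc a r z -> F n z 0 i != 0 /\ forall k, normc (F n z 0 k) <= 2 * normc (F n z 0 i)] &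
     forall k, ucvg (disc a r) (fun n z => F n z 0 k / F n z 0 i) (fun z => psi z 0 k)].
have loc a : exists p : R * 'I_N.+1 * (C -> vec), U a -> good a p.1.1 p.1.2 p.2.
  have [Ua|nU] := pselect (U a); last by exists (0, ord0, fun=> 0).
  have [r [M [r0 M0 H]]] := hF a Ua.
  have [d d0 dU] : exists2 d : R, 0 < d & disc a d `<=` U by apply/cnbhsP; exact: open_nbhs_nbhs.
  pose K := 5 * N.+1%:R * M; have K0 : 0 < K by rewrite !mulr_gt0 // ltr0Sn.
  have ex n : exists i, F n a != 0 -> forall k, normc (F n a 0 k) <= normc (F n a 0 i).
    have [/row_neq0_max[i _ iP]|F0] := boolP (F n a != 0); first by exists i.
    by exists ord0.
  have [i iP] := omega_finite (fun n => projT1 (cid (ex n))).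
  pose s := Num.min (Num.min r d) K^-1.
  have s0 : 0 < s by rewrite !lt_min r0 d0 invr_gt0.
  have [sr sd sK] : [/\ s <= r, s <= d & s <= K^-1] by rewrite !ge_min !lexx !orbT.
  have dom : omega [set n | (forall k, holomorphic_on (disc a s) (coord (F n) k)) /\
        forall z, disc a s z -> F n z 0 i != 0 /\ forall k, normc (F n z 0 k) <= 2 * normc (F n z 0 i)].
    apply: filterS (filterI H iP) => n /= [[h1 h2]]; case: cid => /= j jP ji.
    rewrite {j}ji in jP; have {}jP := jP (h2 a (disc0 a r0)).1.
    split=> [k|z zs]; first by apply: holomorphic_sub (h1 k); exact: disc_le.
    have zr : disc a r z by exact: disc_le zs.
    have D := dominating_coord M0 h1 h2 jP zr (lt_le_trans zs sK); split => //.
    have [k k0 _] := row_neq0_max (h2 z zr).1; apply: contraNneq k0 => i0.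
    by have := D k; rewrite i0 normc0 mulr0 -normc_eq0 eq_le normc_ge0 => ->.
  have mon k : exists g, ucvg (disc a (s / 4)) (fun n z => F n z 0 k / F n z 0 i) g.
    apply: (@montel _ a s _ 2) => //; apply: filterS dom => n /= [h1 h2]; split.
      move=> z zs; have [Fi _] := h2 z zs.
      apply: cdiff_derivable; apply: (cdiff_ratio (f := coord (F n) k) (g := coord (F n) i)) => //;
        by apply: derivable_cdiff; apply: h1.
    move=> z zs; have [Fi Fk] := h2 z zs; rewrite normc_div ler_pdivrMr ?normc_gt0 //.
  exists (s / 4, i, fun z => \row_k projT1 (cid (mon k)) z) => _; split => /=; first by lra.
  - by apply: subset_trans dU; apply: disc_le; lra.
  - have s4 : disc a (s / 4) `<=` disc a s by apply: disc_le; lra.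
    apply: filterS dom => n /= [h1 h2]; split=> [k|z /s4 /h2 //].
    by apply: holomorphic_sub (h1 k).
  - move=> k e e0; apply: filterS (projT2 (cid (mon k)) e e0) => n /= h z zs.
    by rewrite mxE; exact: h.
pose ch a := projT1 (cid (loc a)).
have chP a : U a -> good a (ch a).1.1 (ch a).1.2 (ch a).2 by rewrite /ch; case: cid.
(* The value at [z] is read in the chart chosen at [z]; [eqs] shows that its ratios agree with the
   limit in the chart chosen at [a]. *)
exists (fun z => (ch z).2 z) => a Ua; exists (ch a).1.1, (ch a).1.2.
have [r0 rU dom cv] := chP a Ua.
set r := (ch a).1.1 in r0 rU dom cv *; set i := (ch a).1.2 in dom cv *; set psi := (ch a).2 in cv.
have eqs z : disc a r z -> [/\ (ch z).2 z 0 i != 0 & forall k, psi z 0 k = (ch z).2 z 0 k / (ch z).2 z 0 i].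
  move=> za; have [s0 _ domz cvz] := chP z (rU z za).
  set j := (ch z).1.2 in domz cvz *; set G := (ch z).2 z.
  have zz := disc0 z s0.
  have E k : psi z 0 k = G 0 k * psi z 0 j.
    have := slimM (ucvg_slim (cvz k) zz) (ucvg_slim (cv j) za).
    move=> H; apply: (slim_unique (ucvg_slim (cv k) za)); apply: slim_near H _.
    apply: filterS (filterI dom domz) => n /= [[_ h1] [_ h2]].
    have [Fi _] := h1 z za; have [Fj _] := h2 z zz.
    by field; rewrite Fi Fj.
  have Ei : psi z 0 i = 1.
    apply: (slim_unique (ucvg_slim (cv i) za)); apply: slim_near (slim_cst 1) _.
    by apply: filterS dom => n /= [_ h1]; have [Fi _] := h1 z za; rewrite divff.
  have Gi : G 0 i != 0.
    by apply: contraTneq isT => G0; have := E i; rewrite Ei G0 mul0r => /eqP; rewrite oner_eq0.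
  have Gj : psi z 0 j = (G 0 i)^-1 by apply: (mulfI Gi); rewrite -(E i) Ei divff.
  by split => // k; rewrite (E k) Gj.
have cvG k : ucvg (disc a r) (fun n z => F n z 0 k / F n z 0 i) (fun z => (ch z).2 z 0 k / (ch z).2 z 0 i).
  by move=> e e0; apply: filterS (cv k e e0) => n /= h z za; have [_ <-] := eqs z za; exact: h.
split => // [z /eqs[]//|k]; split => //.
apply: (weierstrass r0 _ (cvG k)).1.
apply: filterS dom => n /= [h1 h2] z zs; have [Fi _] := h2 z zs.
apply: cdiff_derivable; apply: (cdiff_ratio (f := coord (F n) k) (g := coord (F n) i)) => //;
  by apply: derivable_cdiff; apply: h1.
Qed.

End Marty.

(** * Closure properties of differentiability *)

Section Differentiable.
Context {R : realType}.
Local Notation C := R[i].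
Implicit Types (f g : C -> C) (z w : C).

Definition cdiffable f z := exists l, cdiff f z l.

Lemma cdiffableP f z : cdiffable f z <-> derivable (f : C^o -> C^o) z 1.
Proof. by split=> [[l]/cdiff_derivable|/derivable_cdiff H]; last by exists (cderiv f z). Qed.

Lemma cdiffable_cst l z : cdiffable (fun=> l) z.
Proof. by exists 0; exact: cdiff_cst. Qed.

Lemma cdiffableD f g z : cdiffable f z -> cdiffable g z -> cdiffable (fun w => f w + g w) z.
Proof. by move=> [l fl] [m gm]; eexists; apply: cdiffD fl gm. Qed.

Lemma cdiffableM f g z : cdiffable f z -> cdiffable g z -> cdiffable (fun w => f w * g w) z.
Proof. by move=> [l fl] [m gm]; eexists; apply: cdiffM fl gm. Qed.

Lemma cdiffableV f z : f z != 0 -> cdiffable f z -> cdiffable (fun w => (f w)^-1) z.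
Proof. by move=> f0 [l fl]; eexists; apply: cdiffV fl. Qed.

Lemma cdiffableX f z n : cdiffable f z -> cdiffable (fun w => f w ^+ n) z.
Proof. by move=> [l fl]; eexists; apply: cdiffX fl. Qed.

Lemma cdiffable_eq f g z : f =1 g -> cdiffable f z -> cdiffable g z.
Proof. by move=> /funext ->. Qed.

Lemma cdiffable_sum (I : Type) (r : seq I) (P : pred I) (F : I -> C -> C) z :
  (forall i, cdiffable (F i) z) -> cdiffable (fun w => \sum_(i <- r | P i) F i w) z.
Proof.
move=> H; elim: r => [|i r IH].
  by apply: cdiffable_eq (cdiffable_cst 0 z) => w; rewrite big_nil.
have [Pi|Pi] := boolP (P i).
  by apply: cdiffable_eq (cdiffableD (H i) IH) => w; rewrite big_cons Pi.
by apply: cdiffable_eq IH => w; rewrite big_cons (negbTE Pi).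
Qed.

Lemma cdiffable_prod (I : Type) (r : seq I) (P : pred I) (F : I -> C -> C) z :
  (forall i, cdiffable (F i) z) -> cdiffable (fun w => \prod_(i <- r | P i) F i w) z.
Proof.
move=> H; elim: r => [|i r IH].
  by apply: cdiffable_eq (cdiffable_cst 1 z) => w; rewrite big_nil.
have [Pi|Pi] := boolP (P i).
  by apply: cdiffable_eq (cdiffableM (H i) IH) => w; rewrite big_cons Pi.
by apply: cdiffable_eq IH => w; rewrite big_cons (negbTE Pi).
Qed.

End Differentiable.

(** * Hyperplanes in general position *)

Section GeneralPosition.
Context {R : realType} {N : nat}.
Local Notation C := R[i].
Local Notation vec := 'rV[C]_N.+1.
Implicit Types (z w b : C) (r M delta : R) (i k l : 'I_N.+1) (a v : vec).

Definition detv (v : 'I_N.+1 -> vec) : C := \det (\matrix_(i, k) v k 0 i).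

Lemma detv_scale (x : 'I_N.+1 -> C) (v : 'I_N.+1 -> vec) :
  detv (fun k => x k *: v k) = (\prod_k x k) * detv v.
Proof.
rewrite /detv (_ : (\matrix_(i, k) (x k *: v k) 0 i) =
  (\matrix_(i, k) v k 0 i) *m diag_mx (\row_k x k)); last first.
  apply/matrixP => i k; rewrite !mxE (bigD1 k) //= big1 => [|j jk].
    by rewrite !mxE eqxx mulr1n addr0 mulrC.
  by rewrite !mxE (negbTE jk) mulr0n mulr0.
by rewrite det_mulmx det_diag mulrC; congr (_ * _); apply: eq_bigr => k _; rewrite mxE.
Qed.

Lemma normc_detv_le (v : 'I_N.+1 -> vec) : (forall k i, normc (v k 0 i) <= 1) ->
  normc (detv v) <= (N.+1)`!%:R.
Proof.
move=> v1; apply: le_trans (normc_sum _ _ _) _.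
apply: (@le_trans _ _ (\sum_(s : 'S_N.+1) 1)).
  apply: ler_sum => s _; rewrite normcM normcX normcN normc1 expr1n mul1r normc_prod.
  by apply: prodr_ile1 => i _; rewrite mxE normc_ge0 v1.
by rewrite sumr_const card_Sn.
Qed.

Lemma normc_detv_perm (v : 'I_N.+1 -> vec) (s : 'S_N.+1) :
  normc (detv (fun k => v (s k))) = normc (detv v).
Proof.
rewrite /detv (_ : (\matrix_(i, k) v (s k) 0 i) = col_perm s (\matrix_(i, k) v k 0 i)); last first.
  by apply/matrixP => i k; rewrite !mxE.
by rewrite col_permE det_mulmx det_perm normcM normcX normcN normc1 expr1n mulr1.
Qed.

Lemma hnorm_ge a i : normc (a 0 i) <= hnorm a.
Proof. by apply: le_bigmax. Qed.

Lemma hnorm_gt0 a : a != 0 -> 0 < hnorm a.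
Proof. by move=> /row_neq0_max[i i0 _]; apply: lt_le_trans (hnorm_ge a i); rewrite normc_gt0. Qed.

Lemma hnorm_max a i : (forall k, normc (a 0 k) <= normc (a 0 i)) -> hnorm a = normc (a 0 i).
Proof.
move=> ai; apply/eqP; rewrite eq_le hnorm_ge andbT.
by apply/bigmax_leP; split => [|k _]; [exact: normc_ge0|exact: ai].
Qed.

Lemma normc_hnormalize a i : a != 0 -> normc (hnormalize a 0 i) = normc (a 0 i) / hnorm a.
Proof.
move=> /hnorm_gt0 a0; rewrite mxE normcM normcR ger0_norm 1?mulrC //.
by rewrite invr_ge0 ltW.
Qed.

Lemma hnormalize_le1 a i : a != 0 -> normc (hnormalize a 0 i) <= 1.
Proof. by move=> a0; rewrite normc_hnormalize // ler_pdivrMr ?hnorm_gt0 // mul1r hnorm_ge. Qed.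

Lemma normc_detv_normalize (v : 'I_N.+1 -> vec) : (forall k, v k != 0) ->
  normc (detv v) = (\prod_k hnorm (v k)) * normc (detv (fun k => hnormalize (v k))).
Proof.
move=> v0; have {1}-> : v = (fun k => (hnorm (v k))%:C%C *: hnormalize (v k)).
  apply/funext => k; rewrite /hnormalize scalerA -rmorphM /= mulfV ?scale1r //.
  by rewrite gt_eqF // hnorm_gt0.
rewrite detv_scale normcM normc_prod; congr (_ * _); apply: eq_bigr => k _.
by rewrite normcR ger0_norm // ltW // hnorm_gt0.
Qed.

(** The product in [hyperplane_prod] has one factor for each increasing map. An arbitrary injective
    family reaches such a factor by sorting, which changes the determinant by a sign only. *)
Lemma exists_sorting_perm (q : nat) (s : 'I_N.+1 -> 'I_q) : injective s ->
  exists p : 'S_N.+1, forall i j : 'I_N.+1, (i < j)%N -> (s (p i) < s (p j))%N.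
Proof.
move=> s_inj; pose t := [tuple s i | i < N.+1].
pose le_o := (fun x y : 'I_q => (x <= y)%N).
have /tuple_permP[p pE] : perm_eq (sort_tuple le_o t) t by rewrite perm_sort.
exists p => i j ij.
have tot : total le_o by move=> x y; exact: leq_total.
have tr : transitive le_o by move=> x y z; exact: leq_trans.
have sorted_t : sorted le_o (sort_tuple le_o t) by exact: sort_sorted.
rewrite pE in sorted_t.
have sz : size [tuple tnth t (p i) | i < N.+1] = N.+1 by rewrite size_tuple.
have := @sorted_ltn_nth _ le_o tr (s ord0) _ sorted_t i j.
rewrite !inE !sz !ltn_ord => /(_ isT isT ij).
rewrite -!(tnth_nth (s ord0) [tuple tnth t (p i) | i < N.+1]) !tnth_mktuple /le_o => le_ij.
rewrite ltn_neqAle le_ij andbT; apply/negP => /eqP/val_inj/s_inj/perm_inj ij'.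
by rewrite ij' ltnn in ij.
Qed.

(** If a product of minors exceeds [delta] and each of them is at most (N+1)!, every single one is
    at least this number. The exponent counts all maps, which may only decrease the bound since
    (N+1)! is at least 1. *)
Definition minor_bound (q : nat) delta : R :=
  delta / (N.+1)`!%:R ^+ #|{: {ffun 'I_N.+1 -> 'I_q}}|.

Lemma minor_bound_gt0 q delta : 0 < delta -> 0 < minor_bound q delta.
Proof. by move=> d0; rewrite divr_gt0 // exprn_gt0 // ltr0n fact_gt0. Qed.

Lemma detv_ge_minor_bound (q : nat) (a : 'I_q -> vec) delta (s : 'I_N.+1 -> 'I_q) :
  0 < delta -> (forall j, a j != 0) -> delta < hyperplane_prod a -> injective s ->
  minor_bound q delta <= normc (detv (fun k => hnormalize (a (s k)))).
Proof.
move=> d0 a0 ad /exists_sorting_perm[p p_inc].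
rewrite -(normc_detv_perm _ p).
pose t := [ffun k => s (p k)] : {ffun 'I_N.+1 -> 'I_q}.
have t_inc : [forall i : 'I_N.+1, forall j : 'I_N.+1, (i < j)%N ==> (t i < t j)%N].
  by apply/forallP => i; apply/forallP => j; apply/implyP => /p_inc; rewrite !ffunE.
pose D (u : {ffun 'I_N.+1 -> 'I_q}) := normc (detv (fun k => hnormalize (a (u k)))).
pose Y := \prod_(u : {ffun 'I_N.+1 -> 'I_q} | [forall i : 'I_N.+1, forall j : 'I_N.+1, (i < j)%N ==> (u i < u j)%N] && (u != t)) D u.
have XY : delta < D t * Y by rewrite /Y -bigD1.
have -> : (fun k => hnormalize (a (s (p k)))) = (fun k => hnormalize (a (t k))).
  by apply/funext => k; rewrite ffunE.
rewrite -/(D t).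
have K1 : 1 <= (N.+1)`!%:R :> R by rewrite ler1n fact_gt0.
have YK : Y <= (N.+1)`!%:R ^+ #|{: {ffun 'I_N.+1 -> 'I_q}}|.
  apply: (@le_trans _ _ (\prod_(s : {ffun 'I_N.+1 -> 'I_q}) (N.+1)`!%:R)); last first.
    by rewrite prodr_const.
  rewrite /Y big_mkcond /=; apply: ler_prod => u _; case: ifP => _.
    by rewrite normc_ge0 normc_detv_le // => k i; exact: hnormalize_le1.
  by rewrite ler01.
rewrite ler_pdivrMr; last by rewrite exprn_gt0 // ltr0n fact_gt0.
by apply: le_trans (ltW XY) (ler_wpM2l _ YK); exact: normc_ge0.
Qed.

Definition gen_pos (q : nat) (a : 'I_q -> vec) :=
  forall s : 'I_N.+1 -> 'I_q, injective s -> detv (fun k => a (s k)) != 0.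

Lemma pairing_mulmx (v : vec) (a : 'I_N.+1 -> vec) k :
  pairing v (a k) = (v *m \matrix_(i, k) a k 0 i) 0 k.
Proof. by rewrite mxE; apply: eq_bigr => i _; rewrite mxE mulrC. Qed.

Lemma injection_into_set (q : nat) (J : {set 'I_q}) : (N < #|J|)%N ->
  exists s : 'I_N.+1 -> 'I_q, injective s /\ forall k, s k \in J.
Proof.
move=> NJ; exists (fun k => enum_val (widen_ord NJ k)); split=> [k k'|k]; last exact: enum_valP.
by move=> /enum_val_inj/(congr1 val) /= /val_inj.
Qed.

(** The coefficients of N+1 of the hyperplanes form an invertible matrix, so the coordinates of [v]
    are recovered from N+1 pairings. *)
Lemma gen_pos_bound (q : nat) (a : 'I_q -> vec) (J : {set 'I_q}) : gen_pos a -> (N < #|J|)%N ->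
  exists2 M : R, 0 < M & forall v B, (forall j, j \in J -> normc (pairing v (a j)) <= B) ->
    forall i, normc (v 0 i) <= M * B.
Proof.
move=> ga /injection_into_set[s [s_inj sJ]].
pose A := \matrix_(i, k) a (s k) 0 i.
have Au : A \in unitmx by rewrite unitmxE unitfE; exact: ga.
pose M := \sum_i \sum_k normc (invmx A i k).
have M0 : 0 <= M by apply: sumr_ge0 => i _; apply: sumr_ge0 => k _; exact: normc_ge0.
exists (M + 1) => [|v B vB i]; first by rewrite ltr_wpDl.
have B0 : 0 <= B by apply: le_trans (vB (s ord0) (sJ ord0)); exact: normc_ge0.
have -> : v = (v *m A) *m invmx A by rewrite mulmxK.
rewrite mxE; apply: le_trans (normc_sum _ _ _) _.
apply: (@le_trans _ _ (\sum_k B * normc (invmx A k i))).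
  apply: ler_sum => k _; rewrite normcM ler_wpM2r ?normc_ge0 //.
  by rewrite -(pairing_mulmx v (fun k => a (s k))) vB.
rewrite -mulr_sumr mulrC ler_wpM2r // /M exchange_big /=.
apply: le_trans (ler_sum_one (u := fun i => \sum_k normc (invmx A k i)) i _) _.
  by move=> j; apply: sumr_ge0 => k _; exact: normc_ge0.
by rewrite lerDl.
Qed.

Lemma gen_pos_pairing0 (q : nat) (a : 'I_q -> vec) (J : {set 'I_q}) v : gen_pos a -> (N < #|J|)%N ->
  (forall j, j \in J -> pairing v (a j) = 0) -> v = 0.
Proof.
move=> ga NJ vJ; have [M M0 H] := gen_pos_bound ga NJ.
apply/rowP => i; rewrite mxE; apply: eq0_normc; apply/eqP.
rewrite eq_le normc_ge0 andbT -(mulr0 M); apply: H => j /vJ ->.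
by rewrite normc0.
Qed.

End GeneralPosition.

(** * Charts of uniform size for moving hyperplanes *)

Section HyperplaneChart.
Context {R : realType} {N : nat}.
Local Notation C := R[i].
Local Notation vec := 'rV[C]_N.+1.
Implicit Types (z w b : C) (r M delta : R) (i k l : 'I_N.+1) (a v : vec).

Lemma cdiffable_detv (v : 'I_N.+1 -> C -> vec) z :
  (forall k i, cdiffable (coord (v k) i) z) -> cdiffable (fun w => detv (fun k => v k w)) z.
Proof.
move=> dv; apply: cdiffable_sum => s; apply: cdiffableM; first exact: cdiffable_cst.
apply: cdiffable_prod => i; apply: cdiffable_eq (dv (s i) i) => w; by rewrite mxE.
Qed.

Lemma ratio_bounds n (c K x : R) (d : 'I_n -> R) (i0 : 'I_n) : 0 < c ->
  (forall j, c <= d j <= K) -> c <= x <= K ->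
  c ^+ n / K ^+ n.+1 <= d i0 ^+ n / (x * \prod_j d j) <= K ^+ n / c ^+ n.+1.
Proof.
move=> c0 db /andP[x1 x2].
have K0 : 0 < K by exact: lt_le_trans c0 (le_trans x1 x2).
have [d1 d2] := andP (db i0).
have pd1 : c ^+ n <= \prod_j d j.
  rewrite -[in X in X <= _](card_ord n) -prodr_const; apply: ler_prod => i _.
  by rewrite (ltW c0); case/andP: (db i).
have pd2 : \prod_j d j <= K ^+ n.
  rewrite -[in X in _ <= X](card_ord n) -prodr_const; apply: ler_prod => i _.
  by have /andP[h1 ->] := db i; rewrite (le_trans (ltW c0) h1).
have cN : 0 < c ^+ n by rewrite exprn_gt0.
have pd0 : 0 < \prod_j d j by exact: lt_le_trans cN pd1.
have x0 : 0 < x by exact: lt_le_trans c0 x1.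
have d0 : 0 < d i0 by exact: lt_le_trans c0 d1.
have dn1 : c ^+ n <= d i0 ^+ n by rewrite lerXn2r // nnegrE ltW.
have dn2 : d i0 ^+ n <= K ^+ n by rewrite lerXn2r // nnegrE ltW.
have xp0 : 0 < x * \prod_j d j by rewrite mulr_gt0.
have KN : 0 < K ^+ n.+1 by rewrite exprn_gt0.
have cN1 : 0 < c ^+ n.+1 by rewrite exprn_gt0.
apply/andP; split.
  apply: ler_pM => //; first exact: ltW; first by rewrite invr_ge0 ltW.
  by rewrite lef_pV2 ?posrE // exprS ler_pM // ltW.
apply: ler_pM => //; first by rewrite exprn_ge0 // ltW.
  by rewrite invr_ge0 ltW.
by rewrite lef_pV2 ?posrE // exprS ler_pM // ltW.
Qed.

(* Normalization is not holomorphic, but [hnorm] is comparable to a power of the modulus of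
   a holomorphic function [E], built from the minors. *)
Lemma hyperplane_chart_scale (q : nat) (a : 'I_q -> vec) (s : 'I_N.+1 -> 'I_q) (e : 'I_q) (c K : R) :
  0 < c -> (forall j, a j != 0) ->
  (forall t : 'I_N.+1 -> 'I_q, injective t -> c <= normc (detv (fun k => hnormalize (a (t k)))) <= K) ->
  injective s -> (forall k, s k != e) ->
  let Di i := detv (fun k => a (if k == i then e else s k)) in
  let E := Di ord0 ^+ N.+1 / (detv (fun k => a (s k)) * \prod_i Di i) in
  c ^+ N.+1 / K ^+ N.+2 <= normc E * hnorm (a (s ord0)) ^+ N.+1 /\
  normc E * hnorm (a (s ord0)) ^+ N.+1 <= K ^+ N.+1 / c ^+ N.+2.
Proof.
move=> c0 a0 cK s_inj se Di E.
pose si i k := if k == i then e else s k.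
have si_inj i : injective (si i).
  move=> k l; rewrite /si; case: (eqVneq k i) => [->|ki]; case: (eqVneq l i) => [->|li] //.
  - by move=> h; have := se l; rewrite -h eqxx.
  - by move=> h; have := se k; rewrite h eqxx.
  - exact: s_inj.
pose d i := normc (detv (fun k => hnormalize (a (si i k)))).
pose dd := normc (detv (fun k => hnormalize (a (s k)))).
have db i : c <= d i <= K by exact: cK.
have ddb : c <= dd <= K by exact: cK.
pose P := \prod_k hnorm (a (s k)); pose x := hnorm (a e).
have h0 j : 0 < hnorm (a j) by exact: hnorm_gt0.
have P0 : 0 < P by apply: prodr_gt0 => k _; exact: h0.
have x0 : 0 < x by exact: h0.
(* [Di i] contains [e] in place of [s i]. Counting degrees, [E] is homogeneous of degree -(N+1) in
   [a (s ord0)] and of degree 0 in all the other vectors, so only one norm survives. *)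
have DiE i : normc (Di i) = P * x * d i / hnorm (a (s i)).
  apply: (mulIf (lt0r_neq0 (h0 (s i)))); rewrite divfK ?gt_eqF //.
  rewrite /Di normc_detv_normalize // -/(d i) mulrAC; congr (_ * _).
  rewrite (bigD1 i) //= eqxx /P [in RHS](bigD1 i) //=.
  rewrite -/x (eq_bigr (fun k => hnorm (a (s k)))); last by move=> k /negbTE ->.
  by ring.
have prodDi : \prod_i normc (Di i) = (P * x) ^+ N.+1 * (\prod_i d i) / P.
  rewrite (eq_bigr _ (fun i _ => DiE i)) big_split big_split /= prodr_const card_ord.
  by rewrite prodfV.
have -> : normc E * hnorm (a (s ord0)) ^+ N.+1 = d ord0 ^+ N.+1 / (dd * \prod_i d i).
  rewrite /E normc_div normcX normcM normc_prod prodDi DiE.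
  rewrite (normc_detv_normalize (fun k => a0 (s k))) -/P -/dd expr_div_n.
  have hN : hnorm (a (s ord0)) ^+ N.+1 != 0 by rewrite expf_neq0 // gt_eqF.
  have PN : (P * x) ^+ N.+1 != 0 by rewrite expf_neq0 // gt_eqF // mulr_gt0.
  have dd0 : dd != 0 by rewrite gt_eqF // (lt_le_trans c0) //; case/andP: ddb.
  have pd0 : \prod_i d i != 0.
    by rewrite gt_eqF // prodr_gt0 // => i _; rewrite (lt_le_trans c0) //; case/andP: (db i).
  rewrite exprMn; move: hN PN dd0 pd0; set u := hnorm _ ^+ _; set y := (P * x) ^+ _.
  move: (\prod_i d i) (d ord0 ^+ _) => pd dn hN PN dd0 pd0.
  by field; rewrite hN PN dd0 pd0 gt_eqF.
by apply/andP; exact: ratio_bounds.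
Qed.

(** The holomorphic function [beta], which is [E] times the (N+1)-st power of the coordinate [k], is
    at most [B0] in modulus, and at least [kap] at [b] where that coordinate is largest. The Cauchy
    estimate keeps it above [kap / 2] on a disc whose radius does not depend on [H] or [b], and
    there the coordinate [k] still controls all the others. *)
Lemma hyperplane_chart (q : nat) delta r : (N.+1 < q)%N -> 0 < delta -> 0 < r ->
  exists B eps : R, [/\ 0 < B, 0 < eps, eps <= r &
    forall b (H : 'I_q -> C -> vec),
    (forall j k, holomorphic_on (disc b r) (coord (H j) k)) ->
    (forall z, disc b r z -> (forall j, H j z != 0) /\ delta < hyperplane_prod (fun j => H j z)) ->
    forall j k, (forall l, normc (H j b 0 l) <= normc (H j b 0 k)) ->
    forall z, disc b eps z -> H j z 0 k != 0 /\
      forall l, normc (H j z 0 l) <= B * normc (H j z 0 k)].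
Proof.
move=> Nq delta0 r0.
pose c := @minor_bound R N q delta; have c0 : 0 < c by exact: minor_bound_gt0.
pose K : R := Num.max c (N.+1)`!%:R.
have [cK KK] : c <= K /\ (N.+1)`!%:R <= K by rewrite !le_max !lexx orbT.
have K0 : 0 < K by lra.
pose kap := c ^+ N.+1 / K ^+ N.+2; pose B0 := K ^+ N.+1 / c ^+ N.+2.
have kap0 : 0 < kap by rewrite divr_gt0 // exprn_gt0.
have B00 : 0 < B0 by rewrite divr_gt0 // exprn_gt0.
have kapB : kap <= B0.
  apply: ler_pM; rewrite ?exprn_ge0 ?invr_ge0 ?exprn_ge0 ?(ltW c0) ?(ltW K0) //.
    by rewrite lerXn2r ?nnegrE // ltW.
  by rewrite lef_pV2 ?posrE ?exprn_gt0 // lerXn2r ?nnegrE // ltW.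
pose B := 2 * B0 / kap; have B1 : 1 <= B by rewrite /B ler_pdivlMr //; lra.
have e0 : 0 < kap * r / (16 * B0) by rewrite divr_gt0 // mulr_gt0.
(* The Lipschitz constant of [beta] is [8 B0 / r], so that this radius allows a change of at most
   [kap / 2]. *)
exists B, (Num.min (r / 4) (kap * r / (16 * B0))).
have r4 : 0 < r / 4 by lra.
split; [by lra|by rewrite lt_min e0 r4|by rewrite ge_min; apply/orP; left; lra|].
move=> b H hH Hz j k kmax z; rewrite /disc /= lt_min => /andP[zr ze].
have q0 : (0 < q)%N by exact: leq_trans Nq.
pose o m : 'I_q := insubd (Ordinal q0) m.
have oE m : (m <= N.+1)%N -> o m = m :> nat.
  by move=> mN; rewrite val_insubd (leq_ltn_trans mN Nq).
(* An enumeration of N+2 distinct indices that begins with the given [j]: the first N+1 form [s],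
   the last is [e]. *)
pose t m := tperm j (o 0%N) (o m).
pose s (k : 'I_N.+1) := t k; pose e := t N.+1.
have t_inj m n : (m <= N.+1)%N -> (n <= N.+1)%N -> t m = t n -> m = n.
  by move=> mN nN /perm_inj/(congr1 val) /=; rewrite !oE.
have s_inj : injective s.
  by move=> u v /t_inj h; apply/val_inj; apply: h; apply: ltnW; exact: ltn_ord.
have se u : s u != e.
  apply/eqP => /t_inj h; have := ltn_ord u; rewrite h ?ltnn //.
  by apply: ltnW; exact: ltn_ord.
have s0 : s ord0 = j by rewrite /s /t tpermR.
pose Di i u := detv (fun m => H (if m == i then e else s m) u).
pose E u := Di ord0 u ^+ N.+1 / (detv (fun m => H (s m) u) * \prod_i Di i u).
have key u : disc b r u -> kap <= normc (E u) * hnorm (H j u) ^+ N.+1 <= B0.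
  move=> ur; have [Hu0 Hud] := Hz u ur; rewrite -s0.
  apply/andP; apply: (hyperplane_chart_scale (a := fun m => H m u) c0 Hu0 _ s_inj se) => v v_inj.
  apply/andP; split.
    exact: (detv_ge_minor_bound (a := fun m => H m u)).
  apply: le_trans KK.
  by apply: normc_detv_le => m i; exact: hnormalize_le1.
pose beta u := E u * H j u 0 k ^+ N.+1.
have dH u m i : disc b r u -> cdiffable (coord (H m) i) u.
  by move=> ur; apply/cdiffableP; exact: hH.
have nz u (v : 'I_N.+1 -> 'I_q) : disc b r u -> injective v -> detv (fun m => H (v m) u) != 0.
  move=> ur v_inj; have [Hu0 Hud] := Hz u ur.
  rewrite -normc_gt0 (normc_detv_normalize (fun m => Hu0 (v m))) mulr_gt0 //.
    by apply: prodr_gt0 => m _; exact: hnorm_gt0.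
  by apply: lt_le_trans c0 _; exact: (detv_ge_minor_bound (a := fun m => H m u)) Hud v_inj.
have si_inj i : injective (fun m => if m == i then e else s m).
  move=> u v /=; case: (eqVneq u i) => [->|ui]; case: (eqVneq v i) => [->|vi] //.
  - by move=> h; have := se v; rewrite -h eqxx.
  - by move=> h; have := se u; rewrite h eqxx.
  - exact: s_inj.
have hbeta : holomorphic_on (disc b r) beta.
  move=> u ur; apply/cdiffableP; apply: cdiffableM; last by apply: cdiffableX; exact: dH.
  apply: cdiffableM.
    by apply: cdiffableX; apply: cdiffable_detv => m i; exact: dH.
  apply: cdiffableV.
    by rewrite mulf_neq0 ?nz //; apply/prodf_neq0 => i _; exact: nz.
  apply: cdiffableM; first by apply: cdiffable_detv => m i; exact: dH.
  by apply: cdiffable_prod => i; apply: cdiffable_detv => m i'; exact: dH.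
have betaB u : disc b r u -> normc (beta u) <= B0.
  move=> ur; have /andP[_] := key u ur; apply: le_trans.
  rewrite /beta (normcM (E u)) (normcX (H j u 0 k)) ler_wpM2l ?normc_ge0 // lerXn2r ?nnegrE ?normc_ge0 ?hnorm_ge //.
  by apply: le_trans (hnorm_ge _ k); exact: normc_ge0.
have betab : kap <= normc (beta b).
  by have /andP[+ _] := key b (disc0 b r0); rewrite (hnorm_max kmax) /beta (normcM (E b)) (normcX (H j b 0 k)).
have [_ /(_ (z - b) (ltW zr)) + _] := taylor1 r0 hbeta betaB.
rewrite [b + _]addrC subrK => lip.
have zr' : disc b r z by rewrite /disc /=; lra.
have betaz : kap / 2 <= normc (beta z).
  have h : 8 * B0 / r * normc (z - b) <= kap / 2.
    apply: (@le_trans _ _ (8 * B0 / r * (kap * r / (16 * B0)))).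
      apply: ler_wpM2l (ltW ze); apply: divr_ge0 (ltW r0).
      by rewrite mulr_ge0 // ltW.
    by rewrite le_eqVlt; apply/orP; left; apply/eqP; field; rewrite !gt_eqF.
  by have := ler_normc_sub (beta b) (beta z); rewrite normcBC; lra.
have Hk0 : H j z 0 k != 0.
  apply: contraTneq betaz => h; rewrite /beta h expr0n /= mulr0 normc0.
  by rewrite -ltNge divr_gt0.
split => // l.
have E0 : 0 < normc (E z).
  rewrite normc_gt0; apply: contraTneq betaz => h; rewrite /beta h mul0r normc0.
  by rewrite -ltNge divr_gt0.
have Hk1 : 0 < normc (H j z 0 k) by rewrite normc_gt0.
rewrite -ler_pdivrMr // leNgt; apply/negP => big.
have /andP[_ up] := key z zr'.
have low : normc (E z) * normc (H j z 0 l) ^+ N.+1 <= B * (normc (E z) * normc (H j z 0 k) ^+ N.+1).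
  apply: (@le_trans _ _ B0).
    apply: le_trans up; rewrite ler_wpM2l ?normc_ge0 // lerXn2r ?nnegrE ?normc_ge0 ?hnorm_ge //.
    by apply: le_trans (hnorm_ge _ k); exact: normc_ge0.
  rewrite /beta (normcM (E z)) (normcX (H j z 0 k)) in betaz; apply: (@le_trans _ _ (B * (kap / 2))).
    by rewrite le_eqVlt; apply/orP; left; apply/eqP; rewrite /B; field; rewrite gt_eqF.
  by rewrite ler_wpM2l //; lra.
rewrite mulrCA ler_pM2l // -ler_pdivrMr ?exprn_gt0 // -expr_div_n in low.
have B2 := le_trans B1 (ltW big).
(* The ratio exceeds [B], which is at least 1, so its (N+1)-st power exceeds [B] as well, contrary
   to [low]. *)
suff : B < B by rewrite ltxx.
apply: lt_le_trans big (le_trans _ low); rewrite exprS ler_peMr //.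
  by rewrite divr_ge0 ?normc_ge0.
by apply: exprn_ege1.
Qed.

End HyperplaneChart.

Local Opaque cexp.

(** * Curves omitting hyperplanes *)

Section Maximum.
Context {R : realType}.
Local Notation C := R[i].
Implicit Types (f g : C -> C) (z w a : C) (r e M : R) (phi : C -> R).

Lemma ccont_normc f z : ccont f z -> ccont (fun w => (normc (f w))%:C%C) z.
Proof.
move=> cf e e0; have [d d0 H] := cf e e0; exists d => // h /H hb.
rewrite -rmorphB normcR; apply: le_trans hb; rewrite ler_norml lerNl opprB.
by rewrite ler_normc_sub normcBC ler_normc_sub.
Qed.

Lemma ccontV f z : f z != 0 -> ccont f z -> ccont (fun w => (f w)^-1) z.
Proof. by move=> f0 cf; apply: (ccont_comp cf); exact: cdiff_ccont (cdiff_inv f0). Qed.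

Lemma ccont_sum (I : Type) (s : seq I) (F : I -> C -> C) z :
  (forall i, ccont (F i) z) -> ccont (fun w => \sum_(i <- s) F i w) z.
Proof.
move=> H; elim: s => [|i s IH].
  by apply: ccont_near (ccont_cst 0 z) _; exists 1 => // w _; rewrite big_nil.
by apply: ccont_near (ccontD (H i) IH) _; exists 1 => // w _; rewrite big_cons.
Qed.

Lemma ccontR_slim phi (u : nat -> C) z : ccont (fun w => (phi w)%:C%C) z -> slim u z ->
  forall e, 0 < e -> omega [set n | `|phi (u n) - phi z| <= e].
Proof.
move=> cf uz e e0; have [d d0 H] := cf e e0; apply: filterS (uz d d0) => n /= /H.
by rewrite [z + _]addrC subrK -rmorphB normcR.
Qed.

(** A maximising sequence converges along [omega] to a point of the closed disc. If [phi] were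
    unbounded, the same argument for a sequence with [phi (u n) > n] would give a contradiction. *)
Lemma disc_maximum phi a r : 0 <= r ->
  (forall z, normc (z - a) <= r -> ccont (fun w => (phi w)%:C%C) z) ->
  exists2 z, normc (z - a) <= r & forall w, normc (w - a) <= r -> phi w <= phi z.
Proof.
move=> r0 cphi.
have lim (u : nat -> C) : (forall n, normc (u n - a) <= r) ->
    exists2 z, normc (z - a) <= r & forall e, 0 < e -> omega [set n | `|phi (u n) - phi z| <= e].
  move=> ur; have [|z uz] := @omega_limit _ u (normc a + r).
    by apply: filterS filterT => n _ /=; have := ler_normc_sub (u n) a; have := ur n; lra.
  have za : normc (z - a) <= r.
    by apply: (slim_le (slimB uz (slim_cst a))); apply: filterS filterT => n _ /=.
  by exists z => //; apply: ccontR_slim => //; exact: cphi.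
have aa : normc (a - a) <= r by rewrite subrr normc0.
pose S := [set phi z | z in [set z | normc (z - a) <= r]].
have [[b bS]|nb] := pselect (exists b, ubound S b).
  have hS : has_sup S by split; [exists (phi a), a|exists b].
  have ex n : exists z, normc (z - a) <= r /\ sup S - n.+1%:R^-1 < phi z.
    have e0 : 0 < n.+1%:R^-1 :> R by rewrite invr_gt0.
    by have [_ [z zr <-] h] := sup_adherent e0 hS; exists z.
  have [u uP] : exists u : nat -> C, forall n, normc (u n - a) <= r /\ sup S - n.+1%:R^-1 < phi (u n).
    by exists (fun n => projT1 (cid (ex n))) => n; exact: projT2 (cid (ex n)).
  have [z zr zl] := lim u (fun n => (uP n).1).
  exists z => // w wr; apply: (@le_trans _ _ (sup S)); first by apply: ub_le_sup; [exists b|exists w].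
  apply: le_of_all_eps => e e0; have e2 : 0 < e / 2 by lra.
  have [n [/= h1 h2]] := omega_neq0 (filterI (zl _ e2) (omega_small e2)).
  have := (uP n).2; move: h1; rewrite ler_norml => /andP[_ h1] h3.
  by move: (n.+1%:R^-1) h2 h3 => x h2 h3; lra.
have ex n : exists z, normc (z - a) <= r /\ n%:R < phi z.
  apply: contrapT => /forallNP H; apply: nb; exists n%:R => _ [z zr <-].
  by rewrite leNgt; apply/negP => h; apply: (H z).
have [u uP] : exists u : nat -> C, forall n, normc (u n - a) <= r /\ n%:R < phi (u n).
  by exists (fun n => projT1 (cid (ex n))) => n; exact: projT2 (cid (ex n)).
have [z zr zl] := lim u (fun n => (uP n).1).
have [n [/= h1 h2]] := omega_neq0 (filterI (zl _ ltr01) (omega_geq (Num.truncn (`|phi z| + 1)).+1)).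
have := (uP n).2; move: h1; rewrite ler_norml => /andP[_ h1] h3.
have := truncnS_gt (`|phi z| + 1); have := ler_norm (phi z).
move: h2; rewrite -(ler_nat R); lra.
Qed.

End Maximum.

(** * The Hermitian product and Cauchy-Schwarz *)

Section Hermitian.
Context {R : realType} {N : nat}.
Local Notation C := R[i].
Local Notation vec := 'rV[C]_N.+1.
Implicit Types (u v : vec) (i k : 'I_N.+1).

Definition nsq v : R := \sum_k normc (v 0 k) ^+ 2.

Lemma nsq_ge0 v : 0 <= nsq v.
Proof. by apply: sumr_ge0 => k _; rewrite exprn_ge0 // normc_ge0. Qed.

Lemma nsq_gt0 v : v != 0 -> 0 < nsq v.
Proof. exact: (sum_sqr_gt0 (F := fun=> v) (z := 0)). Qed.

Lemma nsq_ge v i : normc (v 0 i) ^+ 2 <= nsq v.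
Proof. exact: (sum_sqr_ge (fun=> v) 0). Qed.

Lemma nsqZ (x : C) v : nsq (x *: v) = normc x ^+ 2 * nsq v.
Proof. by rewrite /nsq mulr_sumr; apply: eq_bigr => k _; rewrite mxE normcM exprMn. Qed.

Lemma vnorm_sqr v : vnorm v ^+ 2 = nsq v.
Proof. by rewrite sqr_sqrtr // nsq_ge0. Qed.

Lemma hermZl (x : C) u v : herm (x *: u) v = x * herm u v.
Proof. by rewrite /herm mulr_sumr; apply: eq_bigr => k _; rewrite mxE mulrA. Qed.

Lemma hermZr (x : C) u v : herm u (x *: v) = x^*%C * herm u v.
Proof. by rewrite /herm mulr_sumr; apply: eq_bigr => k _; rewrite mxE rmorphM mulrCA. Qed.

Lemma mulcJ (z : C) : z * z^*%C = (normc z ^+ 2)%:C%C.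
Proof. by rewrite sqr_normcE; case: z => x y; simpc; rewrite /= -!expr2; congr (_ +i* _)%C; ring. Qed.

Lemma herm_self v : herm v v = (nsq v)%:C%C.
Proof. by rewrite /herm /nsq rmorph_sum; apply: eq_bigr => k _; exact: mulcJ. Qed.

(* The defect in the Cauchy-Schwarz inequality is invariant under
   the translation [u -> u - v]. *)
Lemma herm_near u v : nsq u * nsq v <= normc (herm u v) ^+ 2 + nsq (u - v) * nsq v.
Proof.
have E1 : nsq (u - v) = nsq u - 2 * Re (herm u v) + nsq v.
  rewrite /nsq /herm (raddf_sum (@complex.Re R)) mulr_sumr -sumrB -big_split; apply: eq_bigr => k _ /=.
  by rewrite !mxE !sqr_normcE; case: (u 0 k) => a b; case: (v 0 k) => c d /=; ring.
have E2 (x : C) (y : R) : normc (x - y%:C%C) ^+ 2 = normc x ^+ 2 - 2 * y * Re x + y ^+ 2.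
  by rewrite !sqr_normcE; case: x => a b /=; ring.
have := exprn_ge0 2 (normc_ge0 (herm u v - (nsq v)%:C%C)); rewrite E2 E1.
lra.
Qed.

Lemma herm_le u v : normc (herm u v) ^+ 2 <= nsq u * nsq v.
Proof.
have [->|v0] := eqVneq v 0.
  rewrite /herm big1 ?normc0 ?expr0n /= => [|k _]; last by rewrite mxE rmorph0 mulr0.
  by rewrite mulr_ge0 ?nsq_ge0.
pose x := herm u v / (nsq v)%:C%C.
have nv := nsq_gt0 v0; have nvC : (nsq v)%:C%C != 0 :> C by rewrite fmorph_eq0 gt_eqF.
have E1 w : nsq (u - w) = nsq u - 2 * Re (herm u w) + nsq w.
  rewrite /nsq /herm (raddf_sum (@complex.Re R)) mulr_sumr -sumrB -big_split; apply: eq_bigr => k _ /=.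
  by rewrite !mxE !sqr_normcE; case: (u 0 k) => a b; case: (w 0 k) => c d /=; ring.
have := nsq_ge0 (u - x *: v); rewrite E1 nsqZ hermZr /x.
have -> : (herm u v / (nsq v)%:C%C)^*%C * herm u v = ((normc (herm u v) ^+ 2) / nsq v)%:C%C.
  rewrite rmorphM fmorphV /= mulrAC mulrC -[(_^*%C) * _]mulrC mulcJ.
  rewrite [RHS]rmorphM fmorphV /= mulrC; congr (_ * _^-1).
  by rewrite oppr0.
rewrite normc_div normcR (gtr0_norm nv) /= => h.
have E : normc (herm u v) ^+ 2 / nsq v <= nsq u.
  have -> : normc (herm u v) ^+ 2 / nsq v = 2 * (normc (herm u v) ^+ 2 / nsq v) -
      (normc (herm u v) / nsq v) ^+ 2 * nsq v by field; rewrite gt_eqF.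
  lra.
by rewrite -ler_pdivrMr.
Qed.

End Hermitian.

(** * The identity theorem *)

Section Identity.
Context {R : realType}.
Local Notation C := R[i].
Implicit Types (f g : C -> C) (z w a : C) (r d e : R).

Definition vanish f a := exists2 d : R, 0 < d & forall z, disc a d z -> f z = 0.

Lemma vanish_open f a : vanish f a -> exists2 d : R, 0 < d & forall w, disc a d w -> vanish f w.
Proof.
move=> [d d0 fd]; exists d => // w wd; exists (d - normc (w - a)); first by rewrite subr_gt0.
by move=> z zw; apply: fd; apply: disc_sub zw; lra.
Qed.

Lemma vanish_closed f a r : 0 < r -> holomorphic_on (disc a r) f ->
  (forall d : R, 0 < d -> exists2 w, disc a d w & vanish f w) -> vanish f a.
Proof.
move=> r0 hf H; have [//|[m [c [d [c0 d0 fd]]]]] := isolated_zero r0 hf.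
have [w wd [e e0 fw]] := H _ d0.
pose t := Num.min e (d - normc (w - a)) / 2.
have m0 : 0 < Num.min e (d - normc (w - a)) by rewrite lt_min e0 subr_gt0.
have t0 : 0 < t by rewrite divr_gt0.
have te : t < e by rewrite ltr_pdivrMr // mulr_natr mulr2n ltr_pwDl // ge_min lexx.
have td : t < d - normc (w - a).
  by rewrite ltr_pdivrMr // mulr_natr mulr2n ltr_pwDl // ?ge_min ?lexx ?orbT // subr_gt0.
have [v v0 [vd vw]] : exists2 v : C, v != 0 & normc v < d /\ disc w e (a + v).
  have [wa|wa] := eqVneq w a; last first.
    by exists (w - a); [rewrite subr_eq0|split => //; rewrite [a + _]addrC subrK; exact: disc0].
  exists t%:C%C; first by rewrite fmorph_eq0 gt_eqF.
  rewrite normcR gtr0_norm // wa disc_shift normcR gtr0_norm //; split => //.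
  by move: td; rewrite wa subrr normc0 subr0.
have := fd _ vd; rewrite (fw _ vw) normc0 leNgt mulr_gt0 // exprn_gt0 // normc_gt0 //.
Qed.

Lemma identity_theorem f a : holomorphic_on setT f -> vanish f a -> forall z, f z = 0.
Proof.
move=> hf fa z; suff [d d0] : vanish f z by apply; exact: disc0.
apply: (plane_induction fa) => [w|w H]; first exact: vanish_open.
by apply: (vanish_closed (ltr01 : 0 < 1 :> R)) H => v _; exact: hf.
Qed.

End Identity.

(** * A maximum principle for curves of bounded spherical derivative *)

Section Growth.
Context {R : realType} {N : nat}.
Local Notation C := R[i].
Local Notation vec := 'rV[C]_N.+1.
Implicit Types (F : C -> vec) (p q : C -> C) (z w : C) (r e M : R) (i k : 'I_N.+1).

(** The squared cosine of the Fubini-Study distance from F(z) to F(z0) is at least 1 - K |z - z0|^2: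
    an integrated, division-free form of a bound on the spherical derivative. *)
Definition locally_lipschitz F (K rho : R) := forall z0 z, normc (z - z0) <= rho ->
  nsq (F z) * nsq (F z0) * (1 - K * normc (z - z0) ^+ 2) <= normc (herm (F z) (F z0)) ^+ 2.

(** Divided by the coordinate dominating at [z0], the curve is bounded by 2 on a disc of uniform
    radius, hence Lipschitz by [taylor1]; [herm_near] turns the distance of the vectors into the
    cosine. *)
Lemma sph_locally_lipschitz F M : 0 < M -> (forall k, holomorphic_on setT (coord F k)) ->
  (forall z, F z != 0 /\ sph F z <= M) ->
  exists K rho : R, [/\ 0 < K, 0 < rho & locally_lipschitz F K rho].
Proof.
move=> M0 hF FM; pose r := (5 * N.+1%:R * M)^-1.
have r0 : 0 < r by rewrite invr_gt0 !mulr_gt0 // ltr0Sn.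
pose L := 8 * 2 / r; have L0 : 0 < L by rewrite divr_gt0 // mulr_gt0.
pose K := N.+1%:R * L ^+ 2; have K0 : 0 < K by rewrite mulr_gt0 ?ltr0Sn // exprn_gt0.
exists K, (r / 4); split => //; first by rewrite divr_gt0.
move=> z0 z zr; have zr' : normc (z - z0) < r by lra.
have hd k : holomorphic_on (disc z0 r) (coord F k) by apply: holomorphic_sub (hF k).
have [i i0 imax] := row_neq0_max (FM z0).1.
have D w : disc z0 r w -> forall k, normc (F w 0 k) <= 2 * normc (F w 0 i).
  by move=> wr; apply: (dominating_coord M0 hd (fun w _ => FM w) imax wr).
have Fi w : disc z0 r w -> F w 0 i != 0.
  move=> wr; have [k k0 _] := row_neq0_max (FM w).1; apply: contraNneq k0 => h.
  by have := D w wr k; rewrite h normc0 mulr0 -normc_eq0 eq_le normc_ge0 => ->.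
pose phi w : vec := (F w 0 i)^-1 *: F w.
have lip k : normc (phi z 0 k - phi z0 0 k) <= L * normc (z - z0).
  have hphi : holomorphic_on (disc z0 r) (fun w => F w 0 k / F w 0 i).
    move=> w wr; apply: cdiff_derivable.
    by apply: (cdiff_ratio (f := coord F k) (g := coord F i)) (Fi w wr) _ _;
      apply: derivable_cdiff; apply: hF.
  have b2 w : disc z0 r w -> normc (F w 0 k / F w 0 i) <= 2.
    by move=> wr; rewrite normc_div ler_pdivrMr ?normc_gt0 ?Fi // D.
  have [_ /(_ (z - z0) zr) + _] := taylor1 r0 hphi b2.
  by rewrite [z0 + _]addrC subrK !mxE !(mulrC _^-1).
have FE w : disc z0 r w -> F w = F w 0 i *: phi w.
  by move=> wr; rewrite scalerA mulfV ?scale1r // Fi.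
have zz : disc z0 r z by [].
have z00 : disc z0 r z0 by exact: disc0.
rewrite (FE _ zz) (FE _ z00) (nsqZ (F z 0 i)) (nsqZ (F z0 0 i)).
rewrite (hermZl (F z 0 i)) (hermZr (F z0 0 i)) (normcM (F z 0 i)) (normcM (F z0 0 i)^*%C) normcJ.
set x := normc (F z 0 i); set y := normc (F z0 0 i); set t := normc (z - z0).
have u1 w : disc z0 r w -> 1 <= nsq (phi w).
  move=> wr; apply: le_trans (nsq_ge _ i); rewrite mxE mulVf ?normc1 ?expr1n //.
  exact: Fi.
have near := herm_near (phi z) (phi z0).
have diff : nsq (phi z - phi z0) <= K * t ^+ 2.
  apply: (@le_trans _ _ (\sum_(k < N.+1) (L * t) ^+ 2)).
    apply: ler_sum => k _.
    rewrite (_ : (phi z - phi z0) 0 k = phi z 0 k - phi z0 0 k); last by rewrite !mxE.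
    have Lt : 0 <= L * t by rewrite mulr_ge0 ?normc_ge0 // ltW.
    by apply: lerXn2r; rewrite ?nnegrE ?normc_ge0.
  by rewrite sumr_const card_ord -mulr_natl exprMn mulrA.
have key : nsq (phi z) * nsq (phi z0) * (1 - K * t ^+ 2) <= normc (herm (phi z) (phi z0)) ^+ 2.
  have h1 := ler_wpM2r (nsq_ge0 (phi z0)) diff.
  have n0 : 0 <= K * t ^+ 2 * nsq (phi z0) by rewrite mulr_ge0 ?nsq_ge0 // mulr_ge0 ?sqr_ge0 // ltW.
  have h2 := ler_wpM2l n0 (u1 z zz); rewrite mulr1 in h2.
  move: near h1 h2; set A := nsq (phi z); set B := nsq (phi z0); set D1 := nsq (_ - _).
  by move=> *; lra.
have xy : 0 <= (x * y) ^+ 2 by rewrite sqr_ge0.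
have := ler_wpM2l xy key; rewrite -exprMn mulrA => h.
apply: le_trans (le_trans h _); rewrite le_eqVlt; apply/orP; left; apply/eqP.
  by move: (nsq (phi z)) (nsq (phi z0)) (x) (y) (t) => A B x' y' t'; ring.
by move: (normc (herm _ _)) (x) (y) => A x' y'; ring.
Qed.

Lemma holomorphic_herm F (v : vec) (D : set C) : (forall k, holomorphic_on D (coord F k)) ->
  holomorphic_on D (fun z => herm (F z) v).
Proof.
move=> hF z Dz; apply/cdiffableP; apply: cdiffable_sum => k.
by apply: cdiffableM (cdiffable_cst _ _); apply/cdiffableP; exact: hF.
Qed.

(** By [lip] the Laplacian of log |F|^2 is at most 4K, that of 2K |z|^2 is 8K, so log [E] is
    strictly subharmonic. Without second derivatives: at an interior maximum [z0] of [E], |F z|^2 is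
    compared with |<F z, F z0>|^2 and the weight with the modulus of an exponential. This gives a
    holomorphic [theta] near [z0] that is strictly smaller on a surrounding square than at its
    centre. *)
Lemma growth_maximum F (K rho r B : R) q : 0 < K -> 0 < rho -> 0 < r -> 0 < B ->
  (forall k, holomorphic_on setT (coord F k)) -> (forall z, F z != 0) ->
  locally_lipschitz F K rho -> holomorphic_on setT q ->
  (forall z, normc z = r -> normc (cexp (q z)) ^+ 2 <= B * nsq (F z)) ->
  normc (cexp (q 0)) ^+ 2 <= B * nsq (F 0) * expR (2 * K * r ^+ 2).
Proof.
move=> K0 rho0 r0 B0 hF F0 lip hq bd.
pose W z : R := expR (2 * K * (normc z ^+ 2 - r ^+ 2)).
have W0 z : 0 < W z by exact: expR_gt0.
pose E z := normc (cexp (q z)) ^+ 2 * W z / nsq (F z).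
have nF z : 0 < nsq (F z) by exact: nsq_gt0.
have cq z : ccont q z by exact: holomorphic_ccont hq I.
have cn f z : ccont f z -> ccont (fun w => ((normc (f w)) ^+ 2)%:C%C) z.
  move=> cf; have := ccontM (ccont_normc cf) (ccont_normc cf).
  move=> /ccont_near; apply; exists 1 => // w _.
  by rewrite -rmorphM /= expr2.
have cE z : normc (z - 0) <= r -> ccont (fun w => (E w)%:C%C) z.
  move=> _.
  have c1 := cn _ _ (ccont_comp (cq z) (cdiff_ccont (cdiff_cexp _))).
  have c2 : ccont (fun w => (W w)%:C%C) z.
    have cz : ccont (fun w => (2 * K)%:C%C * (((normc w) ^+ 2)%:C%C + (- r ^+ 2)%:C%C)) z.
      by apply: ccontZ; apply: ccontD (ccont_cst _ _); apply: (cn id); exact: cdiff_ccont (cdiff_id z).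
    have := ccont_normc (ccont_comp cz (cdiff_ccont (cdiff_cexp _))).
    move=> /ccont_near; apply; exists 1 => // w _.
    by rewrite /= normc_cexp /W -!(rmorphD, rmorphM).
  have c3 : ccont (fun w => (nsq (F w))%:C%C) z.
    have : ccont (fun w => \sum_k ((normc (F w 0 k)) ^+ 2)%:C%C) z.
      by apply: ccont_sum => k; apply: (cn (coord F k)); exact: holomorphic_ccont (hF k) I.
    by move=> /ccont_near; apply; exists 1 => // w _; rewrite /nsq rmorph_sum.
  have n0 : (nsq (F z))%:C%C != 0 :> C by rewrite fmorph_eq0 gt_eqF.
  have := ccontM (ccontM c1 c2) (ccontV n0 c3).
  by move=> /ccont_near; apply; exists 1 => // w _; rewrite /E /= !rmorphM fmorphV.
have [z0 z0r z0max] := disc_maximum (ltW r0) cE.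
rewrite subr0 in z0r.
have {}z0max z : normc z <= r -> E z <= E z0 by move=> zr; apply: z0max; rewrite subr0.
suff EB : E z0 <= B.
  have := le_trans (z0max 0 (ltac:(by rewrite normc0 ltW))) EB.
  rewrite /E /W normc0 expr0n /= sub0r mulrN expRN ler_pdivrMr // ler_pdivrMr ?expR_gt0 //.
move: z0r; rewrite le_eqVlt => /predU1P[z0r|z0r].
  by rewrite /E ler_pdivrMr // /W z0r subrr mulr0 expR0 mulr1; exact: bd.
exfalso.
(* The boundary of the square lies within [2 s] of [z0]: this distance keeps it inside the disc of
   radius [r], lets [lip] apply, and makes K |z - z0|^2 at most 1/4. *)
pose s := Num.min (Num.min ((r - normc z0) / 2) (rho / 2)) (Num.min 1 (1 / (16 * K))).
have s0 : 0 < s.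
  rewrite !lt_min ltr01 (divr_gt0 rho0) // (divr_gt0 _ (ltr0Sn _ 1)) ?subr_gt0 //.
  by rewrite divr_gt0 // mulr_gt0.
have [s1 s2 s3 s4] : [/\ s <= (r - normc z0) / 2, s <= rho / 2, s <= 1 & s <= 1 / (16 * K)].
  by rewrite !ge_min !lexx !orbT.
have sK : K * (2 * s) ^+ 2 <= 1 / 4.
  have : K * s <= 1 / 16.
    by move: s4; rewrite ler_pdivlMr ?mulr_gt0 //; lra.
  have : s * s <= s * 1 by rewrite ler_wpM2l // ltW.
  move=> h1 h2; have := ler_wpM2l (ltW K0) h1; rewrite exprMn expr2; lra.
(* The linear exponent comes from |z|^2 - |z0|^2 = |z - z0|^2 + 2 Re (conj z0 (z - z0)): its modulus
   accounts for all of the weight except exp (2 K |z - z0|^2). *)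
pose theta z := cexp (q z + (2 * K)%:C%C * (z0^*%C * (z - z0))) / herm (F z) (F z0).
have hermb z : normc (z - z0) <= 2 * s ->
    nsq (F z) * nsq (F z0) * (1 - K * normc (z - z0) ^+ 2) <= normc (herm (F z) (F z0)) ^+ 2.
  by move=> zs; apply: lip; lra.
have Kx z : normc (z - z0) <= 2 * s -> K * normc (z - z0) ^+ 2 <= 1 / 4.
  move=> zs; apply: le_trans sK; rewrite ler_wpM2l ?(ltW K0) // lerXn2r ?nnegrE ?normc_ge0 //.
  by rewrite mulr_ge0 // ltW.
have herm0 z : normc (z - z0) <= 2 * s -> 0 < normc (herm (F z) (F z0)) ^+ 2.
  move=> zs; apply: lt_le_trans (hermb z zs); rewrite !mulr_gt0 //.
  by have := Kx z zs; lra.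
have hn0 z : normc (z - z0) <= 2 * s -> herm (F z) (F z0) != 0.
  by move=> /herm0 h; apply: contraTneq h => ->; rewrite normc0 expr0n /= ltxx.
have hherm : holomorphic_on setT (fun z => herm (F z) (F z0)) by exact: holomorphic_herm.
have htheta : holomorphic_on (disc z0 (2 * s)) theta.
  move=> z /ltW zs; apply/cdiffableP; apply: cdiffableM; last first.
    by apply: cdiffableV; [exact: hn0|apply/cdiffableP; exact: (hherm z I)].
  have [l dq] : cdiffable q z by apply/cdiffableP; exact: hq.
  have := cdiff_comp (cdiffD dq (cdiffZ (2 * K)%:C%C (cdiffZ z0^*%C (cdiff_subC z0 z)))) (cdiff_cexp _).
  by move=> dd; eexists; exact: dd.
have th0 : normc (theta z0) ^+ 2 = normc (cexp (q z0)) ^+ 2 / nsq (F z0) ^+ 2.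
  rewrite /theta subrr !mulr0 addr0 normc_div expr_div_n herm_self normcR.
  by rewrite ger0_norm // nsq_ge0.
have step z : normc (z - z0) <= 2 * s ->
    normc (theta z) ^+ 2 * (1 + K * normc (z - z0) ^+ 2 / 2) <= normc (theta z0) ^+ 2.
  move=> zs; set x := K * normc (z - z0) ^+ 2.
  have x4 : x <= 1 / 4 by exact: Kx.
  have x0 : 0 <= x by rewrite mulr_ge0 ?sqr_ge0 // ltW.
  have zr : normc z <= r by have := ler_normc_sub z z0; lra.
  have := z0max z zr; rewrite /E ler_pdivrMr // [leRHS]mulrAC ler_pdivlMr //.
  pose y := 2 * K * Re (z0^*%C * (z - z0)).
  have WE : W z = W z0 * (expR y ^+ 2 * expR (2 * x)).
    rewrite /W [expR y ^+ 2]expr2 -!expRD; congr expR; rewrite /x /y !sqr_normcE.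
    by case: (z) => a b; case: (z0) => c d /=; ring.
  have tE : normc (theta z) ^+ 2 = normc (cexp (q z)) ^+ 2 * expR y ^+ 2 / normc (herm (F z) (F z0)) ^+ 2.
    rewrite /theta normc_div cexpD normcM !expr_div_n exprMn; congr (_ * _ ^+ 2 / _).
    rewrite normc_cexp; congr expR; rewrite /y.
    by case: (z0^*%C * (z - z0)) => a b /=; ring.
  rewrite tE th0 WE.
  have hz := hermb z zs; have h0 := herm0 z zs; rewrite -/x in hz.
  have n1 := nF z; have n0 := nF z0; have w0 := W0 z0.
  have q0 : 0 <= normc (cexp (q z)) ^+ 2 * expR y ^+ 2 by rewrite mulr_ge0 ?sqr_ge0.
  have e2x : 1 + 2 * x <= expR (2 * x) by exact: expR_ge1Dx.
  move: hz h0 n1 n0 w0 q0 e2x; set H := normc (herm _ _) ^+ 2; set n1 := nsq (F z); set n0 := nsq (F z0).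
  set a := normc (cexp (q z)) ^+ 2; set b := normc (cexp (q z0)) ^+ 2; set ey := expR y ^+ 2.
  set ex := expR (2 * x); set w := W z0.
  move=> hz h0 n10 n00 w0 ae0 e2x.
  have -> : a * (w * (ey * ex)) * n0 = w * (a * ey * ex * n0) by ring.
  have -> : b * w * n1 = w * (b * n1) by ring.
  rewrite ler_pM2l // => H1.
  rewrite [leLHS]mulrAC ler_pdivrMr // [leRHS]mulrAC ler_pdivlMr ?exprn_gt0 //.
  (* (1 + 2x)(1 - x) = 1 + x - 2x^2 is at least 1 + x/2 for x at most 1/4: the weight with [2 K]
     outdoes the loss with [K] in [lip]. *)
  have p1 : (1 + x / 2) <= ex * (1 - x).
    have : (1 + 2 * x) * (1 - x) <= ex * (1 - x) by rewrite ler_wpM2r //; lra.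
    have : x * x <= x * (1 / 4) by rewrite ler_wpM2l.
    lra.
  apply: (@le_trans _ _ (a * ey * (ex * (1 - x)) * n0 ^+ 2)).
    by rewrite ler_wpM2r ?sqr_ge0 // ler_wpM2l.
  have x1 : 0 <= 1 - x by lra.
  apply: (@le_trans _ _ (b * n1 * ((1 - x) * n0))).
    rewrite (_ : a * ey * (ex * (1 - x)) * n0 ^+ 2 = a * ey * ex * n0 * ((1 - x) * n0)); last by ring.
    by rewrite ler_wpM2r // mulr_ge0 // ltW.
  rewrite (_ : b * n1 * _ = b * (n1 * n0 * (1 - x))); last by ring.
  by rewrite ler_wpM2l // sqr_ge0.
pose m := 1 + K * s ^+ 2 / 2.
have m1 : 1 < m by rewrite ltrDl divr_gt0 // mulr_gt0 // exprn_gt0.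
have sm1 : 1 < Num.sqrt m by rewrite -[X in X < _]sqrtr1 ltr_sqrt //; lra.
have thz0 : 0 < normc (theta z0).
  by rewrite normc_gt0 mulf_neq0 ?invr_eq0 ?cexp_neq0 // hn0 // subrr normc0 mulr_ge0 // ltW.
have := @max_modulus _ z0 theta s (normc (theta z0) / Num.sqrt m) s0 htheta.
suff h : forall z, square_bd s (z - z0) -> normc (theta z) <= normc (theta z0) / Num.sqrt m.
  move=> /(_ h); rewrite ler_pdivlMr; last by lra.
  by rewrite leNgt ltr_pMr // sm1.
move=> z /(square_bd_norm s0)[zs z2].
rewrite ler_pdivlMr; last by lra.
rewrite -(@ler_pXn2r _ 2%N) ?nnegrE ?mulr_ge0 ?normc_ge0 ?sqrtr_ge0 //.
rewrite exprMn sqr_sqrtr; last by lra.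
apply: le_trans (step z z2); rewrite ler_wpM2l ?sqr_ge0 // lerD2l ler_wpM2r // ler_wpM2l ?(ltW K0) //.
by rewrite lerXn2r ?nnegrE ?normc_ge0 // ltW.
Qed.

End Growth.

(** * Exponents are quadratic polynomials *)

Section QuadraticGrowth.
Context {R : realType} {N : nat}.
Local Notation C := R[i].
Local Notation vec := 'rV[C]_N.+1.
Implicit Types (F : C -> vec) (p q : C -> C) (z w u : C) (r e M : R).

Definition taylor_estimate p (c : nat -> C) (A d : R) := forall n w, normc w <= d ->
  normc (p w - \sum_(k < n) c k * w ^+ k) <= A * (normc w / (2 * d)) ^+ n.

Lemma entire_taylor p : holomorphic_on setT p ->
  exists c A d, [/\ 0 < A :> R, 0 < d :> R & taylor_estimate p c A d].
Proof.
move=> hp; have [d d0 pb] := ccont_bounded (holomorphic_ccont hp (I : setT 0)).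
have hd : holomorphic_on (disc 0 d) p by apply: holomorphic_sub hp.
have [c /(_ _ pb) cP] := power_series d0 hd.
exists c, (4 * (normc (p 0) + 1)), (d / 4); split.
- by rewrite mulr_gt0 // ltr_wpDl ?normc_ge0.
- by rewrite divr_gt0.
move=> n w wd; have := cP n w wd; rewrite add0r.
by have -> : normc w / (2 * (d / 4)) = 2 * normc w / d by field; rewrite gt_eqF.
Qed.

(** The Taylor remainder of order [k] divided by [w^k]; the value [c k] at 0 removes the
    singularity. *)
Definition taylor_remainder p (c : nat -> C) k w : C :=
  if w == 0 then c k else (p w - \sum_(l < k) c l * w ^+ l) / w ^+ k.

Lemma holomorphic_taylor_remainder p c (A d : R) k : holomorphic_on setT p -> 0 < A -> 0 < d ->
  taylor_estimate p c A d -> holomorphic_on setT (taylor_remainder p c k).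
Proof.
move=> hp A0 d0 cP; apply: holomorphicT => z.
have [->|z0] := eqVneq z 0; last first.
  have [l dl] : cdiffable (fun w => (p w - \sum_(l < k) c l * w ^+ l) / w ^+ k) z.
    apply: cdiffableM; last first.
      by apply: cdiffableV; [rewrite expf_neq0|apply: cdiffableX; exists 1; exact: cdiff_id].
    have [a da] : cdiffable p z by apply/cdiffableP; exact: hp.
    have [b db] : cdiffable (fun w => \sum_(l < k) c l * w ^+ l) z.
      apply: cdiffable_sum => i; apply: cdiffableM; first exact: cdiffable_cst.
      by apply: cdiffableX; exists 1; exact: cdiff_id.
    by exists (a - b); exact: cdiffB da db.
  exists l; apply: cdiff_near dl _; exists (normc z); first by rewrite normc_gt0.
  move=> w wz; rewrite /taylor_remainder ifN //; apply: contraTneq wz => ->.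
  by rewrite /disc /= sub0r normcN ltxx.
exists (c k.+1) => e e0.
pose q := A / (2 * d) ^+ k.+2; have q0 : 0 < q by rewrite divr_gt0 // exprn_gt0 // mulr_gt0.
exists (Num.min d (e / q)) => [|h]; first by rewrite lt_min d0 divr_gt0.
rewrite lt_min => /andP[/ltW hd]; rewrite ltr_pdivlMr // => /ltW he.
rewrite add0r /taylor_remainder eqxx; have [->|h0] := eqVneq h 0.
  by rewrite subrr mulr0 subrr normc0 mulr0.
have hk : h ^+ k != 0 by rewrite expf_neq0.
have -> : (p h - \sum_(l < k) c l * h ^+ l) / h ^+ k - c k - c k.+1 * h =
    (p h - \sum_(l < k.+2) c l * h ^+ l) / h ^+ k.
  rewrite !big_ord_recr /= exprS; field; exact: hk.
have nh : 0 < normc h by rewrite normc_gt0.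
rewrite normc_div normcX ler_pdivrMr ?exprn_gt0 //.
apply: le_trans (cP k.+2 h hd) _.
have -> : A * (normc h / (2 * d)) ^+ k.+2 = normc h * q * normc h * normc h ^+ k.
  have D0 : 2 * d != 0 by rewrite gt_eqF // mulr_gt0.
  rewrite /q; move: (2 * d) D0 => D D0; have Dk : D ^+ k != 0 by rewrite expf_neq0.
  by rewrite expr_div_n !exprS; field; rewrite ?Dk ?D0.
by rewrite ler_wpM2r ?exprn_ge0 ?normc_ge0 // ler_wpM2r ?normc_ge0.
Qed.

Section Barrier.
Variables (p : C -> C) (c : nat -> C) (k : nat) (r : R) (u : C).

(* On the circle of radius [r] its real part is [(1 + Re (u r^k / z^k)) / 2]
   times that of [p]: the terms of [u r^k p / z^k] with a pole at 0 are replaced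
   by holomorphic ones with the same real part on the circle. *)
Definition barrier z : C := 2^-1 * p z + 4^-1 * (u^*%C * (z ^+ k / r%:C%C ^+ k) * p z +
  u * r%:C%C ^+ k * taylor_remainder p c k z +
  u^*%C * \sum_(l < k) (c l)^*%C * (r%:C%C ^+ (2 * l) / r%:C%C ^+ k) * z ^+ (k - l)).

Lemma holomorphic_barrier : holomorphic_on setT p ->
  holomorphic_on setT (taylor_remainder p c k) -> holomorphic_on setT barrier.
Proof.
move=> hp hr z _; apply/cdiffableP.
have dp : cdiffable p z by apply/cdiffableP; exact: hp.
have dr : cdiffable (taylor_remainder p c k) z by apply/cdiffableP; exact: hr.
have dX n : cdiffable (fun w => w ^+ n) z by apply: cdiffableX; exists 1; exact: cdiff_id.
have cc l : cdiffable (fun=> l) z by exact: cdiffable_cst.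
apply: cdiffableD; first exact: cdiffableM.
apply: cdiffableM => //; apply: cdiffableD; first apply: cdiffableD.
- by apply: cdiffableM => //; apply: cdiffableM => //; exact: cdiffableM.
- by apply: cdiffableM.
by apply: cdiffableM => //; apply: cdiffable_sum => l; exact: cdiffableM.
Qed.

Hypotheses (r0 : 0 < r) (u1 : normc u = 1).

Lemma Re_barrier z : normc z = r ->
  Re (barrier z) = Re (p z) * (1 + Re (u * r%:C%C ^+ k / z ^+ k)) / 2.
Proof.
move=> zr; have z0 : z != 0 by rewrite -normc_gt0 zr.
have rC : r%:C%C != 0 :> C by rewrite fmorph_eq0 gt_eqF.
(* On the circle conjugation is the inversion [r^2 / z]; it exchanges the polar terms with the
   polynomial that closes [barrier]. *)
have zJ : z^*%C = r%:C%C ^+ 2 / z.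
  by apply: (mulIf z0); rewrite divfK // mulrC mulcJ zr rmorphXn.
pose e := u * r%:C%C ^+ k / z ^+ k.
have rJ n : (r%:C%C ^+ n)^*%C = r%:C%C ^+ n :> C by rewrite rmorphXn /= oppr0.
have eJ : u^*%C * (z ^+ k / r%:C%C ^+ k) = e^*%C.
  rewrite /e rmorphM fmorphV rmorphM /= rJ rmorphXn /= zJ expr_div_n -exprM mulnC exprM expr2.
  by field; rewrite !expf_neq0.
have tr : u * r%:C%C ^+ k * taylor_remainder p c k z = e * p z - e * \sum_(l < k) c l * z ^+ l.
  by rewrite /taylor_remainder (negbTE z0) /e; field; rewrite expf_neq0.
have T3 : u^*%C * \sum_(l < k) (c l)^*%C * (r%:C%C ^+ (2 * l) / r%:C%C ^+ k) * z ^+ (k - l) =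
    (e * \sum_(l < k) c l * z ^+ l)^*%C.
  rewrite rmorphM rmorph_sum /= -eJ !mulr_sumr; apply: eq_bigr => l _.
  rewrite rmorphM rmorphXn /= zJ expr_div_n -exprM.
  have lk := ltnW (ltn_ord l).
  rewrite -[in z ^+ k](subnK lk) exprD; field.
  by rewrite !expf_neq0.
have ReJ x : Re x^*%C = Re x :> R by case: x.
have Rehalf x : Re (2^-1 * x) = Re x / 2 :> R.
  have -> : 2^-1 = (2^-1)%:C%C :> C by rewrite fmorphV rmorph_nat.
  by case: x => a b; simpc => /=; ring.
have Requarter x : Re (4^-1 * x) = Re x / 4 :> R.
  have -> : 4^-1 = (4^-1)%:C%C :> C by rewrite fmorphV rmorph_nat.
  by case: x => a b; simpc => /=; ring.
rewrite /barrier eJ tr T3 raddfD /= Rehalf Requarter !raddfD /= raddfN /= ReJ -/e.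
have -> : Re (e^*%C * p z) + (Re (e * p z) - Re (e * \sum_(l < k) c l * z ^+ l)) +
   Re (e * \sum_(l < k) c l * z ^+ l) = 2 * Re e * Re (p z).
  by case: (e) => a b; case: (p z) => x y /=; ring.
by field.
Qed.

(** The factor of [Re (p z)] in [Re_barrier] lies between 0 and 1. *)
Lemma Re_barrier_le z : normc z = r -> Re (barrier z) <= Num.max (Re (p z)) 0.
Proof.
move=> zr; rewrite Re_barrier //; set e := u * _ / _.
have e1 : normc e = 1 by rewrite /e normc_div normcM !normcX normcR (gtr0_norm r0) u1 zr mul1r divff // expf_neq0 // gt_eqF.
have := normc_Re e; rewrite e1 ler_norml => /andP[h1 h2].
have [p0|p0] := leP 0 (Re (p z)).
  have : Re (p z) * (1 + Re e) <= Re (p z) * 2 by rewrite ler_wpM2l //; lra.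
  by lra.
have : 0 <= - Re (p z) * (1 + Re e) by rewrite mulr_ge0 //; lra.
by lra.
Qed.

(** Only the coefficient of order [k] survives at 0, since the exponents [k - l] of the last sum are
    positive. *)
Lemma barrier0 : p 0 = 0 -> (0 < k)%N -> barrier 0 = 4^-1 * (u * r%:C%C ^+ k * c k).
Proof.
move=> p0 k0; rewrite /barrier p0 !mulr0 !add0r /taylor_remainder eqxx big1 ?mulr0 ?addr0 // => l _.
by rewrite expr0n subn_eq0 leqNgt ltn_ord mulr0.
Qed.

End Barrier.

(** The function [barrier] satisfies the boundary condition of [growth_maximum]: its real part is at
    most the larger of [Re (p z)] and 0, and the last two hypotheses cover these two cases. At 0 it
    equals [r^k |c k| / 4], so that [r^k |c k| / 2] is at most a constant plus [2 K r^2], which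
    fails for large [r] if [k > 2] and [c k] is not 0. *)
Lemma quadratic_growth F (K rho B : R) p : 0 < K -> 0 < rho -> 0 < B ->
  (forall k, holomorphic_on setT (coord F k)) -> (forall z, F z != 0) ->
  locally_lipschitz F K rho -> holomorphic_on setT p -> p 0 = 0 ->
  (forall z, normc (cexp (p z)) ^+ 2 <= B * nsq (F z)) -> (forall z, 1 <= B * nsq (F z)) ->
  exists x y : C, forall z, p z = x * z + y * z ^+ 2.
Proof.
move=> K0 rho0 B0 hF F0 lip hp p0 pF oneF.
have [c [A [d [A0 d0 cP]]]] := entire_taylor hp.
have c0 : c 0%N = 0.
  have := cP 1%N 0; rewrite normc0 mul0r expr1 mulr0 big_ord1 p0 expr0 mulr1 sub0r normcN => h.
  by apply: eq0_normc; apply/eqP; rewrite eq_le normc_ge0 h // ltW.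
have ck k : (2 < k)%N -> c k = 0.
  move=> k3; apply/eqP/negPn/negP => ck0; have n0 : 0 < normc (c k) by rewrite normc_gt0.
  have nC : (normc (c k))%:C%C != 0 :> C by rewrite fmorph_eq0 gt_eqF.
  (* The unimodular number that rotates [c k] onto the positive axis. *)
  pose u := (c k)^*%C / (normc (c k))%:C%C.
  have u1 : normc u = 1 by rewrite normc_div normcJ normcR gtr0_norm // divff // gt_eqF.
  pose A1 := B * nsq (F 0); have A10 : 0 < A1 by rewrite mulr_gt0 // nsq_gt0.
  (* Since [A1] is at most exp [A1], the growth bound gives [r |c k|] at most [2 (A1 + 2 K)]; this
     [r] violates it. *)
  pose r := 1 + 2 * (A1 + 2 * K) / normc (c k).
  have q0 : 0 < 2 * (A1 + 2 * K) / normc (c k) by rewrite divr_gt0 // mulr_gt0 // addr_gt0 // mulr_gt0.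
  have r1 : 1 <= r by rewrite lerDl ltW.
  have r0 : 0 < r by lra.
  have hQ : holomorphic_on setT (barrier p c k r u).
    apply: holomorphic_barrier; first exact: hp.
    exact: holomorphic_taylor_remainder hp A0 d0 cP.
  have bd z : normc z = r -> normc (cexp (barrier p c k r u z)) ^+ 2 <= B * nsq (F z).
    move=> zr; have : Re (barrier p c k r u z) <= Num.max (Re (p z)) 0 by exact: Re_barrier_le.
       rewrite normc_cexp le_max => /orP[h|h].
      apply: le_trans (pF z); rewrite normc_cexp lerXn2r ?nnegrE ?expR_ge0 // ler_expR //.
    apply: le_trans (oneF z); rewrite exprn_ile1 ?expR_ge0 // -expR0 ler_expR //.
  have := growth_maximum K0 rho0 r0 B0 hF F0 lip hQ bd.
  rewrite barrier0 //; last exact: ltn_trans k3.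
  have -> : u * r%:C%C ^+ k * c k = (r ^+ k * normc (c k))%:C%C.
    rewrite rmorphM rmorphXn /= /u; apply: (mulIf nC).
    rewrite -!mulrA [X in _ = _ * X](_ : _ = c k * (c k)^*%C); last first.
      by rewrite mulcJ rmorphXn /= expr2.
    by field; exact: nC.
  have -> : 4^-1 * (r ^+ k * normc (c k))%:C%C = (4^-1 * (r ^+ k * normc (c k)))%:C%C :> C.
    by rewrite [RHS]rmorphM fmorphV rmorph_nat.
  rewrite normc_cexp expr2 -expRD -/A1 /= => h.
  have : expR (4^-1 * (r ^+ k * normc (c k)) + 4^-1 * (r ^+ k * normc (c k))) <=
      expR (A1 + 2 * K * r ^+ 2).
    apply: le_trans h _; rewrite expRD ler_wpM2r ?expR_ge0 //.
    by have := expR_ge1Dx A1; lra.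
  rewrite ler_expR => {}h.
  have r2 : 1 <= r ^+ 2 by rewrite exprn_ege1.
  have rk : r * r ^+ 2 <= r ^+ k by rewrite -exprS ler_weXn2l.
  have h1 : A1 * 1 <= A1 * r ^+ 2 by rewrite ler_wpM2l // ltW.
  have h2 : r * r ^+ 2 * normc (c k) <= r ^+ k * normc (c k) by rewrite ler_wpM2r // ltW.
  have : r * normc (c k) * r ^+ 2 <= 2 * (A1 + 2 * K) * r ^+ 2 by lra.
  rewrite ler_pM2r; last by lra.
  by rewrite /r mulrDl divfK ?gt_eqF // mul1r gerDr leNgt n0.
exists (c 1%N), (c 2%N) => z.
pose g w := p w - (c 1%N * w + c 2%N * w ^+ 2).
have hg : holomorphic_on setT g.
  move=> w _; apply: cdiff_derivable; apply: cdiffB (derivable_cdiff (hp w I)) _.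
  by apply: cdiffD (cdiffZ _ (cdiff_id w)) (cdiffZ _ (cdiffX 2 (cdiff_id w))).
(* The Taylor estimate is local, so it shows equality near 0 only; the identity theorem extends it
   to the plane. *)
suff g0 : vanish g 0 by apply/eqP; rewrite -subr_eq0; apply/eqP; exact: (identity_theorem hg g0).
exists d => // w; rewrite /disc /= subr0 => wd.
have part n : \sum_(l < 3 + n) c l * w ^+ l = c 1%N * w + c 2%N * w ^+ 2.
  rewrite big_split_ord /= [X in _ + X]big1 => [|i _]; last by rewrite ck ?mul0r.
  by rewrite addr0 !big_ord_recr big_ord0 /= c0 expr1; ring.
apply/eqP; rewrite -normc_eq0 eq_le normc_ge0 andbT.
apply: (@le0_of_all_eps _ A _ _) => e e0.
have [n ne] : exists n : nat, 1 / 2 ^+ n < e.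
  exists (Num.truncn e^-1).+1; rewrite ltr_pdivrMr ?exprn_gt0 // mulrC -ltr_pdivrMr //.
  by rewrite mul1r (lt_trans (truncnS_gt _)) // -natrX ltr_nat ltn_expl.
have := cP (3 + n)%N w (ltW wd); rewrite part => /le_trans; apply.
rewrite mulrC ler_wpM2r ?(ltW A0) //; apply: le_trans (ltW ne).
have x0 : 0 <= normc w / (2 * d) by rewrite divr_ge0 ?normc_ge0 // mulr_ge0 // ltW.
have x2 : normc w / (2 * d) <= 1 / 2 by rewrite ler_pdivrMr ?mulr_gt0 //; lra.
rewrite (_ : 1 / 2 ^+ n = (1 / 2) ^+ n); last by rewrite expr_div_n expr1n.
apply: (@le_trans _ _ ((normc w / (2 * d)) ^+ n)).
  by apply: ler_wiXn2l => //; [lra|rewrite leq_addl].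
by rewrite lerXn2r ?nnegrE //; lra.
Qed.

End QuadraticGrowth.

(** * Curves that lie in or omit 2N+1 hyperplanes in general position *)

Section OmittingCurve.
Context {R : realType} {N : nat}.
Local Notation C := R[i].
Local Notation vec := 'rV[C]_N.+1.
Local Notation q := (2 * N + 1)%N.
Implicit Types (h : C -> vec) (z w u : C) (t e M G : R) (v a : vec).

Lemma finite_bound (I : finType) (Q : I -> R -> Prop) :
  (forall (i : I) (d d' : R), d <= d' -> Q i d -> Q i d') ->
  (forall i : I, exists d : R, Q i d) -> exists2 d : R, 0 < d & forall i : I, Q i d.
Proof.
move=> Qle Qex; suff H (s : seq I) : exists2 d : R, 0 < d & forall i : I, i \in s -> Q i d.
  by have [d d0 dP] := H (enum I); exists d => // i; apply: dP; rewrite mem_enum.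
elim: s => [|i s [d d0 dP]]; first by exists 1.
have [d' d'P] := Qex i; exists (Num.max d d') => [|j]; first by rewrite lt_max d0.
rewrite in_cons => /predU1P[->|/dP]; last by apply: Qle; rewrite le_max lexx.
by apply: Qle d'P; rewrite le_max lexx orbT.
Qed.

Lemma pairingB v (w : vec) a : pairing (v - w) a = pairing v a - pairing w a.
Proof. by rewrite /pairing -sumrB; apply: eq_bigr => i _; rewrite !mxE mulrBr. Qed.

Lemma pairingZ (x : C) v a : pairing (x *: v) a = x * pairing v a.
Proof. by rewrite /pairing mulr_sumr; apply: eq_bigr => i _; rewrite !mxE mulrCA. Qed.

Lemma pairing_herm v a : pairing v a = herm v (map_mx (fun x : C => x^*%C) a).
Proof. by apply: eq_bigr => i _; rewrite mxE conjcK mulrC. Qed.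

Lemma pairing_le a : exists2 B : R, 0 < B & forall v, normc (pairing v a) ^+ 2 <= B * nsq v.
Proof.
exists (nsq (map_mx (fun x : C => x^*%C) a) + 1) => [|v]; first by rewrite ltr_wpDl // nsq_ge0.
rewrite pairing_herm; apply: le_trans (herm_le _ _) _.
by rewrite mulrC ler_wpM2r ?nsq_ge0 // lerDl.
Qed.

Lemma pairing_le_max a (v : vec) (B : R) : (forall i, normc (v 0 i) <= B) ->
  normc (pairing v a) <= (\sum_i normc (a 0 i)) * B.
Proof.
move=> vB; apply: le_trans (normc_sum _ _ _) _; rewrite mulr_suml.
by apply: ler_sum => i _; rewrite normcM ler_wpM2l ?normc_ge0.
Qed.

Definition large_set (a : 'I_q -> vec) G v : {set 'I_q} :=
  [set j | [forall k, normc (pairing v (a k)) <= G * normc (pairing v (a j))]].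

(** If at most N indices were large, the complement would have more than N elements. By general
    position its pairings bound [v], hence all pairings, so that the largest of them would itself be
    large. [G] is uniform because there are finitely many index sets. *)
Lemma card_large_set (a : 'I_q -> vec) : gen_pos a ->
  exists2 G : R, 0 < G & forall v, (N < #|large_set a G v|)%N.
Proof.
move=> ga; pose Q (J : {set 'I_q}) G := (N < #|J|)%N -> forall v, exists2 j, j \in J &
  forall k, normc (pairing v (a k)) <= G * normc (pairing v (a j)).
have [G G0 GP] : exists2 G : R, 0 < G & forall J, Q J G.
  apply: finite_bound => [J d d' dd H NJ v|J].
    have [j jJ jP] := H NJ v; exists j => // k; apply: le_trans (jP k) _.
    by rewrite ler_wpM2r // normc_ge0.
  have [NJ|NJ] := ltnP N #|J|; last by exists 0; rewrite /Q ltnNge NJ.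
  have [M M0 MP] := gen_pos_bound ga NJ.
  exists ((\sum_k \sum_i normc (a k 0 i)) * M) => _ v.
  have /card_gt0P[j0 j0J] : (0 < #|J|)%N by exact: leq_trans NJ.
  have [j jJ jmax] : exists2 j, j \in J & forall k, k \in J -> normc (pairing v (a k)) <= normc (pairing v (a j)).
    pose j := [arg max_(j > j0 | j \in J) normc (pairing v (a j))]%O.
    by exists j; rewrite /j; case: arg_maxP.
  exists j => // k; apply: le_trans (pairing_le_max (a k) (MP v _ jmax)) _.
  rewrite mulrA ler_wpM2r ?normc_ge0 // ler_wpM2r ?(ltW M0) //.
  apply: (ler_sum_one (u := fun k => \sum_i normc (a k 0 i))) => l.
  by apply: sumr_ge0 => i _; exact: normc_ge0.
exists G => // v; rewrite ltnNge; apply/negP => small.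
have NJ : (N < #|~: large_set a G v|)%N.
  have := cardsC (large_set a G v); rewrite card_ord => cE.
  by rewrite -(ltn_add2l #|large_set a G v|) cE (leq_ltn_trans (leq_add small (leqnn N))) // mul2n addn1 addnn.
have [j] := GP _ NJ v; rewrite !inE => /negP jn jP; apply: jn.
by apply/forallP => k; exact: jP.
Qed.

(** Two subsets with at least N+1 of the 2N+1 indices cannot be disjoint. *)
Lemma large_set_meet (a : 'I_q -> vec) G v (w : vec) : (forall v, (N < #|large_set a G v|)%N) ->
  exists j, j \in large_set a G v /\ j \in large_set a G w.
Proof.
move=> big; have : (0 < #|large_set a G v :&: large_set a G w|)%N.
  rewrite -(ltn_add2l #|large_set a G v :|: large_set a G w|) addn0 cardsUI.
  apply: leq_ltn_trans (max_card _) _; rewrite card_ord.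
  by apply: leq_trans (leq_add (big v) (big w)); rewrite addn1 addSn addnS ltnS mul2n addnn.
by move=> /card_gt0P[j]; rewrite inE => /andP[? ?]; exists j.
Qed.

Lemma linear_bound_eq0 (x A B : R) : (forall t, 1 <= t -> `|x| * t ^+ 2 <= A * t + B) -> x = 0.
Proof.
move=> H; apply/eqP; rewrite -normr_eq0; apply/negPn/negP => x0.
have xp : 0 < `|x| by rewrite lt_neqAle eq_sym x0 normr_ge0.
pose t := 1 + (`|A| + `|B|) / `|x|.
have t1 : 1 <= t by rewrite lerDl divr_ge0 // addr_ge0.
have := H t t1; have := ler_norm A; have := ler_norm B => hB hA.
have h1 : A * t <= `|A| * t by rewrite ler_wpM2r //; lra.
have h2 : `|B| * 1 <= `|B| * t by rewrite ler_wpM2l.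
have E : `|x| * t ^+ 2 = (`|x| + (`|A| + `|B|)) * t.
  by rewrite /t; field.
rewrite E; have : 0 < `|x| * t by rewrite mulr_gt0 //; lra.
lra.
Qed.

(** The pairing with [a j1] being 1, the index [j1] has exponent 0, and |h| is bounded below as
    [quadratic_growth] requires. An index large at two points controls all exponents at both of them
    up to an additive constant; opposite points leave no room for a nonzero quadratic or linear
    part. *)
Theorem omitting_curve_constant (a : 'I_q -> vec) h M (j1 : 'I_q) : gen_pos a ->
  (forall k, holomorphic_on setT (coord h k)) -> 0 < M ->
  (forall z, h z != 0 /\ sph h z <= M) ->
  (forall j, (forall z, pairing (h z) (a j) = 0) \/ (forall z, pairing (h z) (a j) != 0)) ->
  (forall z, pairing (h z) (a j1) = 1) -> forall z, h z = h 0.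
Proof.
move=> ga hh M0 hM om j1P.
have [K [rho [K0 rho0 lip]]] := sph_locally_lipschitz M0 hh hM.
have h0 z : h z != 0 by have [] := hM z.
have hol j : holomorphic_on setT (fun z => pairing (h z) (a j)).
  move=> z _; apply/cdiffableP; apply: cdiffable_sum => k.
  by apply: cdiffableM; [exact: cdiffable_cst|apply/cdiffableP; exact: (hh k)].
have [B1 B10 B1P] := pairing_le (a j1).
pose nz j := forall z, pairing (h z) (a j) != 0.
have loc j : exists t : C * (C * C), nz j -> [/\ t.1 != 0,
    forall z, pairing (h z) (a j) = t.1 * cexp (t.2.1 * z + t.2.2 * z ^+ 2) &
    j = j1 -> t.2.1 = 0 /\ t.2.2 = 0].
  have [->|jj1] := eqVneq j j1.
    exists (1, (0, 0)) => _; split => //; first exact: oner_neq0.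
    by move=> z; rewrite j1P /= !mul0r addr0 cexp0 mulr1.
  have [nj|] := pselect (nz j); last by exists (0, (0, 0)).
  have [p [c [hp p0 c0 pP]]] := entire_log (hol j) nj.
  have [B B0 BP] := pairing_le (a j).
  have cc : 0 < normc c ^+ 2 by rewrite exprn_gt0 // normc_gt0.
  pose B2 := B / normc c ^+ 2 + B1.
  have B20 : 0 < B2 by rewrite addr_gt0 // divr_gt0.
  have [||x [y xyP]] := @quadratic_growth _ _ h K rho B2 p K0 rho0 B20 hh h0 lip hp p0.
  - move=> z; have := BP (h z); rewrite pP normcM exprMn mulrC -ler_pdivlMr // mulrAC => /le_trans; apply.
    by rewrite ler_wpM2r ?nsq_ge0 // lerDl ltW.
  - move=> z; have := B1P (h z); rewrite j1P normc1 expr1n => /le_trans; apply.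
    by rewrite ler_wpM2r ?nsq_ge0 // lerDr ltW // divr_gt0.
  exists (c, (x, y)) => _; split => [//|z|/eqP]; first by rewrite pP xyP.
  by rewrite (negbTE jj1).
pose c j := (projT1 (cid (loc j))).1.
pose x j := (projT1 (cid (loc j))).2.1; pose y j := (projT1 (cid (loc j))).2.2.
have cxy j : nz j -> [/\ c j != 0,
    forall z, pairing (h z) (a j) = c j * cexp (x j * z + y j * z ^+ 2) &
    j = j1 -> x j = 0 /\ y j = 0].
  by rewrite /c /x /y; case: cid.
have nz1 : nz j1 by move=> z; rewrite j1P oner_neq0.
have [G G0 big] := card_large_set ga.
pose T j z := Re (x j * z + y j * z ^+ 2).
(* When moduli are compared up to the factor [G], the exponents are compared up to log (G |c_j| /
   |c_k|); [L] bounds all these logarithms. *)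
pose L := \sum_k \sum_j G * normc (c j) / normc (c k).
have LP j k : G * normc (c j) / normc (c k) <= L.
  have nn i l : 0 <= G * normc (c i) / normc (c l).
    by rewrite divr_ge0 ?normc_ge0 // mulr_ge0 ?normc_ge0 // ltW.
  apply: (@le_trans _ _ (\sum_j G * normc (c j) / normc (c k))).
    exact: (ler_sum_one (u := fun j => G * normc (c j) / normc (c k))).
  apply: (ler_sum_one (u := fun k => \sum_j G * normc (c j) / normc (c k))) => l.
  by apply: sumr_ge0.
have cmp j k z : j \in large_set a G (h z) -> nz k -> nz j /\ T k z <= L + T j z.
  rewrite inE => /forallP jP nk.
  have nj : nz j.
    have [j0|//] := om j; have := jP j1; rewrite j1P normc1 j0 normc0 mulr0 => ?; lra.
  split => //; have [cj pj _] := cxy j nj; have [ck pk _] := cxy k nk.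
  have := jP k; rewrite pk pj (normcM (c k)) (normcM (c j)) !normc_cexp -/(T k z) -/(T j z) => H.
  have ck0 : 0 < normc (c k) by rewrite normc_gt0.
  rewrite -ler_expR expRD; rewrite mulrC -ler_pdivlMr // in H; apply: le_trans H _.
  rewrite -mulrA mulrA mulrAC [X in X <= _](_ : _ = G * normc (c j) / normc (c k) * expR (T j z)); last by ring.
  rewrite ler_wpM2r ?expR_ge0 //; apply: le_trans (LP j k) _.
  by have := expR_ge1Dx L; lra.
have pair k l z w : nz k -> nz l -> exists j, [/\ nz j, T k z <= L + T j z, T l z <= L + T j z,
     T k w <= L + T j w & T l w <= L + T j w].
  move=> nk nl; have [j [jz jw]] := large_set_meet (h z) (h w) big; exists j.
  have [nj ?] := cmp j k z jz nk; have [_ ?] := cmp j l z jz nl.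
  by have [_ ?] := cmp j k w jw nk; have [_ ?] := cmp j l w jw nl.
have [x1 y1] : x j1 = 0 /\ y j1 = 0 by have [_ _] := cxy j1 nz1; apply.
have T1 z : T j1 z = 0 by rewrite /T x1 y1 !mul0r addr0.
(* In the directions [u] and [i u] the quadratic terms have opposite signs, and
   some index is large at both points. *)
pose X := \sum_j normc (x j).
have xX j : normc (x j) <= X.
  by apply: (ler_sum_one (u := fun j => normc (x j))) => l; exact: normc_ge0.
have TE j z : T j z = Re (x j * z) + Re (y j * z ^+ 2) by rewrite /T raddfD.
have Rex j z : `|Re (x j * z)| <= X * normc z.
  by apply: le_trans (normc_Re _) _; rewrite normcM ler_wpM2r ?normc_ge0.
have Rey k u : nz k -> Re (y k * u ^+ 2) = 0.
  move=> nk; apply: (@linear_bound_eq0 _ (6 * X * normc u) (2 * L)) => t t1.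
  have t0 : 0 < t by lra.
  (* Compared with [j1], the exponent of [j] is at least [-L] at both points, which bounds |Re (y_j
     u^2)| t^2 by a linear function of [t]; the comparison with [k] transfers this to [y k]. *)
  have [j [nj]] := pair k j1 (u * t%:C%C) ('i%C * u * t%:C%C) nk nz1.
  rewrite !T1 !TE => e1 e2 e3 e4.
  have sq l : Re (y l * (u * t%:C%C) ^+ 2) = Re (y l * u ^+ 2) * t ^+ 2.
    have -> : y l * (u * t%:C%C) ^+ 2 = y l * u ^+ 2 * (t ^+ 2)%:C%C by rewrite rmorphXn; ring.
    by case: (y l * u ^+ 2) => ? ?; simpc => /=; ring.
  have sqi l : Re (y l * ('i%C * u * t%:C%C) ^+ 2) = - Re (y l * u ^+ 2) * t ^+ 2.
    have -> : y l * ('i%C * u * t%:C%C) ^+ 2 = - (y l * u ^+ 2) * (t ^+ 2)%:C%C.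
      by rewrite !exprMn sqr_i rmorphXn; ring.
    by case: (y l * u ^+ 2) => ? ?; simpc => /=; ring.
  rewrite !sq !sqi in e1 e2 e3 e4.
  have n1 : normc (u * t%:C%C) = normc u * t by rewrite normcM normcR gtr0_norm.
  have n2 : normc ('i%C * u * t%:C%C) = normc u * t by rewrite -mulrA normcM normci mul1r n1.
  have := Rex j (u * t%:C%C); have := Rex k (u * t%:C%C); have := Rex j ('i%C * u * t%:C%C).
  have := Rex k ('i%C * u * t%:C%C); rewrite n1 n2 !ler_norml.
  move=> /andP[f1 f2] /andP[f3 f4] /andP[f5 f6] /andP[f7 f8].
  have tt : 0 <= t ^+ 2 by rewrite sqr_ge0.
  rewrite -[X in _ * X](ger0_norm tt) -normrM ler_norml; apply/andP; split; lra.
have y0 k : nz k -> y k = 0.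
  move=> nk; have := Rey k 1 nk; have := Rey k (1 +i* 1)%C nk.
  case: (y k) => c1 c2; rewrite !expr2; simpc => /= r1 r2.
  by congr (_ +i* _)%C; lra.
have Rex0 k u : nz k -> Re (x k * u) = 0.
  (* With the quadratic parts gone, opposite points are compared; taking them at distance [t^2] fits
     the shape of [linear_bound_eq0]. *)
  move=> nk; apply: (@linear_bound_eq0 _ 0 (2 * L)) => t t1.
  have t0 : 0 < t by lra.
  have [j [nj]] := pair k j1 (u * (t ^+ 2)%:C%C) (- u * (t ^+ 2)%:C%C) nk nz1.
  rewrite !T1 !TE (y0 k nk) (y0 j nj) !mul0r !raddf0 !addr0 ?add0r.
  have lin l w : Re (x l * (w * (t ^+ 2)%:C%C)) = Re (x l * w) * t ^+ 2.
    by rewrite mulrA; case: (x l * w) => ? ?; simpc => /=; ring.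
  have linN l : Re (x l * - u) = - Re (x l * u) by rewrite mulrN raddfN.
  rewrite !lin !linN => e1 e2 e3 e4.
  have tt : 0 <= t ^+ 2 by rewrite sqr_ge0.
  rewrite -[X in _ * X](ger0_norm tt) -normrM ler_norml; apply/andP; split; lra.
have x0 k : nz k -> x k = 0.
  move=> nk; have := Rex0 k 1 nk; have := Rex0 k 'i%C nk; rewrite mulr1.
  by case: (x k) => c1 c2; simpc => /= r1 r2; congr (_ +i* _)%C; lra.
move=> z; apply/eqP; rewrite -subr_eq0; apply/eqP.
apply: (@gen_pos_pairing0 _ _ _ a [set: 'I_q]) => //.
  by rewrite cardsT card_ord addn1 ltnS mul2n -addnn leq_addr.
move=> j _; rewrite pairingB; have [j0|nj] := om j; first by rewrite !j0 subrr.
have [_ pj _] := cxy j nj.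
by rewrite !pj (x0 j nj) (y0 j nj) !mul0r subrr.
Qed.

End OmittingCurve.

(** * Rescaling *)

Section DiagonalLimit.
Context {R : realType}.
Local Notation C := R[i].
Implicit Types (z w : C) (r d e : R).

Lemma open_disc z r : open (disc z r : set C^o).
Proof.
rewrite openE => w wr; apply/cnbhsP; exists (r - normc (w - z)); first by rewrite subr_gt0.
by apply: disc_sub; rewrite addrC subrK.
Qed.

(** The point [u n] is chosen in [P n] within [1 / (n+1)] of the infimum of the distances to [z], so
    that a single sequence serves all radii [d]. *)
Lemma diagonal_points (P : nat -> C -> Prop) z :
  (forall d, 0 < d -> omega [set n | exists2 w, disc z d w & P n w]) ->
  exists2 u : nat -> C, slim u z & omega [set n | P n (u n)].
Proof.
move=> H; pose S n := [set normc (w - z) | w in [set w | P n w]].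
have ex n : exists u, (exists w, P n w) -> P n u /\ normc (u - z) < inf (S n) + n.+1%:R^-1.
  have [[w Pw]|nP] := pselect (exists w, P n w); last by exists 0.
  have hS : has_inf (S n).
    by split; [exists (normc (w - z)), w|exists 0 => _ [v _ <-]; exact: normc_ge0].
  have e0 : 0 < n.+1%:R^-1 :> R by rewrite invr_gt0.
  by have [_ [u Pu <-] ul] := inf_adherent e0 hS; exists u.
pose u n := projT1 (cid (ex n)).
have uP n : (exists w, P n w) -> P n (u n) /\ normc (u n - z) < inf (S n) + n.+1%:R^-1.
  by rewrite /u; case: cid.
exists u; last first.
  by apply: filterS (H 1 ltr01) => n /= [w _ Pw]; have [] := uP n (ex_intro _ w Pw).
move=> e e0; have e2 : 0 < e / 2 by rewrite divr_gt0.
apply: filterS (filterI (H _ e2) (omega_small e2)) => n /= [[w wd Pw] ne].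
have [_ ul] := uP n (ex_intro _ w Pw).
have : inf (S n) <= normc (w - z).
  by apply: ge_inf; [exists 0 => _ [v _ <-]; exact: normc_ge0|exists w].
by move: wd; rewrite /disc /=; move: (n.+1%:R^-1) ne ul => x; lra.
Qed.

Lemma ucvg_diagonal (f : nat -> C -> C) g (u : nat -> C) z r : 0 < r ->
  ucvg (disc z r) f g -> ccont g z -> slim u z -> slim (fun n => f n (u n)) (g z).
Proof.
move=> r0 fg cg uz e e0; have e2 : 0 < e / 2 by rewrite divr_gt0.
have [d d0 dP] := cg _ e2.
apply: filterS (filterI (fg _ e2) (filterI (uz _ d0) (uz _ r0))) => n /= [h1 [h2 h3]].
have := dP _ h2; rewrite [z + _]addrC subrK => h4; have := h1 _ h3 => h5.
by have := normc_triangle (f n (u n)) (g (u n)) (g z); lra.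
Qed.

Lemma slim_ge (u : nat -> C) l (c : R) : slim u l -> omega [set n | c <= normc (u n)] -> c <= normc l.
Proof.
move=> ul uc; apply: le_of_all_eps => e e0.
have [n [/= h1 h2]] := omega_neq0 (filterI (ul e e0) uc).
by have := ler_normc_sub (u n) l; lra.
Qed.

End DiagonalLimit.

(** * Local alternatives for the limit curve *)

Section RescaledLimit.
Context {R : realType} {N : nat}.
Local Notation C := R[i].
Local Notation vec := 'rV[C]_N.+1.
Local Notation q := (2 * N + 1)%N.
Implicit Types (z w : C) (d e : R) (k : 'I_N.+1) (l j : 'I_q).

(** When [F] arises by substituting p + s z, this is [s] times the derived vector of the original
    map. The derivative brings one factor [s] into the Wronskians, so the coordinate 0 gets it
    explicitly, and it disappears in the limit. *)
Definition rescaled_derived_vec (s : R) (F : C -> vec) z : vec :=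
  \row_k (if k == 0 then s%:C%C * F z 0 0 ^+ 2 else wronskian (coord F 0) (coord F k) z).

(** Constancy as a map to projective space: all two by two minors formed with the value at [z]
    vanish, whatever scalars [G] carries. *)
Definition locally_constant (G : C -> vec) z :=
  exists2 d : R, 0 < d & forall w, disc z d w -> forall k k', G w 0 k * G z 0 k' = G w 0 k' * G z 0 k.

Variables (F : nat -> C -> vec) (A : nat -> 'I_q -> C -> vec) (rho : nat -> R)
  (kap : 'I_q -> 'I_N.+1) (a : 'I_q -> vec) (B delta : R) (G : C -> vec) (z1 : C) (r : R) (i : 'I_N.+1).

Local Notation V n := (rescaled_derived_vec (rho n) (F n)).

Hypotheses (r0 : 0 < r) (B0 : 0 < B) (delta0 : 0 < delta) (ga : gen_pos a).
Hypothesis rho0 : forall n, 0 < rho n.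
Hypothesis rho_lim : forall e, 0 < e -> omega [set n | rho n < e].
Hypothesis Gi0 : forall z, disc z1 r z -> G z 0 i != 0.
Hypothesis hF : omega [set n | (forall k, holomorphic_on (disc z1 r) (coord (F n) k)) /\
  forall z, disc z1 r z -> F n z 0 i != 0 /\ forall k, normc (F n z 0 k) <= 2 * normc (F n z 0 i)].
Hypothesis hcv : forall k, holomorphic_on (disc z1 r) (fun z => G z 0 k / G z 0 i) /\
  ucvg (disc z1 r) (fun n z => F n z 0 k / F n z 0 i) (fun z => G z 0 k / G z 0 i).
Hypothesis hA : omega [set n | forall l, (forall k, holomorphic_on (disc z1 r) (coord (A n l) k)) /\
  forall z, disc z1 r z -> A n l z 0 (kap l) != 0 /\
    forall k, normc (A n l z 0 k) <= B * normc (A n l z 0 (kap l))].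
Hypothesis hAcv : forall l k, ucvg (disc z1 r) (fun n z => A n l z 0 k / A n l z 0 (kap l)) (fun=> a l 0 k).
Hypothesis share_derived : omega [set n | forall z, disc z1 r z -> forall l, F n z 0 0 != 0 ->
  pairing (V n z) (A n l z) = 0 -> pairing (F n z) (A n l z) = 0].
Hypothesis share_away : omega [set n | forall z, disc z1 r z -> forall l,
  pairing (F n z) (A n l z) = 0 -> delta * vnorm (F n z) <= normc (F n z 0 0)].
Hypothesis share_bounded : omega [set n | forall z, disc z1 r z -> forall l,
  pairing (F n z) (A n l z) = 0 -> forall l',
  normc (pairing (V n z) (hnormalize (A n l' z))) <= rho n * delta^-1 * normc (F n z 0 0) ^+ 2].

Let psi k z := G z 0 k / G z 0 i.
Let psin n k z := F n z 0 k / F n z 0 i.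
Let bn n l k z := A n l z 0 k / A n l z 0 (kap l).

Lemma psi_le2 k z : disc z1 r z -> normc (psi k z) <= 2.
Proof.
move=> zr; apply: (slim_le (ucvg_slim (hcv k).2 zr)); apply: filterS hF => n /= [_ h].
by have [h1 h2] := h z zr; rewrite normc_div ler_pdivrMr ?normc_gt0.
Qed.

Lemma holomorphic_ratio (f g : C -> C) (D : set C) : holomorphic_on D f -> holomorphic_on D g ->
  (forall z, D z -> g z != 0) -> holomorphic_on D (fun z => f z / g z).
Proof.
move=> hf hg g0 z Dz; apply/cdiffableP; apply: cdiffableM; first by apply/cdiffableP; exact: hf.
by apply: cdiffableV; [exact: g0|apply/cdiffableP; exact: hg].
Qed.

Lemma pairing_ratio n l z : disc z1 r z -> F n z 0 i != 0 -> A n l z 0 (kap l) != 0 ->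
  \sum_k bn n l k z * psin n k z = pairing (F n z) (A n l z) / (A n l z 0 (kap l) * F n z 0 i).
Proof.
move=> zr F0 A0; rewrite /pairing mulr_suml; apply: eq_bigr => k _.
by rewrite /bn /psin; field; rewrite F0 A0.
Qed.

Lemma limit_pairing l z : pairing (\row_k psi k z) (a l) = pairing (G z) (a l) / G z 0 i.
Proof. by rewrite /pairing mulr_suml; apply: eq_bigr => k _; rewrite mxE mulrA. Qed.

Let abound : {M : R | 0 < M & forall l k, normc (a l 0 k) <= M}.
Proof.
apply: cid2; exists (1 + \sum_l \sum_k normc (a l 0 k)) => [|l k].
  by rewrite ltr_wpDr // sumr_ge0 // => l _; apply: sumr_ge0 => k _; exact: normc_ge0.
apply: le_trans (ler_sum_one (u := fun k => normc (a l 0 k)) k _) _ => [m|]; first exact: normc_ge0.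
apply: le_trans (ler_sum_one (u := fun l => \sum_k normc (a l 0 k)) l _) _ => [m|].
  by apply: sumr_ge0 => m' _; exact: normc_ge0.
by rewrite lerDr.
Qed.

Lemma ucvg_pairing l (f : nat -> 'I_N.+1 -> C -> C) (g : 'I_N.+1 -> C -> C) s M : s <= r ->
  (forall k z, disc z1 s z -> normc (g k z) <= M) ->
  (forall k, ucvg (disc z1 s) (fun n => f n k) (g k)) ->
  ucvg (disc z1 s) (fun n z => \sum_k bn n l k z * f n k z) (fun z => \sum_k a l 0 k * g k z).
Proof.
move=> sr gM fg; have [M' M'0 aM] := abound.
apply: ucvg_sum => k; apply: (@ucvgM _ _ _ _ _ _ (Num.max M M')).
- by move=> z _; rewrite le_max aM orbT.
- by move=> z zs; rewrite le_max gM.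
- by apply: ucvg_sub (hAcv l k); exact: disc_le.
- exact: fg.
Qed.

(** Hurwitz's theorem is applied to the pairings of the ratios, which are holomorphic and converge;
    clearing the nonvanishing denominators turns their zeros into points of [F n] on [A n l]. *)
Lemma rescaled_common_zero l : pairing (G z1) (a l) = 0 ->
  ~ vanish (fun z => pairing (G z) (a l) / G z 0 i) z1 ->
  exists2 u : nat -> C, slim u z1 &
    omega [set n | disc z1 r (u n) /\ pairing (F n (u n)) (A n l (u n)) = 0].
Proof.
move=> g0 nv; pose w z := \sum_k a l 0 k * psi k z.
have wE z : w z = pairing (G z) (a l) / G z 0 i.
  by rewrite -limit_pairing; apply: eq_bigr => k _; rewrite mxE.
have wcv : ucvg (disc z1 r) (fun n z => \sum_k bn n l k z * psin n k z) w.
  apply: (@ucvg_pairing _ _ _ _ 2) => // k; first exact: psi_le2.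
  exact: (hcv k).2.
have hw : omega [set n | holomorphic_on (disc z1 r) (fun z => \sum_k bn n l k z * psin n k z)].
  apply: filterS (filterI hF hA) => n /= [[h1 h2] /(_ l)[h3 h4]] z zr.
  apply/cdiffableP; apply: cdiffable_sum => k; apply: cdiffableM; apply/cdiffableP.
    by apply: (holomorphic_ratio (h3 k) (h3 (kap l))) zr => v /h4[].
  by apply: (holomorphic_ratio (h1 k) (h1 i)) zr => v /h2[].
have w0 : w z1 = 0 by rewrite wE g0 mul0r.
have nvw : ~ vanish w z1.
  by move=> [d d0 H]; apply: nv; exists d => // z /H; rewrite wE.
have [u uz uP] := @diagonal_points _ (fun n z => \sum_k bn n l k z * psin n k z = 0) z1
  (fun d (pd : 0 < d) => hurwitz r0 pd hw wcv w0 nvw).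
exists u => //; apply: filterS (filterI (filterI uP (uz _ r0)) (filterI hF hA)) => n /=.
move=> [[u0 ur] [[_ h2] /(_ l)[_ h4]]]; split => //.
have [Fi _] := h2 _ ur; have [Ak _] := h4 _ ur.
move: u0; rewrite pairing_ratio // => /eqP; rewrite mulf_eq0 invr_eq0 mulf_eq0 (negbTE Fi) (negbTE Ak) !orbF.
by move=> /eqP.
Qed.

(* Hurwitz's theorem gives points near [z1] where [F n] lies on [A n l]; there
   [share_bounded] makes the derivative of [G / G_0] orthogonal to every [a l']
   in the limit. A second application, to the pairings of this derivative,
   shows with [share_derived] that those which are not identically 0 come from
   indices [l'] with [G z1] on [a l'], of which there are at most N. *)
Lemma rescaled_dichotomy l : pairing (G z1) (a l) = 0 ->
  vanish (fun z => pairing (G z) (a l) / G z 0 i) z1 \/ locally_constant G z1.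
Proof.
move=> g0; have [v|nv] := pselect (vanish (fun z => pairing (G z) (a l) / G z 0 i) z1); [by left|right].
have [u uz uP] := rescaled_common_zero g0 nv.
have z1r : disc z1 r z1 by exact: disc0.
have cpsi k : ccont (psi k) z1 by exact: holomorphic_ccont (hcv k).1 z1r.
(* Condition (ii) passes to the limit along the points [u n], so [G_0] does not vanish at [z1] and
   the affine coordinates [x k] make sense near it. *)
have psi0 : delta <= normc (psi 0 z1).
  apply: (slim_ge (ucvg_diagonal r0 (hcv 0).2 (cpsi 0) uz)).
  apply: filterS (filterI (filterI uP hF) share_away) => n /= [[[ur u0] [_ h2]] h3].
  have [Fi _] := h2 _ ur; rewrite normc_div ler_pdivlMr ?normc_gt0 //.
  apply: le_trans (h3 _ ur l u0); rewrite ler_wpM2l ?(ltW delta0) //.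
  rewrite -(@ler_pXn2r _ 2%N) ?nnegrE ?normc_ge0 ?sqrtr_ge0 // vnorm_sqr; exact: nsq_ge.
have d2 : 0 < delta / 2 by rewrite divr_gt0.
have [d d0 dP] := cpsi 0 _ d2.
pose s := Num.min d r; have s0 : 0 < s by rewrite lt_min d0.
have [sd sr] : s <= d /\ s <= r by rewrite !ge_min !lexx orbT.
have sub_sr : disc z1 s `<=` disc z1 r by exact: disc_le.
have psib z : disc z1 s z -> delta / 2 <= normc (psi 0 z).
  move=> zs; have := dP (z - z1) (lt_le_trans zs sd); rewrite [z1 + _]addrC subrK => h.
  by have := ler_normc_sub (psi 0 z1) (psi 0 z); rewrite (normcBC (psi 0 z1)); lra.
pose x k z := psi k z * (psi 0 z)^-1; pose xn n k z := psin n k z * (psin n 0 z)^-1.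
have xcv k : ucvg (disc z1 s) (fun n => xn n k) (x k).
  apply: (@ucvgM _ _ _ _ _ _ (Num.max 2 (2 / delta))).
  - by move=> z /sub_sr zr; rewrite le_max psi_le2.
  - move=> z zs; rewrite le_max; apply/orP; right; have := psib z zs => h.
    by rewrite normcV -[2 / delta]invf_div lef_pV2 ?posrE //; lra.
  - by apply: ucvg_sub (hcv k).2.
  by apply: (ucvgV d2 psib); apply: ucvg_sub (hcv 0).2.
have F00 : omega [set n | forall z, disc z1 s z -> F n z 0 0 != 0].
  have d4 : 0 < delta / 4 by rewrite divr_gt0.
  apply: filterS (filterI hF ((hcv 0).2 _ d4)) => n /= [[_ h2] h3] z zs.
  have zr := sub_sr z zs; have := h3 z zr; have := psib z zs; rewrite /psi => h4 h5.
  apply/eqP => F0; move: h4 h5; rewrite F0 mul0r sub0r normcN => h4 h5.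
  have := le_lt_trans h4 h5; rewrite ltNge => /negP; apply; lra.
have xnE n k z : F n z 0 i != 0 -> F n z 0 0 != 0 -> xn n k z = F n z 0 k / F n z 0 0.
  by move=> Fi F0; rewrite /xn /psin; field; rewrite Fi F0.
have hxn k : omega [set n | holomorphic_on (disc z1 s) (xn n k)].
  apply: filterS (filterI hF F00) => n /= [[h1 h2] h3].
  have hpsi k' : holomorphic_on (disc z1 s) (psin n k').
    apply: holomorphic_ratio => [|| v /sub_sr/h2[] //]; exact: (holomorphic_sub sub_sr (h1 _)).
  apply: (holomorphic_ratio (hpsi k) (hpsi 0)) => v vs.
  by have [Fi _] := h2 v (sub_sr v vs); rewrite mulf_neq0 ?invr_eq0 ?h3.
have hx k : holomorphic_on (disc z1 s) (x k) by have [] := weierstrass s0 (hxn k) (xcv k).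
have dxcv k : ucvg (disc z1 (s / 2)) (fun n => cderiv (xn n k)) (cderiv (x k)).
  by have [] := weierstrass s0 (hxn k) (xcv k).
have hdx k : holomorphic_on (disc z1 s) (cderiv (x k)).
  by apply: holomorphic_cderiv => //; exact: open_disc.
have [s1 s10 s1P] : exists2 d : R, 0 < d & forall k z, disc z1 d z ->
    normc (cderiv (x k) z) <= normc (cderiv (x k) z1) + 1.
  apply: finite_radius => [k e e' ee H z ze|k]; first by apply: H; exact: disc_le ze.
  by apply: ccont_bounded; exact: holomorphic_ccont (hdx k) (disc0 z1 s0).
pose M := \sum_k (normc (cderiv (x k) z1) + 1).
have dxM k z : disc z1 s1 z -> normc (cderiv (x k) z) <= M.
  move=> /s1P h; apply: le_trans (h k) _.
  apply: (ler_sum_one (u := fun k => normc (cderiv (x k) z1) + 1)) => k'.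
  by rewrite addr_ge0 ?normc_ge0.
pose t := Num.min s1 (s / 2); have t0 : 0 < t by rewrite lt_min s10 divr_gt0.
have [ts1 ts2] : t <= s1 /\ t <= s / 2 by rewrite !ge_min !lexx orbT.
have ts : t <= s by lra.
have tr : t <= r by exact: le_trans ts sr.
have sub_ts : disc z1 t `<=` disc z1 s by exact: disc_le.
have sub_tr : disc z1 t `<=` disc z1 r by exact: disc_le.
(* The normalised pairing of the rescaled derived vector, see [ynE]. Divided by F_0^2 that vector
   has coordinate [rho n] at 0, where the derivative of [xn n 0] contributes nothing. *)
pose yn n l' z := \sum_k bn n l' k z * (cderiv (xn n k) z + (rho n)%:C%C * (k == 0)%:R).
pose y l' z := \sum_k a l' 0 k * cderiv (x k) z.
have ycv l' : ucvg (disc z1 t) (fun n => yn n l') (y l').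
  apply: (@ucvg_pairing _ _ _ _ M) => // k; first by move=> z zt; apply: dxM; exact: disc_le zt.
  move=> e e0; have e2 : 0 < e / 2 by rewrite divr_gt0.
  apply: filterS (filterI (dxcv k _ e2) (rho_lim e2)) => n /= [h1 h2] z zt.
  have := h1 z (disc_le ts2 zt) => h3.
  have h4 : normc ((rho n)%:C%C * (k == 0)%:R) < e / 2.
    case: (k == 0); last by rewrite mulr0 normc0.
    by rewrite mulr1 normcR gtr0_norm.
  rewrite addrAC; apply: le_lt_trans (ler_normcD _ _) _; lra.
have good : omega [set n | forall z, disc z1 t z -> [/\ F n z 0 i != 0, F n z 0 0 != 0,
    forall k, cderiv (xn n k) z = wronskian (coord (F n) 0) (coord (F n) k) z / F n z 0 0 ^+ 2 &
    forall l', A n l' z 0 (kap l') != 0 /\ forall k, normc (A n l' z 0 k) <= B * normc (A n l' z 0 (kap l'))]].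
  apply: filterS (filterI (filterI hF F00) hA) => n /= [[[h1 h2] h3] h4] z zt.
  have zs := sub_ts z zt; have zr := sub_tr z zt; have [Fi _] := h2 z zr.
  split => //; [exact: h3| |by move=> l'; have [_ h5] := h4 l'; exact: h5].
  move=> k; apply: cdiff_cderiv.
  have D k' : cdiff (coord (F n) k') z (cderiv (coord (F n) k') z).
    by apply: derivable_cdiff; exact: h1.
  apply: cdiff_near (cdiff_ratio (h3 z zs) (D k) (D 0)) _.
  exists (s - normc (z - z1)); first by rewrite subr_gt0.
  move=> v vz; have vs : disc z1 s v by apply: disc_sub vz; lra.
  by rewrite xnE ?h3 //; have [] := h2 v (sub_sr v vs).
have ynE : omega [set n | forall z, disc z1 t z -> forall l',
    yn n l' z = pairing (V n z) (A n l' z) / (A n l' z 0 (kap l') * F n z 0 0 ^+ 2)].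
  apply: filterS good => n /= H z zt l'; have [Fi F0 dx Ak] := H z zt; have [Ak0 _] := Ak l'.
  rewrite /yn /pairing mulr_suml; apply: eq_bigr => k _; rewrite dx mxE /bn.
  have [->|k0] := eqVneq k 0; last by rewrite mulr0 addr0; field; rewrite Ak0 F0.
  have -> : wronskian (coord (F n) 0) (coord (F n) 0) z = 0 by rewrite /wronskian mulrC subrr.
  by rewrite mulr1; field; rewrite Ak0 F0.
have cy l' : ccont (y l') z1.
  apply: ccont_sum => k.
  by apply: ccontZ; exact: holomorphic_ccont (hdx k) (disc0 z1 s0).
(* At [u n], (iii) bounds [yn] by [rho n] times [B / delta], where [B] compensates the passage from
   the normalised coefficients to division by the coordinate [kap l']. *)
have y0 l' : y l' z1 = 0.
  apply: eq0_normc; apply/eqP; rewrite eq_le normc_ge0 andbT.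
  apply: le_of_all_eps => e e0; rewrite add0r.
  apply: (slim_le (ucvg_diagonal t0 (ycv l') (cy l') uz)).
  have eB : 0 < e / (B / delta) by rewrite !divr_gt0.
  apply: filterS (filterI (filterI (filterI uP (uz _ t0)) (filterI good ynE))
    (filterI share_bounded (rho_lim eB))) => n /=.
  move=> [[[[ur u0] ut] [H HE]] [h3 h4]]; rewrite (HE _ ut).
  have [Fi F0 _ Ak] := H _ ut; have [Ak0 AkB] := Ak l'.
  have := h3 _ ur l u0 l'.
  have An0 : A n l' (u n) != 0 by apply: contraNneq Ak0 => ->; rewrite mxE.
  have hn0 := hnorm_gt0 An0.
  have -> : pairing (V n (u n)) (hnormalize (A n l' (u n))) =
      ((hnorm (A n l' (u n)))^-1)%:C%C * pairing (V n (u n)) (A n l' (u n)).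
    by rewrite /pairing mulr_sumr; apply: eq_bigr => k _; rewrite mxE mulrA.
  have hB : hnorm (A n l' (u n)) <= B * normc (A n l' (u n) 0 (kap l')).
    by apply/bigmax_leP; split => [|k _]; [rewrite mulr_ge0 ?normc_ge0 // ltW|exact: AkB].
  rewrite normcM normcR gtr0_norm ?invr_gt0 // mulrC ler_pdivrMr // => h5.
  have p1 : 0 < normc (A n l' (u n) 0 (kap l')) by rewrite normc_gt0.
  have p2 : 0 < normc (F n (u n) 0 0) by rewrite normc_gt0.
  rewrite normc_div normcM normcX ler_pdivrMr ?mulr_gt0 ?exprn_gt0 //.
  apply: le_trans h5 _; rewrite ltr_pdivlMr ?divr_gt0 // in h4.
  have p3 : 0 <= rho n * delta^-1 * normc (F n (u n) 0 0) ^+ 2.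
    by rewrite !mulr_ge0 ?invr_ge0 ?normc_ge0 ?(ltW (rho0 n)) ?(ltW delta0).
  apply: le_trans (ler_wpM2l p3 hB) _.
  have -> : rho n * delta^-1 * normc (F n (u n) 0 0) ^+ 2 * (B * normc (A n l' (u n) 0 (kap l'))) =
     rho n * (B / delta) * (normc (A n l' (u n) 0 (kap l')) * normc (F n (u n) 0 0) ^+ 2) by ring.
  by rewrite ler_wpM2r ?(ltW h4) // mulr_ge0 ?normc_ge0 // exprn_ge0 ?normc_ge0.
have hyn l' : omega [set n | holomorphic_on (disc z1 t) (yn n l')].
  have hxns : omega [set n | forall k, holomorphic_on (disc z1 s) (xn n k)]
    by exact: (@filter_forall nat _ (fun k n => holomorphic_on (disc z1 s) (xn n k)) omega _ hxn).
  apply: filterS (filterI hA hxns) => n /= [/(_ l')[h1 h2] h3] z zt; apply/cdiffableP.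
  have zr := sub_tr z zt; have zs := sub_ts z zt.
  apply: cdiffable_sum => k; apply: cdiffableM.
    by apply/cdiffableP; apply: (holomorphic_ratio (h1 k) (h1 (kap l'))) zr => v /h2[].
  apply: cdiffableD; last exact: cdiffable_cst.
  by apply/cdiffableP; apply: (holomorphic_cderiv _ (h3 k)) zs; exact: open_disc.
(* Zeros of [yn n l'] tending to [z1] are points where the derived vector lies on [A n l'], hence
   also [F n] by (i). *)
have xz l' : ~ vanish (y l') z1 -> pairing (\row_k x k z1) (a l') = 0.
  move=> nvy; have [v vz vP] := @diagonal_points _ (fun n z => yn n l' z = 0) z1
    (fun d (pd : 0 < d) => hurwitz t0 pd (hyn l') (ycv l') (y0 l') nvy).
  have cx k : ccont (x k) z1 by exact: holomorphic_ccont (hx k) (disc0 z1 s0).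
  have lim : slim (fun n => \sum_k bn n l' k (v n) * xn n k (v n)) (\sum_k a l' 0 k * x k z1).
    apply: slim_sum => k _; apply: slimM.
      exact: (ucvg_diagonal r0 (hAcv l' k) (ccont_cst _ z1) vz).
    exact: (ucvg_diagonal s0 (xcv k) (cx k) vz).
  have -> : pairing (\row_k x k z1) (a l') = \sum_k a l' 0 k * x k z1.
    by apply: eq_bigr => k _; rewrite mxE.
  apply: (slim_unique lim); apply: slim_near (slim_cst 0) _.
  apply: filterS (filterI (filterI vP (vz _ t0)) (filterI (filterI good ynE) share_derived)) => n /=.
  move=> [[v0 vt] [[H HE] h1]]; have [Fi F0 _ Ak] := H _ vt; have [Ak0 _] := Ak l'.
  have V0 : pairing (V n (v n)) (A n l' (v n)) = 0.
    apply/eqP; move: v0; rewrite (HE _ vt) => /eqP; rewrite mulf_eq0 invr_eq0 mulf_eq0.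
    by rewrite (negbTE Ak0) expf_eq0 (negbTE F0) !orbF.
  have := h1 _ (sub_tr _ vt) l' F0 V0 => P0.
  rewrite (eq_bigr (fun k => A n l' (v n) 0 k * F n (v n) 0 k * (A n l' (v n) 0 (kap l') * F n (v n) 0 0)^-1)).
    by rewrite -mulr_suml -/(pairing _ _) P0 mul0r.
  by move=> k _; rewrite xnE // /bn; field; rewrite Ak0 F0.
pose J : {set 'I_q} := [set l' : 'I_q | `[< vanish (y l') z1 >]]%SET.
have x0 : \row_k x k z1 != 0.
  apply/eqP => /rowP/(_ 0); rewrite !mxE /x divff => [/eqP|]; first by rewrite oner_eq0.
  by rewrite -normc_gt0; lra.
(* Otherwise the vector [x z1], whose coordinate 0 is 1, would lie on more than N of the
   hyperplanes. So the derivative of [x] is orthogonal to N+1 of the [a l'] on a common disc, and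
   vanishes there. *)
have NJ : (N < #|J|)%N.
  rewrite ltnNge; apply/negP => small; apply/negP: x0; apply/negPn/eqP.
  apply: (gen_pos_pairing0 (J := ~: J) ga) => [|l']; last by rewrite !inE => /asboolP; exact: xz.
  have := cardsC J; rewrite card_ord => cE.
  by rewrite -(ltn_add2l #|J|) cE (leq_ltn_trans (leq_add small (leqnn N))) // mul2n addn1 addnn.
have [d1 d10 d1P] : exists2 d : R, 0 < d & forall l', l' \in J -> forall z, disc z1 d z -> y l' z = 0.
  apply: (@finite_radius _ _ (fun l' d => l' \in J -> forall z, disc z1 d z -> y l' z = 0)).
    by move=> l' e e' ee H lJ z ze; apply: (H lJ); exact: disc_le ze.
  move=> l'; have [|nJ] := boolP (l' \in J); last by exists 1.
  by rewrite inE => /asboolP[e e0 eP]; exists e.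
pose m := Num.min d1 s; have m0 : 0 < m by rewrite lt_min d10.
have [md ms] : m <= d1 /\ m <= s by split; rewrite ge_min lexx ?orbT.
have dx0 k z : disc z1 m z -> cdiff (x k) z 0.
  move=> zm; have zs : disc z1 s z by exact: disc_le zm.
  have : \row_k cderiv (x k) z = 0.
    apply: (gen_pos_pairing0 ga NJ) => l' lJ.
    rewrite -[RHS](d1P l' lJ z (disc_le md zm)); apply: eq_bigr => k' _.
    by rewrite mxE.
  move=> /rowP/(_ k); rewrite !mxE => dk0.
  by have := derivable_cdiff (hx k z zs); rewrite dk0.
exists m => // w wm k k'.
have wr : disc z1 r w by apply: sub_sr; exact: disc_le wm.
have xE v k0 : disc z1 s v -> G v 0 k0 = x k0 v * G v 0 0.
  move=> vs; have Gi := Gi0 (sub_sr v vs); have := psib v vs; rewrite /x /psi => pb.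
  have G00 : G v 0 0 != 0.
    by apply: contraTneq pb => ->; rewrite mul0r normc0 -ltNge.
  by field; rewrite Gi G00.
have zs1 := disc0 z1 s0; have ws : disc z1 s w by exact: disc_le wm.
rewrite (xE w k ws) (xE w k' ws) (xE z1 k zs1) (xE z1 k' zs1).
rewrite (constant_of_cderiv0 (dx0 k) wm) (constant_of_cderiv0 (dx0 k') wm); ring.
Qed.

End RescaledLimit.

(** * Invariance and limits of the spherical derivative *)

Section SphericalLimit.
Context {R : realType} {N : nat}.
Local Notation C := R[i].
Local Notation vec := 'rV[C]_N.+1.
Implicit Types (z w : C) (r d e : R) (k l i : 'I_N.+1) (F G : C -> vec).

Lemma cdiffable_near (f g : C -> C) z d : 0 < d -> cdiffable f z ->
  (forall w, disc z d w -> f w = g w) -> cdiffable g z.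
Proof. by move=> d0 [x fx] H; exists x; apply: cdiff_near fx _; exists d. Qed.

Lemma slim_normc (u : nat -> C) (l : C) : slim u l -> slim (fun n => (normc (u n))%:C%C) (normc l)%:C%C.
Proof.
move=> ul e e0; apply: filterS (ul e e0) => n /= h; rewrite -rmorphB normcR.
by apply: le_lt_trans h; rewrite ler_norml lerNl opprB ler_normc_sub normcBC ler_normc_sub.
Qed.

Lemma slimV (u : nat -> C) (l : C) : l != 0 -> slim u l -> slim (fun n => (u n)^-1) l^-1.
Proof.
move=> l0 ul; have l1 : 0 < normc l by rewrite normc_gt0.
have : ucvg [set 0] (fun n _ => u n) (fun=> l).
  by move=> e e0; apply: filterS (ul e e0) => n /= h z _.
move=> /(ucvgV (A := [set 0]) l1) H; have := H (fun _ _ => lexx _).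
by move=> /ucvg_slim/(_ (erefl : [set 0] 0)).
Qed.

Lemma slimR_sum (I : finType) (u : I -> nat -> R) (l : I -> R) :
  (forall j : I, slim (fun n => (u j n)%:C%C) (l j)%:C%C) ->
  slim (fun n => (\sum_(j : I) u j n)%:C%C) (\sum_(j : I) l j)%:C%C.
Proof.
move=> H; rewrite rmorph_sum.
have : slim (fun n => \sum_(j : I) (u j n)%:C%C) (\sum_(j : I) (l j)%:C%C) by apply: slim_sum => i _; exact: H.
by move=> h; apply: (slim_near h); apply: filterS filterT => n _ /=; rewrite rmorph_sum.
Qed.

Lemma wronskian_scale (c f g : C -> C) z : cdiffable c z -> cdiffable f z -> cdiffable g z ->
  wronskian (fun w => c w * f w) (fun w => c w * g w) z = c z ^+ 2 * wronskian f g z.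
Proof.
move=> /cdiffableP/derivable_cdiff dc /cdiffableP/derivable_cdiff df /cdiffableP/derivable_cdiff dg.
rewrite /wronskian (cdiff_cderiv (cdiffM dc df)) (cdiff_cderiv (cdiffM dc dg)).
by move: (cderiv c z) (cderiv f z) (cderiv g z) (c z) (f z) (g z) => c' f' g' x y t; ring.
Qed.

Lemma wronskian_near (f g f1 g1 : C -> C) z d : 0 < d -> cdiffable f z -> cdiffable g z ->
  (forall w, disc z d w -> f w = f1 w) -> (forall w, disc z d w -> g w = g1 w) ->
  wronskian f g z = wronskian f1 g1 z.
Proof.
move=> d0 /cdiffableP/derivable_cdiff df /cdiffableP/derivable_cdiff dg ff gg.
rewrite /wronskian (ff z (disc0 z d0)) (gg z (disc0 z d0)).
rewrite (cdiff_cderiv (cdiff_near df (ex_intro2 _ _ d d0 ff))).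
by rewrite (cdiff_cderiv (cdiff_near dg (ex_intro2 _ _ d d0 gg))).
Qed.

(** Since W(cf, cg) = c^2 W(f, g), numerator and denominator both acquire the factor |c|^2. *)
Lemma sph_scale (c : C -> C) F F1 z d : 0 < d -> c z != 0 -> cdiffable c z ->
  (forall k, cdiffable (coord F k) z) -> (forall w, disc z d w -> F1 w = c w *: F w) ->
  sph F1 z = sph F z.
Proof.
move=> d0 c0 dc dF FE.
have WE k l : wronskian (coord F1 k) (coord F1 l) z = c z ^+ 2 * wronskian (coord F k) (coord F l) z.
  rewrite -wronskian_scale //; apply/esym; apply: (wronskian_near d0); try exact: cdiffableM.
  - by move=> w /FE; rewrite /coord => ->; rewrite mxE.
  - by move=> w /FE; rewrite /coord => ->; rewrite mxE.
have c2 : normc (c z) ^+ 2 != 0 by rewrite expf_eq0 /= gt_eqF ?normc_gt0.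
rewrite /sph (eq_bigr (fun k => normc (c z) ^+ 2 * \sum_l normc (wronskian (coord F k) (coord F l) z))).
  rewrite -mulr_sumr [X in _ / X](eq_bigr (fun k => normc (c z) ^+ 2 * normc (F z 0 k) ^+ 2)) => [|k _].
    by rewrite -mulr_sumr invfM mulrACA divff // mul1r.
  by rewrite (FE z (disc0 z d0)) mxE normcM exprMn.
by move=> k _; rewrite mulr_sumr; apply: eq_bigr => l _; rewrite WE normcM normcX.
Qed.

(** The vectors [F n] need not converge, but after division by the coordinate [i], which leaves the
    spherical derivative unchanged, their coordinates and derivatives do. *)
Lemma sph_limit (F : nat -> C -> vec) G z r i : 0 < r ->
  omega [set n | (forall k, holomorphic_on (disc z r) (coord (F n) k)) /\
    forall w, disc z r w -> F n w 0 i != 0] ->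
  (forall k, ucvg (disc z r) (fun n w => F n w 0 k / F n w 0 i) (fun w => G w 0 k / G w 0 i)) ->
  G z 0 i != 0 ->
  slim (fun n => (sph (F n) z)%:C%C) (sph (fun w => (G w 0 i)^-1 *: G w) z)%:C%C.
Proof.
move=> r0 hF cv Gi; have zr := disc0 z r0.
pose Fi n w := (F n w 0 i)^-1 *: F n w; pose Gi' w := (G w 0 i)^-1 *: G w.
have hFi : omega [set n | forall k, holomorphic_on (disc z r) (coord (Fi n) k)].
  apply: filterS hF => n /= [h1 h2] k w wr; apply/cdiffableP.
  apply: (cdiffable_near ltr01 (f := fun w => coord (F n) k w * (F n w 0 i)^-1)).
    apply: cdiffableM; first by apply/cdiffableP; exact: h1.
    by apply: cdiffableV; [exact: h2|apply/cdiffableP; exact: h1].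
  by move=> v _; rewrite /coord /Fi mxE mulrC.
have cvi k : ucvg (disc z r) (fun n => coord (Fi n) k) (coord Gi' k).
  move=> e e0; apply: filterS (cv k e e0) => n /= h w /h.
  by rewrite /coord /Fi /Gi' !mxE ![_^-1 * _]mulrC.
have cvd k : slim (fun n => cderiv (coord (Fi n) k) z) (cderiv (coord Gi' k) z).
  have [|_ h] := weierstrass r0 _ (cvi k); first by apply: filterS hFi => n /= h; exact: h.
  by apply: (ucvg_slim h); apply: disc0; rewrite divr_gt0.
have cvs k : slim (fun n => coord (Fi n) k z) (coord Gi' k z) by exact: ucvg_slim (cvi k) zr.
have W k l : slim (fun n => wronskian (coord (Fi n) k) (coord (Fi n) l) z)
    (wronskian (coord Gi' k) (coord Gi' l) z).
  by apply: slimB; apply: slimM.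
have den : slim (fun n => (\sum_k normc (Fi n z 0 k) ^+ 2)%:C%C) (\sum_k normc (Gi' z 0 k) ^+ 2)%:C%C.
  apply: slimR_sum => k; rewrite rmorphXn.
  have := slimM (slim_normc (cvs k)) (slim_normc (cvs k)) => h; apply: (slim_near h).
  by apply: filterS filterT => n _ /=; rewrite rmorphXn.
have num : slim (fun n => (\sum_k \sum_l normc (wronskian (coord (Fi n) k) (coord (Fi n) l) z))%:C%C)
    (\sum_k \sum_l normc (wronskian (coord Gi' k) (coord Gi' l) z))%:C%C.
  by apply: slimR_sum => k; apply: slimR_sum => l; apply: slim_normc; exact: W.
have G0 : (\sum_k normc (Gi' z 0 k) ^+ 2)%:C%C != 0.
  rewrite (fmorph_eq0 (real_complex R)) gt_eqF //; apply: (@sum_sqr_gt0 _ _ Gi').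
  by apply/eqP => /rowP/(_ i); rewrite !mxE mulVf // => /eqP; rewrite oner_eq0.
have := slimM num (slimV G0 den); rewrite -fmorphV -rmorphM => H.
apply: slim_near H _; apply: filterS hF => n /= [h1 h2].
rewrite -fmorphV -rmorphM /=; congr (_ %:C%C).
have d k : cdiffable (coord (F n) k) z by apply/cdiffableP; exact: h1.
apply: (sph_scale (c := fun w => (F n w 0 i)^-1) r0) => //; first by rewrite invr_eq0 h2.
by apply: cdiffableV; [exact: h2|exact: d].
Qed.

End SphericalLimit.

(** * Rescaled limits are constant *)

Section LimitCurve.
Context {R : realType} {N : nat}.
Local Notation C := R[i].
Local Notation vec := 'rV[C]_N.+1.
Local Notation q := (2 * N + 1)%N.
Implicit Types (z w : C) (d e : R) (k i : 'I_N.+1) (l j : 'I_q).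

Variables (F : nat -> C -> vec) (A : nat -> 'I_q -> C -> vec) (rho : nat -> R)
  (kap : 'I_q -> 'I_N.+1) (a : 'I_q -> vec) (B delta : R).

Local Notation V n := (rescaled_derived_vec (rho n) (F n)).

Hypotheses (B0 : 0 < B) (delta0 : 0 < delta) (ga : gen_pos a).
Hypothesis rho0 : forall n, 0 < rho n.
Hypothesis rho_lim : forall e, 0 < e -> omega [set n | rho n < e].
Hypothesis hF : forall L : R, omega [set n | (forall k, holomorphic_on (disc 0 L) (coord (F n) k)) /\
  forall z, disc 0 L z -> F n z != 0 /\ sph (F n) z <= 2].
Hypothesis hA : forall L : R, omega [set n | forall l, (forall k, holomorphic_on (disc 0 L) (coord (A n l) k)) /\
  forall z, disc 0 L z -> A n l z 0 (kap l) != 0 /\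
    forall k, normc (A n l z 0 k) <= B * normc (A n l z 0 (kap l))].
Hypothesis hAcv : forall (L : R) l k,
  ucvg (disc 0 L) (fun n z => A n l z 0 k / A n l z 0 (kap l)) (fun=> a l 0 k).
Hypothesis share_derived : forall L : R, omega [set n | forall z, disc 0 L z -> forall l, F n z 0 0 != 0 ->
  pairing (V n z) (A n l z) = 0 -> pairing (F n z) (A n l z) = 0].
Hypothesis share_away : forall L : R, omega [set n | forall z, disc 0 L z -> forall l,
  pairing (F n z) (A n l z) = 0 -> delta * vnorm (F n z) <= normc (F n z 0 0)].
Hypothesis share_bounded : forall L : R, omega [set n | forall z, disc 0 L z -> forall l,
  pairing (F n z) (A n l z) = 0 -> forall l',
  normc (pairing (V n z) (hnormalize (A n l' z))) <= rho n * delta^-1 * normc (F n z 0 0) ^+ 2].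

(** This is the conclusion that contradicts the normalisation of the rescaled maps at 0: whichever
    alternative holds, the limit curve is locally constant at some point, hence at 0. *)
Lemma rescaled_limit_degenerate : slim (fun n => (sph (F n) 0)%:C%C) 0.
Proof.
have [|G GP] := @marty _ _ setT F openT.
  move=> b _; exists 1, 2; split=> //; apply: filterS (hF (normc b + 1)) => n /= [h1 h2].
  have sub : disc b 1 `<=` disc 0 (normc b + 1) by apply: disc_sub; rewrite subr0.
  split=> [k|z /sub]; [exact: holomorphic_sub sub (h1 k)|exact: h2].
have G0 z : G z != 0.
  have [r [i [r0 _ Gi _ _]]] := GP z I.
  by apply/eqP => Gz; have := Gi z (disc0 z r0); rewrite Gz mxE eqxx.
have dich z l : pairing (G z) (a l) = 0 -> vanish (fun w => pairing (G w) (a l)) z \/ locally_constant G z.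
  move=> Pz; have [r [i [r0 _ Gi hFi hcv]]] := GP z I.
  have sub : disc z r `<=` disc 0 (normc z + r) by apply: disc_sub; rewrite subr0.
  have [|||||v|lc] := @rescaled_dichotomy _ _ F A rho kap a B delta G z r i r0 B0 delta0 ga rho0
    rho_lim Gi hFi hcv _ _ _ _ _ l Pz; last by right.
  - apply: filterS (hA (normc z + r)) => n /= h l'; have [h1 h2] := h l'.
    by split=> [k|w /sub]; [exact: holomorphic_sub sub (h1 k)|exact: h2].
  - by move=> l' k; apply: ucvg_sub (hAcv (normc z + r) l' k).
  - by apply: filterS (share_derived (normc z + r)) => n /= h w /sub; exact: h.
  - by apply: filterS (share_away (normc z + r)) => n /= h w /sub; exact: h.
  - by apply: filterS (share_bounded (normc z + r)) => n /= h w /sub; exact: h.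
  left; have [d d0 dP] := v; exists (Num.min d r); first by rewrite lt_min d0.
  move=> w; rewrite /disc /= lt_min => /andP[wd wr]; apply/eqP.
  have /eqP := dP w wd; rewrite mulf_eq0 invr_eq0 => /orP[] // Gw.
  by have := Gi w wr; rewrite Gw.
have lc_open z : locally_constant G z ->
    exists2 d : R, 0 < d & forall w, disc z d w -> locally_constant G w.
  move=> [d d0 dP]; exists d => // w wd; exists (d - normc (w - z)); first by rewrite subr_gt0.
  move=> v vw k k'; have vz : disc z d v by apply: disc_sub vw; lra.
  have [i Gi _] := row_neq0_max (G0 z).
  have cE u m : disc z d u -> G u 0 m = G u 0 i / G z 0 i * G z 0 m.
    by move=> /dP/(_ m i) h; apply: (mulIf Gi); rewrite h; field.
  by rewrite (cE v k vz) (cE v k' vz) (cE w k wd) (cE w k' wd); ring.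
(* The ratios of [G] have zero derivative around points arbitrarily close to [z]; [vanish_closed]
   carries this to a neighbourhood of [z]. *)
have lc_closed z : (forall d, 0 < d -> exists2 w, disc z d w & locally_constant G w) -> locally_constant G z.
  move=> H; have [r [i [r0 _ Gi _ hcv]]] := GP z I.
  have vd k : vanish (cderiv (fun w => G w 0 k / G w 0 i)) z.
    apply: (vanish_closed r0) => [|d d0].
      by apply: holomorphic_cderiv; [exact: open_disc|exact: (hcv k).1].
    have m0 : 0 < Num.min d r by rewrite lt_min d0.
    have [w] := H _ m0; rewrite /disc /= lt_min => /andP[wd wr] lw; exists w => //.
    have [s s0 sP] := lw; exists (Num.min s (r - normc (w - z))); first by rewrite lt_min s0 subr_gt0.
    move=> v; rewrite /disc /= lt_min => /andP[vs vr].
    apply: cdiff_cderiv; apply: cdiff_near (cdiff_cst (G w 0 k / G w 0 i) v) _.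
    exists (Num.min (s - normc (v - w)) (r - normc (w - z) - normc (v - w))).
      by rewrite lt_min !subr_gt0 vs.
    move=> u; rewrite /disc /= lt_min => /andP[us ur].
    have uw := normc_triangle u v w; have uz := normc_triangle u w z.
    have us' : disc w s u by rewrite /disc /=; lra.
    have Gu : G u 0 i != 0 by apply: Gi; rewrite /disc /=; lra.
    have Gw : G w 0 i != 0 by exact: Gi.
    by apply/eqP; rewrite eqr_div //; apply/eqP; rewrite (sP u us' k i) mulrC.
  have [d d0 dP] : exists2 d : R, 0 < d & forall k z', disc z d z' -> cderiv (fun w => G w 0 k / G w 0 i) z' = 0.
    apply: finite_radius => [k e e' ee h w we|k]; last exact: vd.
    by apply: h; exact: disc_le we.
  exists (Num.min d r); first by rewrite lt_min d0.
  have cst k w : disc z (Num.min d r) w -> G w 0 k = G w 0 i * (G z 0 k / G z 0 i).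
    move=> wm; have wr : disc z r w by move: wm; rewrite /disc /= lt_min => /andP[].
    rewrite -(@constant_of_cderiv0 _ z (Num.min d r) (fun w => G w 0 k / G w 0 i) _ w wm).
      by rewrite mulrCA divff ?mulr1 //; exact: Gi.
    move=> v; rewrite /disc /= lt_min => /andP[vd' vr].
    by have := derivable_cdiff ((hcv k).1 v vr); rewrite dP.
  have zz := disc0 z (_ : 0 < Num.min d r).
  move=> w wm k k'; rewrite (cst k w wm) (cst k' w wm).
  by have := Gi z (disc0 z r0) => Gz; field.
have lc_zero : (exists z, locally_constant G z) -> slim (fun n => (sph (F n) 0)%:C%C) 0.
  move=> [z0 lz0]; have [s s0 sP] : locally_constant G 0.
    exact: (@plane_induction _ (fun z => locally_constant G z) z0 lz0 lc_open lc_closed).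
  have [r [i [r0 _ Gi hFi hcv]]] := GP 0 I.
  have Gi0 := Gi 0 (disc0 0 r0).
  have := @sph_limit _ _ F G 0 r i r0 _ (fun k => (hcv k).2) Gi0.
  rewrite /sph [X in X / _]big1 ?mul0r => [|k _].
    by apply; apply: filterS hFi => n /= [h1 h2]; split=> // w /h2[].
  apply: big1 => l _; apply/eqP; rewrite normc_eq0; apply/eqP.
  have d0 m : cderiv (coord (fun w => (G w 0 i)^-1 *: G w) m) 0 = 0.
    apply: cdiff_cderiv; apply: cdiff_near (cdiff_cst (G 0 0 m / G 0 0 i) 0) _.
    exists (Num.min s r); first by rewrite lt_min s0.
    move=> w; rewrite /disc /= lt_min => /andP[ws wr]; rewrite /coord mxE [RHS]mulrC.
    have Gw := Gi w wr.
    by apply/eqP; rewrite eqr_div //; apply/eqP; rewrite (sP w ws m i) mulrC.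
  by rewrite /wronskian !d0 mulr0 mul0r subrr.
have [/lc_zero //|nlc] := pselect (exists z, locally_constant G z).
(* With local constancy excluded, a zero of a pairing is a zero of a whole neighbourhood, and an
   open-closed argument gives the alternative. *)
have alt l : (forall z, pairing (G z) (a l) = 0) \/ (forall z, pairing (G z) (a l) != 0).
  have [[z0 Pz0]|nz] := pselect (exists z, pairing (G z) (a l) = 0); last first.
    by right=> z; apply/eqP => Pz; apply: nz; exists z.
  have van z : pairing (G z) (a l) = 0 -> vanish (fun w => pairing (G w) (a l)) z.
    by move=> /dich[] // lz; case: nlc; exists z.
  left=> z; suff [d d0] : vanish (fun w => pairing (G w) (a l)) z by apply; exact: disc0.
  apply: (plane_induction (van z0 Pz0)) => [w|w H]; first exact: vanish_open.
  have [r [i [r0 _ Gi _ hcv]]] := GP w I.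
  have [d d0 dP] : vanish (fun v => \sum_k a l 0 k * (G v 0 k / G v 0 i)) w.
    apply: (vanish_closed r0) => [v vr|d d0].
      apply/cdiffableP; apply: cdiffable_sum => k; apply: cdiffableM; first exact: cdiffable_cst.
      by apply/cdiffableP; exact: (hcv k).1.
    have [v vd [e e0 eP]] := H d d0; exists v => //; exists e => // u /eP.
    by rewrite /pairing => h; under eq_bigr do rewrite mulrA; rewrite -mulr_suml h mul0r.
  exists (Num.min d r); first by rewrite lt_min d0.
  move=> v; rewrite /disc /= lt_min => /andP[vd vr]; have Gv := Gi v vr.
  have := dP v vd; under eq_bigr do rewrite mulrA; rewrite -mulr_suml => /eqP.
  by rewrite mulf_eq0 invr_eq0 (negbTE Gv) orbF => /eqP.
have [j1 Pj1] : exists j, forall z, pairing (G z) (a j) != 0.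
  apply: contrapT => /forallNP nj; have := G0 0; rewrite (@gen_pos_pairing0 _ _ _ a [set: 'I_q]%SET (G 0)) ?eqxx //.
    by rewrite cardsT card_ord mul2n -addnn addn1 ltnS leq_addr.
  by move=> j _; have [->|/nj] := alt j.
(* This normalisation does not depend on the scalars carried by [G], so the locally holomorphic
   ratios combine to entire coordinates. *)
pose h z := (pairing (G z) (a j1))^-1 *: G z.
have hE z : exists r i, [/\ 0 < r, forall w, disc z r w -> G w 0 i != 0,
    forall k w, disc z r w -> cdiffable (fun v => G v 0 k / G v 0 i) w,
    omega [set n | (forall k, holomorphic_on (disc z r) (coord (F n) k)) /\
      (forall w, disc z r w -> F n w 0 i != 0)] &
    forall k, ucvg (disc z r) (fun n w => F n w 0 k / F n w 0 i) (fun w => G w 0 k / G w 0 i)].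
  have [r [i [r0 _ Gi hFi hcv]]] := GP z I; exists r, i; split=> //.
  - by move=> k w wr; apply/cdiffableP; exact: (hcv k).1.
  - by apply: filterS hFi => n /= [h1 h2]; split=> // w /h2[].
  - by move=> k; exact: (hcv k).2.
have pd z r i : (forall w, disc z r w -> G w 0 i != 0) ->
    (forall k w, disc z r w -> cdiffable (fun v => G v 0 k / G v 0 i) w) ->
    forall w, disc z r w -> cdiffable (fun v => (\sum_k a j1 0 k * (G v 0 k / G v 0 i))^-1) w.
  move=> Gi dG w wr; apply: cdiffableV.
    under eq_bigr do rewrite mulrA.
    by rewrite -mulr_suml mulf_neq0 ?invr_eq0 //; [exact: Pj1|exact: Gi].
  by apply: cdiffable_sum => k; apply: cdiffableM; [exact: cdiffable_cst|exact: dG].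
have hsE z r i : (forall w, disc z r w -> G w 0 i != 0) -> forall w, disc z r w ->
    h w = (\sum_k a j1 0 k * (G w 0 k / G w 0 i))^-1 *: ((G w 0 i)^-1 *: G w).
  move=> Gi w wr; rewrite scalerA; congr (_ *: _); under eq_bigr do rewrite mulrA.
  by rewrite -mulr_suml invfM invrK -mulrA divff ?mulr1 //; exact: Gi.
have dGi z r i k w : (forall k w, disc z r w -> cdiffable (fun v => G v 0 k / G v 0 i) w) ->
    disc z r w -> cdiffable (coord (fun v => (G v 0 i)^-1 *: G v) k) w.
  by move=> dG wr; apply: cdiffable_eq (dG k w wr) => v; rewrite /coord mxE mulrC.
have hh k : holomorphic_on setT (coord h k).
  move=> z _; have [r [i [r0 Gi dG _ _]]] := hE z; apply/cdiffableP.
  have zr := disc0 z r0.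
  apply: (cdiffable_near r0 (cdiffableM (pd _ _ _ Gi dG z zr) (dGi _ _ _ k z dG zr))) => w wr.
  by rewrite /coord (hsE _ _ _ Gi w wr) [RHS]mxE.
have h2 z : h z != 0 /\ sph h z <= 2.
  split; first by rewrite scaler_eq0 invr_eq0 negb_or Pj1 G0.
  have [r [i [r0 Gi dG hFi cv]]] := hE z; have zr := disc0 z r0.
  have -> : sph h z = sph (fun w => (G w 0 i)^-1 *: G w) z.
    apply: (sph_scale r0 _ (pd _ _ _ Gi dG z zr)); last exact: hsE.
      under eq_bigr do rewrite mulrA.
      by rewrite -mulr_suml invr_eq0 mulf_neq0 ?invr_eq0 //; [exact: Pj1|exact: Gi].
    by move=> k; exact: (dGi _ _ _ k z dG zr).
  rewrite -[X in X <= _]ger0_norm ?sph_ge0 // -normcR.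
  apply: (slim_le (sph_limit r0 hFi cv (Gi z zr))).
  apply: filterS (hF (normc z + 1)) => n /= [_ /(_ z)[]]; first by rewrite /disc /= subr0; lra.
  by move=> _; rewrite normcR ger0_norm // sph_ge0.
have pE z l : pairing (h z) (a l) = (pairing (G z) (a j1))^-1 * pairing (G z) (a l) by rewrite pairingZ.
have hc := @omitting_curve_constant _ _ a h 2 j1 ga hh _ h2.
have {}hc z : h z = h 0.
  apply: hc => // [l|w]; last by rewrite pE mulVf.
  have [Pl|Pl] := alt l; [left=> w|right=> w]; first by rewrite pE Pl mulr0.
  by rewrite pE mulf_neq0 ?invr_eq0.
apply: lc_zero; exists 0; exists 1 => // w _ k k'.
have Gw : G w = (pairing (G w) (a j1) / pairing (G 0) (a j1)) *: G 0.
  have := hc w; rewrite /h => /(congr1 (fun v => pairing (G w) (a j1) *: v)).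
  by rewrite !scalerA divff ?scale1r.
by rewrite Gw !mxE; ring.
Qed.

End LimitCurve.

(** * Affine rescaling and Zalcman's choice of centre *)

Section Rescaling.
Context {R : realType} {N : nat}.
Local Notation C := R[i].
Local Notation vec := 'rV[C]_N.+1.
Implicit Types (z w b : C) (r e L : R) (k l i : 'I_N.+1) (F G : C -> vec).

Definition rescale F (p : C) (s : R) z : vec := F (p + s%:C%C * z).

Lemma cdiff_rescale (f : C -> C) (p : C) (s : R) z : cdiffable f (p + s%:C%C * z) ->
  cdiff (fun w => f (p + s%:C%C * w)) z (cderiv f (p + s%:C%C * z) * s%:C%C).
Proof.
move=> /cdiffableP/derivable_cdiff df.
have dg : cdiff (fun w => p + s%:C%C * w) z s%:C%C.
  have := cdiffD (cdiff_cst p z) (cdiffZ s%:C%C (cdiff_id z)).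
  by rewrite add0r mulr1.
exact: (cdiff_comp dg df).
Qed.

Lemma wronskian_rescale F (p : C) (s : R) z k l :
  (forall k, cdiffable (coord F k) (p + s%:C%C * z)) ->
  wronskian (coord (rescale F p s) k) (coord (rescale F p s) l) z =
  s%:C%C * wronskian (coord F k) (coord F l) (p + s%:C%C * z).
Proof.
move=> dF; have E m : cderiv (coord (rescale F p s) m) z = cderiv (coord F m) (p + s%:C%C * z) * s%:C%C.
  exact: (cdiff_cderiv (cdiff_rescale (dF m))).
rewrite /wronskian (E k) (E l).
have CE m : coord (rescale F p s) m z = coord F m (p + s%:C%C * z) by [].
rewrite (CE k) (CE l); set w := p + _.
by move: (coord F k w) (coord F l w) (cderiv (coord F k) w) (cderiv (coord F l) w) s%:C%C => x y t u v; ring.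
Qed.

Lemma sph_rescale F (p : C) (s : R) z : 0 <= s ->
  (forall k, cdiffable (coord F k) (p + s%:C%C * z)) ->
  sph (rescale F p s) z = s * sph F (p + s%:C%C * z).
Proof.
move=> s0 dF; rewrite /sph mulrA mulr_sumr; congr (_ / _); apply: eq_bigr => k _.
rewrite mulr_sumr; apply: eq_bigr => l _.
by rewrite (wronskian_rescale k l dF) normcM normcR ger0_norm.
Qed.

Lemma derived_vec_rescale F (p : C) (s : R) z :
  (forall k, cdiffable (coord F k) (p + s%:C%C * z)) ->
  rescaled_derived_vec s (rescale F p s) z = s%:C%C *: derived_vec F (p + s%:C%C * z).
Proof.
move=> dF; apply/rowP => k; rewrite !mxE; case: eqP => // _.
exact: (wronskian_rescale 0 k dF).
Qed.

Lemma ccont_sph F (D : set C) z : open (D : set C^o) -> (forall k, holomorphic_on D (coord F k)) ->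
  D z -> F z != 0 -> ccont (fun w => (sph F w)%:C%C) z.
Proof.
move=> oD hF Dz F0.
have cF k : ccont (coord F k) z by apply: cdiff_ccont; apply: derivable_cdiff; exact: hF.
have cd k : ccont (cderiv (coord F k)) z.
  by apply: cdiff_ccont; apply: derivable_cdiff; exact: (holomorphic_cderiv oD (hF k)).
have cW k l : ccont (fun w => (normc (wronskian (coord F k) (coord F l) w))%:C%C) z.
  apply: ccont_normc; rewrite /wronskian.
  have c1 := ccontM (cF k) (cd l); have c2 := ccontZ (-1) (ccontM (cd k) (cF l)).
  by apply: ccont_near (ccontD c1 c2) _; exists 1 => // w _; rewrite mulN1r.
have num : ccont (fun w => \sum_k \sum_l (normc (wronskian (coord F k) (coord F l) w))%:C%C) z.
  by apply: ccont_sum => k; apply: ccont_sum => l; exact: cW.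
have den : ccont (fun w => \sum_k ((normc (F w 0 k))%:C%C * (normc (F w 0 k))%:C%C)) z.
  by apply: ccont_sum => k; apply: ccontM; apply: ccont_normc; exact: cF.
have E w : \sum_k ((normc (F w 0 k))%:C%C * (normc (F w 0 k))%:C%C) = (\sum_k normc (F w 0 k) ^+ 2)%:C%C.
  by rewrite rmorph_sum; apply: eq_bigr => k _; rewrite rmorphXn.
have den0 : \sum_k ((normc (F z 0 k))%:C%C * (normc (F z 0 k))%:C%C) != 0.
  by rewrite E (fmorph_eq0 (real_complex R)) gt_eqF // sum_sqr_gt0.
apply: ccont_near (ccontM num (ccontV den0 den)) _; exists 1 => // w _.
rewrite E -fmorphV /= /sph rmorphM rmorph_sum; congr (_ * _).
by apply: eq_bigr => k _; rewrite rmorph_sum.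
Qed.

(* Zalcman's choice of the centre of rescaling. *)
Lemma zalcman_point F b r r' : 0 < r < r' -> (forall k, holomorphic_on (disc b r') (coord F k)) ->
  (forall z, disc b r' z -> F z != 0) ->
  exists p, normc (p - b) <= r /\ forall w, normc (w - b) <= r ->
    (r - normc (w - b)) * sph F w <= (r - normc (p - b)) * sph F p.
Proof.
move=> /andP[r0 rr] hF F0.
have [|p pr pmax] := @disc_maximum _ (fun w => (r - normc (w - b)) * sph F w) b r (ltW r0).
  move=> z zr; have zr' : disc b r' z by rewrite /disc /=; lra.
  have c1 : ccont (fun w => r%:C%C + (- 1) * (normc (w - b))%:C%C) z.
    apply: ccontD; first exact: ccont_cst.
    by apply: ccontZ; apply: ccont_normc; exact: cdiff_ccont (cdiff_subC b z).
  have c2 := ccontM c1 (ccont_sph (@open_disc _ b r') hF zr' (F0 z zr')).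
  apply: (ccont_near c2).
  by exists 1 => // w _; rewrite mulN1r -rmorphB -rmorphM.
by exists p.
Qed.

End Rescaling.

(** * Local boundedness of the spherical derivatives *)

Section NormalityCriterion.
Context {R : realType} {N : nat}.
Local Notation C := R[i].
Local Notation vec := 'rV[C]_N.+1.
Local Notation q := (2 * N + 1)%N.
Implicit Types (z w b : C) (r e L M : R) (k i : 'I_N.+1) (j l : 'I_q).

Variables (D : set C) (F : nat -> C -> vec) (H : nat -> 'I_q -> C -> vec) (delta : R).
Hypotheses (N0 : (0 < N)%N) (oD : open (D : set C^o)) (delta0 : 0 < delta).
Hypothesis hF : forall n k, holomorphic_on D (coord (F n) k).
Hypothesis F0 : forall n z, D z -> F n z != 0.
Hypothesis hH : forall n l k, holomorphic_on D (coord (H n l) k).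
Hypothesis gH : forall n z, D z -> (forall l, H n l z != 0) /\ delta < hyperplane_prod (fun l => H n l z).
Hypothesis derived_incl : forall n z l, D z -> F n z 0 0 != 0 ->
  pairing (derived_vec (F n) z) (H n l z) = 0 -> pairing (F n z) (H n l z) = 0.
Hypothesis away : forall n z l, D z -> pairing (F n z) (H n l z) = 0 ->
  delta * vnorm (F n z) <= normc (F n z 0 0).
Hypothesis derived_le : forall n z l, D z -> pairing (F n z) (H n l z) = 0 -> forall l',
  normc (pairing (derived_vec (F n) z) (hnormalize (H n l' z))) <= delta^-1 * normc (F n z 0 0) ^+ 2.

Lemma slim_detv (v : nat -> 'I_N.+1 -> vec) (a : 'I_N.+1 -> vec) :
  (forall k m, slim (fun n => v n k 0 m) (a k 0 m)) -> slim (fun n => detv (v n)) (detv a).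
Proof.
move=> va; rewrite /detv /determinant.
apply: (@slim_sum _ _ _ _ (fun (s : 'S_N.+1) (n : nat) => (-1) ^+ s * \prod_m (\matrix_(m, k) v n k 0 m) m (s m))).
move=> s _; apply: slimM; first exact: slim_cst.
apply: (@slim_prod _ _ _ _ (fun (m : 'I_N.+1) (n : nat) => (\matrix_(m, k) v n k 0 m) m (s m))) => m _.
rewrite mxE; apply: (slim_near (va (s m) m)).
by apply: filterS filterT => n _ /=; rewrite mxE.
Qed.

(** When [c k] marks a largest coordinate, division by that coordinate and division by [hnorm]
    differ by a unimodular factor. *)
Lemma normc_detv_chart (v : 'I_N.+1 -> vec) (c : 'I_N.+1 -> 'I_N.+1) :
  (forall k, v k 0 (c k) != 0) -> (forall k m, normc (v k 0 m) <= normc (v k 0 (c k))) ->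
  normc (detv (fun k => \row_m (v k 0 m / v k 0 (c k)))) = normc (detv (fun k => hnormalize (v k))).
Proof.
move=> v0 vc; have -> : detv (fun k => \row_m (v k 0 m / v k 0 (c k))) = detv (fun k => (v k 0 (c k))^-1 *: v k).
  by congr detv; apply: funext => k; apply/rowP => m; rewrite !mxE mulrC.
rewrite detv_scale normcM normc_detv_normalize => [|k]; last first.
  by apply: contraNneq (v0 k) => ->; rewrite mxE.
rewrite normc_prod mulrA -big_split /= big1 ?mul1r // => k _.
by rewrite (hnorm_max (vc k)) normcV mulVf // gt_eqF // normc_gt0.
Qed.

(** The proof is by contradiction: rescaled at Zalcman's points, the maps satisfy the hypotheses of
    [rescaled_limit_degenerate], so their spherical derivatives at 0 tend to 0, although they equal
    1 by construction. *)
Lemma locally_bounded_sph b : D b -> exists r M, [/\ 0 < r, 0 < M & omega [set n |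
  (forall k, holomorphic_on (disc b r) (coord (F n) k)) /\
  forall z, disc b r z -> F n z != 0 /\ sph (F n) z <= M]].
Proof.
move=> Db; have /cnbhsP[r4 r40 r4P] : nbhs (b : C^o) D by exact: open_nbhs_nbhs.
(* The centres [p n] lie in the closed disc of radius [2 r], and discs of radius [2 r] about them
   still lie in [D]. *)
pose r := r4 / 4; have r0 : 0 < r by rewrite divr_gt0.
have r4E : r4 = 4 * r by rewrite /r; field.
have subD : disc b (4 * r) `<=` D by rewrite -r4E.
clearbody r; clear r4 r40 r4P r4E.
apply: contrapT => nb.
have unb M : 0 < M -> omega [set n | exists2 z, disc b r z & M < sph (F n) z].
  move=> M0; have nM : ~ omega [set n | (forall k, holomorphic_on (disc b r) (coord (F n) k)) /\
      forall z, disc b r z -> F n z != 0 /\ sph (F n) z <= M].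
    by move=> h; apply: nb; exists r, M.
  apply: filterS (omegaC nM) => n /= h; apply: contrapT => nz; apply: h.
  have sub : disc b r `<=` D by apply: subset_trans subD; apply: disc_le; lra.
  split=> [k|z zr]; first exact: holomorphic_sub sub (@hF n k).
  split; first by apply: F0; exact: sub.
  by rewrite leNgt; apply/negP => hz; apply: nz; exists z.
have exp n : exists p, normc (p - b) <= 2 * r /\ forall w, normc (w - b) <= 2 * r ->
    (2 * r - normc (w - b)) * sph (F n) w <= (2 * r - normc (p - b)) * sph (F n) p.
  apply: (@zalcman_point _ _ (F n) b (2 * r) (4 * r)); first by apply/andP; split; lra.
    by move=> k; exact: holomorphic_sub subD (@hF n k).
  by move=> z /subD; exact: F0.
have [p pP] := choice exp.
pose s n := sph (F n) (p n); pose t n := 2 * r - normc (p n - b).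
have s_ge0 n : 0 <= s n by exact: sph_ge0.
have t_le n : t n <= 2 * r by rewrite /t lerBlDr lerDl normc_ge0.
have t_ge0 n : 0 <= t n by rewrite /t subr_ge0; exact: (pP n).1.
(* The derivatives are unbounded on the disc of radius [r], where the weight is at least [r]; hence
   the weighted maximum is unbounded. *)
have big M : 0 < M -> omega [set n | M < t n * s n].
  move=> M0; have Mr : 0 < M / r by rewrite divr_gt0.
  apply: filterS (unb _ Mr) => n /= [z zr hz].
  have zr' : normc (z - b) <= 2 * r by move: zr; rewrite /disc /=; lra.
  have h := (pP n).2 z zr'; apply: lt_le_trans h.
  move: hz; rewrite ltr_pdivrMr // => /lt_le_trans; apply.
  rewrite mulrC ler_wpM2r ?sph_ge0 //; move: zr; rewrite /disc /=; lra.
(* The value 1 only keeps [rho] positive for every [n]; by [s_pos] it is not taken on a set of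
   [omega]. *)
pose rho n := if 0 < s n then (s n)^-1 else 1.
have rho0 n : 0 < rho n by rewrite /rho; case: ifP => // h; rewrite invr_gt0.
have s_pos : omega [set n | 0 < s n /\ rho n = (s n)^-1].
  apply: filterS (big 1 ltr01) => n /= h.
  have sn : 0 < s n by rewrite lt_neqAle s_ge0 andbT; apply: contraTneq h => <-; rewrite mulr0 ltr10.
  by rewrite /rho sn.
have rho_t L : 0 < L -> omega [set n | rho n * L < t n / 2].
  move=> L0; have L2 : 0 < 2 * L by rewrite mulr_gt0.
  apply: filterS (filterI s_pos (big _ L2)) => n /= [[sn ->] h].
  rewrite mulrC ltr_pdivrMr //; move: h; rewrite mulrAC; lra.
have rho_lim e : 0 < e -> omega [set n | rho n < e].
  move=> e0; have L0 : 0 < r / e by rewrite divr_gt0.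
  apply: filterS (rho_t _ L0) => n /= h.
  have : rho n * (r / e) < r by have := t_le n; lra.
  by rewrite mulrA ltr_pdivrMr // mulrC ltr_pM2l.
have pD n w : normc w < 2 * r -> D (p n + w).
  move=> wr; apply: subD; rewrite /disc /=; have := (pP n).1.
  by have := ler_normcD (p n - b) w; rewrite addrAC; lra.
have inD (n : nat) L z : disc 0 L z -> rho n * L < t n / 2 -> D (p n + (rho n)%:C%C * z).
  rewrite /disc /= subr0 => zL h; apply: pD; rewrite normcM normcR gtr0_norm //.
  have : rho n * normc z < rho n * L by rewrite ltr_pM2l.
  by have := t_le n; lra.
have dF n k z : D z -> cdiffable (coord (F n) k) z by move=> Dz; apply/cdiffableP; exact: hF.
have pos_le L (L1 := Num.max L 1) : 0 < L1 /\ disc (0 : C) L `<=` disc 0 L1.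
  by split; [rewrite lt_max ltr01 orbT|apply: disc_le; rewrite le_max lexx].
pose g n := rescale (F n) (p n) (rho n).
pose A n l := rescale (H n l) (p n) (rho n).
have hg L : omega [set n | (forall k, holomorphic_on (disc 0 L) (coord (g n) k)) /\
    forall z, disc 0 L z -> g n z != 0 /\ sph (g n) z <= 2].
  have [L10 sL] := pos_le L; move: (Num.max L 1) L10 sL => L1 L10 sL.
  apply: filterS (filterI s_pos (rho_t _ L10)) => n /= [[sn rs] h]; split=> [k z /sL zL|z /sL zL].
    exact: cdiff_derivable (cdiff_rescale (dF n k _ (inD n _ _ zL h))).
  have Dz := inD n _ _ zL h; split; first exact: F0.
  rewrite sph_rescale ?(ltW (rho0 n)) //; last by move=> k; exact: dF.
  have zl : normc ((rho n)%:C%C * z) < t n / 2.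
    rewrite normcM normcR gtr0_norm //; apply: lt_trans h; rewrite ltr_pM2l //.
    by move: zL; rewrite /disc /= subr0.
  have tn : 0 < t n by have := normc_ge0 ((rho n)%:C%C * z); lra.
  have zb : normc (p n + (rho n)%:C%C * z - b) <= 2 * r - t n / 2.
    by have := ler_normcD (p n - b) ((rho n)%:C%C * z); rewrite [p n - b + _]addrAC; rewrite /t in zl *; lra.
  have zb2 : normc (p n + (rho n)%:C%C * z - b) <= 2 * r by lra.
  have := (pP n).2 _ zb2; rewrite -/(t n) -/(s n) => hmax.
  (* At distance less than [t n / 2] from [p n] the weight is at least half of its value at [p n],
     which gives the bound 2 after rescaling. *)
  have : t n / 2 * sph (F n) (p n + (rho n)%:C%C * z) <= t n * s n.
    by apply: le_trans hmax; rewrite ler_wpM2r ?sph_ge0 //; lra.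
  rewrite -mulrA ler_pM2l // .
  move: (sph (F n) (p n + _)) => x hx; rewrite rs mulrC ler_pdivrMr //.
  by move: hx; move: (s n) => y; lra.
have Nq : (N.+1 < q)%N by rewrite mul2n -addnn addn1 ltnS -[X in (X < _)%N]addn0 ltn_add2l.
have r20 : 0 < 2 * r by rewrite mulr_gt0.
have [B [eps [B0 eps0 epsr chart]]] := @hyperplane_chart R N q delta (2 * r) Nq delta0 r20.
have discD n : disc (p n) (2 * r) `<=` D.
  by move=> z zp; have := pD n (z - p n) zp; rewrite addrC subrK.
(* The positions of the largest coefficients at [p n] form an element of a finite type, so they can
   be taken constant along [omega]. *)
have exK n : exists kap : {ffun 'I_q -> 'I_N.+1}, forall l k,
    normc (H n l (p n) 0 k) <= normc (H n l (p n) 0 (kap l)).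
  have ex l : exists k0, forall k, normc (H n l (p n) 0 k) <= normc (H n l (p n) 0 k0).
    have Dp : D (p n) by apply: (discD n); exact: disc0.
    by have [k0 _ h] := row_neq0_max ((gH n Dp).1 l); exists k0.
  by have [f fP] := choice ex; exists [ffun l => f l] => l k; rewrite ffunE.
have [K KP] := choice exK.
have [kap kapP] := omega_finite K.
have hA0 : omega [set n | (forall l k, normc (H n l (p n) 0 k) <= normc (H n l (p n) 0 (kap l))) /\
    forall l z, disc (p n) eps z -> H n l z 0 (kap l) != 0 /\
      forall k, normc (H n l z 0 k) <= B * normc (H n l z 0 (kap l))].
  apply: filterS kapP => n /= Kn; have Hk := KP n; rewrite Kn in Hk.
  split=> // l z zp; apply: (chart (p n) (H n)) => //.
    by move=> j k; exact: holomorphic_sub (discD n) (@hH n j k).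
  by move=> w /discD Dw; exact: gH.
have rho_eps L e : 0 < L -> 0 < e -> omega [set n | rho n * L < e].
  move=> L0 e0; apply: filterS (rho_lim _ (divr_gt0 e0 L0)) => n /=.
  by rewrite ltr_pdivlMr.
have disc_rho (n : nat) L e z : disc 0 L z -> rho n * L < e -> normc ((rho n)%:C%C * z) < e.
  rewrite /disc /= subr0 => zL; apply: lt_trans; rewrite normcM normcR gtr0_norm // ltr_pM2l //.
have hA L : omega [set n | forall l, (forall k, holomorphic_on (disc 0 L) (coord (A n l) k)) /\
    forall z, disc 0 L z -> A n l z 0 (kap l) != 0 /\
      forall k, normc (A n l z 0 k) <= B * normc (A n l z 0 (kap l))].
  have [L10 sL] := pos_le L; move: (Num.max L 1) L10 sL => L1 L10 sL.
  apply: filterS (filterI hA0 (filterI (rho_t _ L10) (rho_eps _ _ L10 eps0))) => n /= [[_ h1] [h2 h3]] l.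
  split=> [k z /sL zL|z /sL zL].
    have dH : cdiffable (coord (H n l) k) (p n + (rho n)%:C%C * z).
      by apply/cdiffableP; apply: hH; exact: inD zL h2.
    exact: cdiff_derivable (cdiff_rescale dH).
  by apply: h1; rewrite /disc /= addrAC subrr add0r; exact: disc_rho zL h3.
have exa l k : exists x, slim (fun n => H n l (p n) 0 k / H n l (p n) 0 (kap l)) x.
  apply: (@omega_limit _ _ B); apply: filterS hA0 => n /= [_ h].
  have [h0 hB] := h l (p n) (disc0 _ eps0).
  by rewrite normc_div ler_pdivrMr ?normc_gt0.
pose a l : vec := \row_k projT1 (cid (exa l k)).
have aP l k : slim (fun n => H n l (p n) 0 k / H n l (p n) 0 (kap l)) (a l 0 k).
  by rewrite mxE; exact: projT2 (cid (exa l k)).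
(* The ratios of the coefficients are Lipschitz with constant [8 B / eps] near [p n], while the
   rescaled disc shrinks to that point: the moving hyperplanes become fixed. *)
have hAcv L l k : ucvg (disc 0 L) (fun n z => A n l z 0 k / A n l z 0 (kap l)) (fun=> a l 0 k).
  have [L10 sL] := pos_le L; apply: (ucvg_sub sL); move: (Num.max L 1) L10 {sL} => L1 L10.
  move=> e e0; have e2 : 0 < e / 2 by rewrite divr_gt0.
  have eps4 : 0 < eps / 4 by rewrite divr_gt0.
  have c0 : 0 < e / 2 / (8 * B / eps) by rewrite !(divr_gt0, mulr_gt0).
  apply: filterS (filterI hA0 (filterI (aP l k _ e2) (filterI (rho_eps _ _ L10 eps4) (rho_eps _ _ L10 c0)))).
  move=> n /= [[_ h1] [h2 [h3 h4]]] z zL.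
  have hr : holomorphic_on (disc (p n) eps) (fun w => H n l w 0 k / H n l w 0 (kap l)).
    have sub : disc (p n) eps `<=` D by apply: subset_trans (discD n); exact: disc_le.
    apply: (holomorphic_ratio (holomorphic_sub sub (@hH n l k)) (holomorphic_sub sub (@hH n l (kap l)))).
    by move=> w /(h1 l)[].
  have [|_ h5 _] := @taylor1 _ (p n) (fun w => H n l w 0 k / H n l w 0 (kap l)) eps B eps0 hr.
    by move=> w /(h1 l)[w0 wB]; rewrite normc_div ler_pdivrMr ?normc_gt0.
  have h6 := disc_rho n _ _ z zL h3; have h7 := disc_rho n _ _ z zL h4.
  have h8 := h5 _ (ltW h6).
  have h9 : 8 * B / eps * normc ((rho n)%:C%C * z) < e / 2.
    by rewrite mulrC -ltr_pdivlMr // !(divr_gt0, mulr_gt0).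
  have := normc_triangle (A n l z 0 k / A n l z 0 (kap l))
    (H n l (p n) 0 k / H n l (p n) 0 (kap l)) (a l 0 k).
  by rewrite /A /rescale; move: h8 h9 h2 => /=; lra.
(* The minors of the normalised coefficients are at least [minor_bound] for each [n], and a positive
   lower bound survives in the limit. *)
have ga : gen_pos a.
  move=> u u_inj; rewrite -normc_gt0; apply: lt_le_trans (@minor_bound_gt0 R N q delta delta0) _.
  have := @slim_detv (fun n k => \row_m (H n (u k) (p n) 0 m / H n (u k) (p n) 0 (kap (u k)))) (fun k => a (u k)).
  move=> sl; apply: (slim_ge (sl _)) => [k m|].
    by apply: (slim_near (aP (u k) m)); apply: filterS filterT => n _ /=; rewrite mxE.
  apply: filterS hA0 => n /= [h1 h2].
  have Dp : D (p n) by apply: (discD n); exact: disc0.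
  have [Hn0 Hprod] := gH n Dp.
  apply: le_trans (detv_ge_minor_bound delta0 Hn0 Hprod u_inj) _.
  rewrite -(@normc_detv_chart (fun k => H n (u k) (p n)) (fun k => kap (u k))) // => k.
  exact: (h2 (u k) (p n) (disc0 _ eps0)).1.
have eqV n L z : disc 0 L z -> rho n * L < t n / 2 ->
    rescaled_derived_vec (rho n) (g n) z = (rho n)%:C%C *: derived_vec (F n) (p n + (rho n)%:C%C * z).
  by move=> zL h; apply: derived_vec_rescale => k; apply: dF; exact: inD zL h.
have lim0 : slim (fun n => (sph (g n) 0)%:C%C) 0.
  apply: (@rescaled_limit_degenerate _ _ g A rho kap a B delta) => // L;
    have [L10 sL] := pos_le L; move: (Num.max L 1) L10 sL => L1 L10 sL;
    apply: filterS (rho_t _ L10) => n /= h z /sL zL l; have Dz := inD n _ _ zL h.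
  - rewrite (eqV n L1) // pairingZ => g0 /eqP; rewrite mulf_eq0 => /orP[|/eqP].
      by rewrite (fmorph_eq0 (real_complex R)) gt_eqF.
    exact: derived_incl.
  - exact: away.
  - move=> Pl l'; rewrite (eqV n L1) // pairingZ normcM normcR gtr0_norm // -mulrA.
    by rewrite ler_pM2l //; exact: (derived_le Dz Pl).
have lim1 : slim (fun n => (sph (g n) 0)%:C%C) 1.
  apply: slim_near (slim_cst 1) _; apply: filterS s_pos => n /= [sn rs].
  have Dp : D (p n) by apply: (discD n); exact: disc0.
  rewrite sph_rescale ?(ltW (rho0 n)) //; last by move=> k; apply: dF; rewrite mulr0 addr0.
  by rewrite mulr0 addr0 rs -/(s n) mulVf ?gt_eqF.
by have /eqP := slim_unique lim0 lim1; rewrite eq_sym oner_eq0.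
Qed.

End NormalityCriterion.

(** * The Fubini-Study distance and normality *)

Section Lines.
Context {R : realType} {N : nat}.
Local Notation C := R[i].
Local Notation vec := 'rV[C]_N.+1.
Local Notation PN := (projspace R N).
Implicit Types (z w : C) (r e d : R) (k i : 'I_N.+1) (u v : vec) (p q : PN).

Lemma vlineZ (x : C) v : x != 0 -> (<[x *: v]> = <[v]>)%VS.
Proof.
move=> x0; apply/eqP; rewrite eqEsubv -!memvE memvZ ?memv_line //=.
by rewrite -[v in v \in _](scalerK x0) memvZ // memv_line.
Qed.

(* The junk value at [0] is the point [1 : 0 : .. : 0]. *)
Definition line_pt_vec v : vec := if v == 0 then delta_mx 0 0 else v.

Lemma dim_line_pt v : (\dim <[line_pt_vec v]>)%VS == 1%N.
Proof.
rewrite dim_vline /line_pt_vec; case: (eqVneq v 0) => [_|v0]; last by rewrite v0.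
rewrite (_ : delta_mx 0 0 != 0) //.
by apply/eqP => /rowP/(_ 0); rewrite !mxE !eqxx => /eqP; rewrite oner_eq0.
Qed.

Definition line_pt v : PN := ProjSpace (dim_line_pt v).

Lemma line_ptE v : v != 0 -> line_of (line_pt v) = <[v]>%VS.
Proof. by move=> v0; rewrite /= /line_pt_vec (negbTE v0). Qed.

Lemma vpick_line p u : line_of p = <[u]>%VS -> u != 0 -> exists2 x : C, x != 0 & vpick p = x *: u.
Proof.
move=> pu u0; have : vpick p \in <[u]>%VS by rewrite -pu memv_pick.
move=> /vlineP[x px]; exists x => //; apply: contraNneq u0 => x0.
have : vpick p == 0 by rewrite px x0 scale0r.
by rewrite vpick0 pu -dimv_eq0 dim_vline; case: (u == 0).
Qed.

Lemma fubini_studyE p q u v : line_of p = <[u]>%VS -> line_of q = <[v]>%VS -> u != 0 -> v != 0 ->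
  fubini_study p q = acos (normc (herm u v) / (vnorm u * vnorm v)).
Proof.
move=> pu qv u0 v0; rewrite /fubini_study.
have [x x0 ->] := vpick_line pu u0; have [y y0 ->] := vpick_line qv v0.
have vZ (c : C) (w : vec) : vnorm (c *: w) = normc c * vnorm w.
  by rewrite /vnorm -/(nsq _) nsqZ sqrtrM ?exprn_ge0 ?normc_ge0 // sqrtr_sqr ger0_norm ?normc_ge0.
rewrite hermZl hermZr !vZ !normcM normcJ; congr acos.
have [x1 y1] : normc x != 0 /\ normc y != 0 by rewrite !gt_eqF ?normc_gt0.
by rewrite mulrA [X in _ / X]mulrACA invfM mulrACA divff ?mul1r // mulf_neq0.
Qed.

(** By [herm_near] the squared cosine of the distance is at least 1 - |u - v|^2 / |u|^2. A cosine in
    [0, 1] is at least its square, so this exceeds cos [e1], and the cosine decreases on [0, pi]. *)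
Lemma fubini_study_lt e : 0 < e -> exists2 c : R, 0 < c & forall p q u v,
  line_of p = <[u]>%VS -> line_of q = <[v]>%VS -> u != 0 -> v != 0 ->
  nsq (u - v) < c * nsq u -> fubini_study p q < e.
Proof.
move=> e0; pose e1 := Num.min e 1.
have e10 : 0 < e1 by rewrite lt_min e0 ltr01.
have [e1e e11] : e1 <= e /\ e1 <= 1 by rewrite !ge_min !lexx orbT.
have e1pi : e1 <= pi by have := pi_ge2 R; lra.
have cos_lt : cos e1 < 1.
  by rewrite -cos0 ltr_cos // in_itv /= ?lexx ?pi_ge0 // (ltW e10).
exists (1 - cos e1); first by rewrite subr_gt0.
move=> p q u v pu qv u0 v0 h; rewrite (fubini_studyE pu qv u0 v0).
have vn (w : vec) : w != 0 -> 0 < vnorm w by move=> w0; rewrite sqrtr_gt0 nsq_gt0.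
have U := vn u u0; have V := vn v v0; set x := _ / _.
have x0 : 0 <= x by rewrite divr_ge0 ?normc_ge0 // mulr_ge0 // ltW.
have x2 : x ^+ 2 = normc (herm u v) ^+ 2 / (nsq u * nsq v) by rewrite expr_div_n exprMn !vnorm_sqr.
have nU := nsq_gt0 u0; have nV := nsq_gt0 v0.
have x1 : x <= 1.
  rewrite -(@ler_pXn2r _ 2%N) ?nnegrE ?ler01 // expr1n x2 ler_pdivrMr ?mulr_gt0 // mul1r.
  exact: herm_le.
have xl : cos e1 < x.
  have h2 : cos e1 < x ^+ 2.
    rewrite x2 ltr_pdivlMr ?mulr_gt0 //; have := herm_near u v.
    have : nsq (u - v) * nsq v < (1 - cos e1) * nsq u * nsq v by rewrite ltr_pM2r.
    by move: (nsq (u - v)) (nsq u) (nsq v) (cos e1) => s t y m; lra.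
  by apply: lt_le_trans h2 _; rewrite expr2 ler_piMl.
have xI : -1 <= x <= 1 by rewrite x1 andbT; lra.
have [/andP[a0 api] ax] := acos_def xI.
apply: lt_le_trans e1e; rewrite -ltr_cos ?in_itv /= ?a0 ?(ltW e10) //.
by rewrite ax.
Qed.

End Lines.

(** * Extraction of a locally uniformly convergent subsequence *)

Section NormalFamily.
Context {R : realType} {N : nat}.
Local Notation C := R[i].
Local Notation vec := 'rV[C]_N.+1.
Local Notation PN := (projspace R N).
Implicit Types (z w : C) (r e d : R) (k i : 'I_N.+1).

Variables (D : set C) (F : nat -> C -> vec) (u : nat -> C -> PN).
Hypotheses (oD : open (D : set C^o)).
Hypothesis repF : forall n, reduced_rep D (F n) (u n).
Hypothesis bF : forall b, D b -> exists r M, [/\ 0 < r, 0 < M & omega [set n |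
  (forall k, holomorphic_on (disc b r) (coord (F n) k)) /\
  forall z, disc b r z -> F n z != 0 /\ sph (F n) z <= M]].

Lemma locally_uniform_limit : exists2 g : C -> PN, holomorphic_map D g &
  forall b e, D b -> 0 < e -> exists2 r, 0 < r &
    omega [set n | forall z, disc b r z -> fubini_study (u n z) (g z) < e].
Proof.
have [G GP] := marty oD bF; exists (fun z => line_pt (G z)).
  move=> b Db; have [r [i [r0 rD Gi _ hcv]]] := GP b Db.
  exists (disc b r), (fun z => (G z 0 i)^-1 *: G z); split=> //; [exact: open_disc|exact: disc0|].
  split=> [k z zr|z zr].
    apply/cdiffableP; apply: (@cdiffable_eq _ (fun w => G w 0 k / G w 0 i)) => [w|].
      by rewrite mxE mulrC.
    by apply/cdiffableP; exact: (hcv k).1.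
  have Gz := Gi z zr; have G0 : G z != 0 by apply: contraNneq Gz => ->; rewrite mxE.
  have Gv : (G z 0 i)^-1 != 0 by rewrite invr_eq0.
  by rewrite scaler_eq0 negb_or Gv G0 line_ptE // vlineZ.
move=> b e Db e0; have [r [i [r0 rD Gi hF hcv]]] := GP b Db; exists r => //.
have [c c0 cP] := @fubini_study_lt R N e e0.
have c1 : 0 < c / N.+1%:R by rewrite divr_gt0 // ltr0n.
(* A bound for each coordinate that is below both 1 and [c / (N+1)], so that [(N+1) m^2 < c]. *)
pose m := c / N.+1%:R / (1 + c / N.+1%:R).
have m0 : 0 < m by rewrite divr_gt0 // ltr_wpDl.
have mE : N.+1%:R * m ^+ 2 < c.
  rewrite mulrC -ltr_pdivlMr ?ltr0n //.
  have [m1 m2] : m < 1 /\ m < c / N.+1%:R.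
    rewrite /m; move: (c / N.+1%:R) c1 => y y0; have y1 : 0 < 1 + y by lra.
    by rewrite !ltr_pdivrMr // mul1r ltr_pMr //; split; lra.
  by apply: le_lt_trans m2; rewrite expr2 ler_piMl ?ltW.
have cvm : omega [set n | forall k z, disc b r z -> normc (F n z 0 k / F n z 0 i - G z 0 k / G z 0 i) < m].
  exact: (@filter_forall nat _ (fun k n => forall z, disc b r z ->
    normc (F n z 0 k / F n z 0 i - G z 0 k / G z 0 i) < m) omega _ (fun k => (hcv k).2 _ m0)).
apply: filterS (filterI hF cvm) => n /= [[_ h1] h2] z zr.
have [Fi _] := h1 z zr; have Gz := Gi z zr; have Dz := rD z zr.
have [F0 uF] := (repF n).2 z Dz.
have G0 : G z != 0 by apply: contraNneq Gz => ->; rewrite mxE.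
have Fv : (F n z 0 i)^-1 != 0 by rewrite invr_eq0.
have Gv : (G z 0 i)^-1 != 0 by rewrite invr_eq0.
apply: (cP _ _ ((F n z 0 i)^-1 *: F n z) ((G z 0 i)^-1 *: G z)).
- by rewrite vlineZ.
- by rewrite line_ptE // vlineZ.
- by rewrite scaler_eq0 negb_or Fv.
- by rewrite scaler_eq0 negb_or Gv.
have n1 : 1 <= nsq ((F n z 0 i)^-1 *: F n z).
  by apply: le_trans (nsq_ge _ i); rewrite mxE mulVf // normc1 expr1n.
apply: lt_le_trans (_ : c * 1 <= _); last by rewrite ler_pM2l.
rewrite mulr1; apply: le_lt_trans mE.
have -> : N.+1%:R * m ^+ 2 = \sum_(k < N.+1) m ^+ 2 by rewrite sumr_const card_ord mulr_natl.
apply: ler_sum => k _; rewrite !mxE ler_pXn2r ?nnegrE ?normc_ge0 ?(ltW m0) //.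
by rewrite ![_^-1 * _]mulrC ltW // h2.
Qed.

(** The usual exhaustion by bounded sets at distance at least [1 / (m+1)] from the complement of
    [D]. *)
Definition exhaustion (m : nat) : set C :=
  [set z | normc z <= m%:R /\ disc z m.+1%:R^-1 `<=` D].

Lemma exhaustion_le (m n : nat) : (m <= n)%N -> exhaustion m `<=` exhaustion n.
Proof.
move=> mn z [zm zD]; split; first by apply: le_trans zm _; rewrite ler_nat.
by apply: subset_trans zD; apply: disc_le; rewrite lef_pV2 ?posrE ?ltr0n // ler_nat.
Qed.

(** Otherwise points [x m] of [K] outside the [m]-th set would cluster along [omega] at a point of
    [K], near which a disc in [D] puts [x n] into the [n]-th set for large [n]. *)
Lemma compact_exhaustion (K : set C) : compact (K : set C^o) -> K `<=` D -> exists m, K `<=` exhaustion m.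
Proof.
move=> cK KD; apply: contrapT => /forallNP nK.
have ex m : exists z, K z /\ ~ exhaustion m z.
  by apply: contrapT => /forallNP h; apply: (nK m) => z Kz; apply: contrapT => nz; apply: (h z).
have [x xP] := choice ex.
have [z [Kz zcl]] : (K : set C^o) `&` cluster (x @ omega : set_system C^o) !=set0.
  have xK : omega [set n | K (x n)] by apply: filterS filterT => n _ /=; exact: (xP n).1.
  exact: (cK _ _ xK).
have /cnbhsP[d d0 dD] : nbhs (z : C^o) D by apply: open_nbhs_nbhs; split => //; exact: KD.
have m0 : 0 < Num.min d 1 / 2 by rewrite divr_gt0 // lt_min d0 ltr01.
have [md m1] : Num.min d 1 <= d /\ Num.min d 1 <= 1 by rewrite !ge_min !lexx orbT.
pose A := [set n | n.+1%:R^-1 < Num.min d 1 / 2 /\ normc z + 1 <= n%:R].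
have oA : omega A.
  apply: filterI; first exact: omega_small.
  apply: filterS (omega_geq (Num.truncn (normc z + 1)).+1) => n /= h.
  by apply: ltW; apply: lt_le_trans (truncnS_gt _) _; rewrite ler_nat.
have [_ [[n [h1 h2] <-] xd]] : x @` A `&` disc z (Num.min d 1 / 2) !=set0.
  apply: zcl; last by apply/cnbhsP; exists (Num.min d 1 / 2).
  by apply: filterS oA => n An; exists n.
apply: (xP n).2; rewrite /disc /= in xd; split.
  by have := ler_normc_sub (x n) z; lra.
apply: subset_trans dD; apply: disc_sub; rewrite /=; move: (n.+1%:R^-1) h1 => y h1; lra.
Qed.

(** Points where the distance is at least [e] would have a limit along [omega]. It lies in [D],
    because discs of the fixed radius [1 / (m+1)] about these points do, and local uniformity there
    is contradicted. *)
Lemma exhaustion_uniform (g : C -> PN) (m : nat) e : 0 < e ->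
  (forall b e, D b -> 0 < e -> exists2 r, 0 < r &
    omega [set n | forall z, disc b r z -> fubini_study (u n z) (g z) < e]) ->
  omega [set n | forall z, exhaustion m z -> fubini_study (u n z) (g z) < e].
Proof.
move=> e0 H; apply: contrapT => /omegaC nE.
have ex n : exists z, (exists w, exhaustion m w /\ e <= fubini_study (u n w) (g w)) ->
    exhaustion m z /\ e <= fubini_study (u n z) (g z).
  have [[w h]|nw] := pselect (exists w, exhaustion m w /\ e <= fubini_study (u n w) (g w)).
    by exists w.
  by exists 0.
have [x xP] := choice ex.
have xE : omega [set n | exhaustion m (x n) /\ e <= fubini_study (u n (x n)) (g (x n))].
  apply: filterS nE => n /= h; apply: xP; apply: contrapT => /forallNP nw; apply: h => z Ez.
  by rewrite ltNge; apply/negP => ez; apply: (nw z).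
have [z xz] : exists z, slim x z.
  by apply: (@omega_limit _ x m%:R); apply: filterS xE => n /= [[h _] _].
have m1 : 0 < m.+1%:R^-1 :> R by rewrite invr_gt0.
have Dz : D z.
  have [n [/= [[_ h] _] xd]] := omega_neq0 (filterI xE (xz _ m1)).
  by apply: h; rewrite /disc /= normcBC.
have [r r0 hr] := H z e Dz e0.
have [n [/= [_ h1] [xr h2]]] := omega_neq0 (filterI xE (filterI (xz _ r0) hr)).
by have := h2 _ xr; rewrite ltNge h1.
Qed.

(** Here the ultrafilter is traded for a subsequence: the indices good on [exhaustion m] up to
    [1 / (m+1)] form a set of [omega], which meets every tail, so they can be picked
    increasingly. *)
Lemma convergent_subsequence : exists (phi : nat -> nat) (g : C -> PN),
  [/\ {homo phi : m n / (m < n)%N}, holomorphic_map D g & cvg_locally_uniformly D (u \o phi) g].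
Proof.
have [g hg gP] := locally_uniform_limit.
pose good m := [set n | forall z, exhaustion m z -> fubini_study (u n z) (g z) < m.+1%:R^-1].
have ex (mk : nat * nat) : exists n, good mk.1 n /\ (mk.2 < n)%N.
  have e0 : 0 < mk.1.+1%:R^-1 :> R by rewrite invr_gt0.
  have [n [h1 h2]] := omega_neq0 (filterI (exhaustion_uniform mk.1 e0 gP) (omega_geq mk.2.+1)).
  by exists n.
have [pick pickP] := choice ex.
pose phi := fix phi m := if m is m'.+1 then pick (m, phi m') else pick (0%N, 0%N).
have phiP m : good m (phi m) by case: m => [|m]; [exact: (pickP (0%N, 0%N)).1|exact: (pickP (m.+1, phi m)).1].
exists phi, g; split=> //.
  apply: homo_ltn => [y x z|m]; first exact: ltn_trans.
  exact: (pickP (m.+1, phi m)).2.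
move=> K cK KD e e0; have [m0 Km] := compact_exhaustion cK KD.
near=> n => z Kz.
have mn : (m0 <= n)%N by near: n; exact: nbhs_infty_ge.
apply: lt_trans (phiP n z (exhaustion_le mn (Km z Kz))) _.
by near: n; exact: near_infty_natSinv_lt (PosNum e0).
Unshelve. all: by end_near. Qed.

End NormalFamily.

Theorem theorem2p1 (R : realType) (N : nat) (N_ge1 : (1 <= N)%N)
  (D : set R[i]) (domD : cdomain D)
  (Fam : set (R[i] -> projspace R N))
  (holFam : forall f, Fam f -> holomorphic_map D f)
  (rep : (R[i] -> projspace R N) -> R[i] -> 'rV[R[i]]_N.+1)
  (repP : forall f, Fam f -> reduced_rep D (rep f) f)
  (rep0 : forall f, Fam f -> exists2 z, D z & rep f z 0 0 != 0)
  (nabla : (R[i] -> projspace R N) -> R[i] -> projspace R N)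
  (nablaP : forall f, Fam f -> derived_map D (rep f) (nabla f))
  (delta : R) (delta_gt0 : 0 < delta) (delta_lt1 : delta < 1) :
  (forall f, Fam f ->
    exists H : 'I_(2 * N + 1) -> R[i] -> 'rV[R[i]]_N.+1,
      (forall j, moving_hyperplane D (H j)) /\
      (forall z, D z ->
        [/\ general_position (fun j => H j z) /\
            delta < hyperplane_prod (fun j => H j z),
            forall j, hyperplane (H j z) (nabla f z) ->
              hyperplane (H j z) (f z),
            (\bigcup_j hyperplane (H j z)) (f z) ->
              delta <= normc (pairing (rep f z) H0)
                         / (vnorm (rep f z) * hnorm (@H0 R N)) &
            (\bigcup_j hyperplane (H j z)) (f z) ->
              forall k,
                normc (pairing (derived_vec (rep f) z) (hnormalize (H k z)))
                  / normc (rep f z 0 0) ^+ 2 <= delta^-1])) ->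
  normal_family D Fam.
Proof.
case: domD => _ oD _ HFam u Fu.
have [H HP] := choice (fun n => HFam (u n) (Fu n)).
pose F n := rep (u n); pose Rep n := repP _ (Fu n).
have F0 n z : D z -> F n z != 0 by move=> Dz; exact: ((Rep n).2 z Dz).1.
have inH n z l : D z -> pairing (F n z) (H n l z) = 0 <-> hyperplane (H n l z) (u n z).
  move=> Dz; have [_ uE] := (Rep n).2 z Dz; split=> [Fz w|]; last by apply; rewrite uE memv_line.
  by rewrite uE => /vlineP[x ->]; rewrite pairingZ Fz mulr0.
have H0E (v : 'rV[R[i]]_N.+1) : pairing v H0 = v 0 0.
  rewrite /pairing (bigD1 0) //= big1 ?addr0 => [|k k0]; first by rewrite mxE !eqxx mul1r.
  by rewrite mxE (negbTE k0) andbF mul0r.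
have hH0 : hnorm (@H0 R N) = 1.
  rewrite (@hnorm_max _ _ _ 0) => [|k]; rewrite !mxE !eqxx ?normc1 //=.
  by case: eqP => _; rewrite ?normc1 ?normc0 ?ler01.
have away n z l : D z -> pairing (F n z) (H n l z) = 0 -> delta * vnorm (F n z) <= normc (F n z 0 0).
  move=> Dz /(inH n z l Dz) Hz; have [_ /(_ z Dz)[_ _ /(_ _) h _]] := HP n.
  have := h (ex_intro2 _ _ l I Hz); rewrite H0E hH0 mulr1 ler_pdivlMr //.
  by rewrite sqrtr_gt0; apply: nsq_gt0; exact: F0.
apply: (@convergent_subsequence _ _ D F u oD Rep) => b Db.
apply: (@locally_bounded_sph _ _ D F H delta N_ge1 oD delta_gt0 _ F0 _ _ _ away _ b Db).
- by move=> n k; exact: (Rep n).1.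
- by move=> n l k; exact: ((HP n).1 l).1.
- by move=> n z Dz; have [mov /(_ z Dz)[[_ h] _ _ _]] := HP n; split=> // l; exact: (mov l).2.
- move=> n z l Dz Fz Vz; have [_ /(_ z Dz)[_ h _ _]] := HP n.
  apply/(inH n z l Dz); apply: h => w.
  have [d [G [_ [_ GP] dG]]] := nablaP _ (Fu n); have [_ ->] := GP z Dz.
  (* The coordinate 0 of [derived_vec] is the square of [f_0], nonzero here, so [d] does not vanish
     and the vector spans the line of [nabla]. Where [f_0] vanishes, the vector itself may vanish;
     this is why the criterion asks for the inclusion only elsewhere. *)
  have d0 : d z != 0.
    apply: contraNneq Fz => dz; have /rowP/(_ 0) := dG z Dz.
    by rewrite dz scale0r !mxE eqxx => /eqP; rewrite expf_eq0.
  move=> /vlineP[x ->]; move: Vz; rewrite dG // !pairingZ => /eqP.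
  by rewrite mulf_eq0 (negbTE d0) => /eqP ->; rewrite mulr0.
- move=> n z l Dz Pz l'; have [_ /(_ z Dz)[_ _ _ h]] := HP n.
  have /(_ l') := h (ex_intro2 _ _ l I (proj1 (inH n z l Dz) Pz)).
  (* By (ii), [f_0] does not vanish at a point where [f] meets one of the hyperplanes, so the
     denominator of (iii) can be cleared. *)
  rewrite ler_pdivrMr // exprn_gt0 //; apply: lt_le_trans (away n z l Dz Pz).
  by rewrite mulr_gt0 // sqrtr_gt0; apply: nsq_gt0; exact: F0.
Qed.
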